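(* Let $X$ and $Y$ be respectively a separable and a reflexive Banach space, and let $L^p(\Omega,\mathcal F_T,\mathbb P)$, with $1\le p<\infty$, be separable. Let $1\le p_1,p_2<\infty$ and $1<q_1,q_2<\infty$. Assume that $\{\mathcal G_n\}_{n=1}^\infty$ is a sequence of uniformly bounded, pointwisely defined linear operators from $L^{p_1}_{\mathbb F}(0,T;L^{p_2}(\Omega;X))$ to $L^{q_1}_{\mathbb F}(0,T;L^{q_2}(\Omega;Y))$. Then there exist a subsequence $\{\mathcal G_{n_k}\}_{k=1}^\infty\subset\{\mathcal G_n\}_{n=1}^\infty$ and a $\mathcal G\in\mathcal L_{pd}\big(L^{p_1}_{\mathbb F}(0,T;L^{p_2}(\Omega;X)),L^{q_1}_{\mathbb F}(0,T;L^{q_2}(\Omega;Y))\big)$ such that, for all $u(\cdot)\in L^{p_1}_{\mathbb F}(0,T;L^{p_2}(\Omega;X))$, $$\mathcal G_{n_k}u(\cdot)\to\mathcal Gu(\cdot)\ \text{ weakly in }L^{q_1}_{\mathbb F}(0,T;L^{q_2}(\Omega;Y))\text{ as }k\to\infty.$$ Moreover, $\|\mathcal G\|\le\sup_{n\in\mathbb N}\|\mathcal G_n\|$, all norms being taken in $\mathcal L\big(L^{p_1}_{\mathbb F}(0,T;L^{p_2}(\Omega;X)),L^{q_1}_{\mathbb F}(0,T;L^{q_2}(\Omega;Y))\big)$.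
   Context: $(\Omega,\mathcal F,\mathbb F,\mathbb P)$ is a complete filtered probability space with filtration $\mathbb F=\{\mathcal F_t\}_{t\ge0}$; $T>0$. For a Banach space $X$, $L^{r_2}_{\mathbb F}(0,T;L^{r_1}(\Omega;X))$ is the Banach space of $\mathbb F$-adapted $X$-valued processes $\varphi$ on $(0,T)\times\Omega$ with $\int_0^T(\mathbb E|\varphi(t)|_X^{r_1})^{r_2/r_1}dt<\infty$, with the canonical norm. $\mathcal L(X,Y)$ is the space of bounded linear operators from $X$ to $Y$. A bounded linear operator $\mathcal T$ from $L^{r_1}_{\mathbb F}(0,T;L^{r_2}(\Omega;X))$ to $L^{r_3}_{\mathbb F}(0,T;L^{r_4}(\Omega;Y))$ is called pointwisely defined if for a.e. $(t,\omega)\in(0,T)\times\Omega$ there exists $L(t,\omega)\in\mathcal L(X,Y)$ with $(\mathcal Tu(\cdot))(t,\omega)=L(t,\omega)u(t,\omega)$ for all $u(\cdot)\in L^{r_1}_{\mathbb F}(0,T;L^{r_2}(\Omega;X))$; the vector space of all such operators is denoted $\mathcal L_{pd}\big(L^{r_1}_{\mathbb F}(0,T;L^{r_2}(\Omega;X)),L^{r_3}_{\mathbb F}(0,T;L^{r_4}(\Omega;Y))\big)$. *)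

(* Defs.v *)
From HB Require Import structures.
From mathcomp Require Import all_boot all_order all_algebra.
From mathcomp Require Import all_classical all_reals all_analysis.

Set Implicit Arguments.
Unset Strict Implicit.
Unset Printing Implicit Defensive.

Import Order.TTheory GRing.Theory Num.Theory.
Import numFieldNormedType.Exports.

Local Open Scope classical_set_scope.
Local Open Scope ring_scope.

(** All Banach spaces are real: [completeNormedModType R] with [R : realType]. *)

Section banach.
Context {R : realType}.

Definition separable (X : topologicalType) : Prop :=
  exists2 D : set X, countable D & dense D.

Definition in_dual (Y : normedModType R) (f : Y -> R) : Prop :=
  linear (f : Y -> R^o) /\ continuous f.

Definition dual_norm (Y : normedModType R) (f : Y -> R) : R :=
  sup [set `|f y| | y in [set y : Y | `|y| <= 1]].

(** Surjectivity of the canonical embedding of [Y] into its bidual. An element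
    of the bidual is a map [Phi], meaningful only on [in_dual Y], that is linear
    there and bounded with respect to the dual norm. *)
Definition reflexive_space (Y : normedModType R) : Prop :=
  forall Phi : (Y -> R) -> R,
    (forall (a : R) (f g : Y -> R), in_dual f -> in_dual g ->
       Phi (fun y => a * f y + g y) = a * Phi f + Phi g) ->
    (exists C : R, forall f, in_dual f -> `|Phi f| <= C * dual_norm f) ->
    exists y : Y, forall f, in_dual f -> Phi f = f y.

End banach.

Section strong_measurability.
Variables (U : Type) (V : topologicalType).

Definition simple_on (S : set_system U) (D : set U) (s : U -> V) : Prop :=
  finite_set (s @` D) /\ forall v, S (D `&` s @^-1` [set v]).

(** Pointwise limit on [D] of [S]-simple functions; for a separable target this
    is Borel measurability, in general it is the measurability of Bochner
    integration theory. *)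
Definition strongly_measurable (S : set_system U) (D : set U) (f : U -> V) :
    Prop :=
  exists s : nat -> U -> V, (forall n, simple_on S D (s n)) /\
    forall x, D x -> s n x @[n --> \oo] --> f x.

End strong_measurability.

Section filtered_space.
Context {R : realType} {d : measure_display} {Omega : measurableType d}.
Variable P : probability Omega R.
Implicit Types (F : R -> set_system Omega) (S : set_system Omega).

(** The filtration is indexed by [R], but only its values at [t >= 0] matter.
    Right-continuity is not required. *)
Record complete_filtration F : Prop := CompleteFiltration {
  filtration_sigma_algebra :
    forall t : R, 0 <= t -> sigma_algebra [set: Omega] (F t);
  filtration_measurable : forall t : R, 0 <= t -> F t `<=` measurable;
  filtration_homo : forall s t : R, 0 <= s -> s <= t -> F s `<=` F t;
  filtration_complete : measure_is_complete P;
  filtration_null : P.-negligible `<=` F 0 }.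

Definition in_Lp S (p : R) (f : Omega -> R) : Prop :=
  (forall B : set R, measurable B -> S (f @^-1` B)) /\
  ('N[P]_(p%:E)[EFin \o f] < +oo)%E.

(** Separability of the real space L^p(Omega, S, P), tested on
    representatives. *)
Definition separable_Lp S (p : R) : Prop :=
  exists2 D : set (Omega -> R), countable D & D `<=` in_Lp S p /\
    forall f, in_Lp S p f -> forall e : R, 0 < e ->
      exists2 g, D g & ('N[P]_(p%:E)[EFin \o (f \- g)%R] < e%:E)%E.

End filtered_space.

(** L^r_F(0,T; L^s(Omega; X)) is handled through representatives: processes
    [u : R -> Omega -> X], of which only the values at [0 < t < T] matter, up to
    equality a.e. for dt x P. *)
Section processes.
Context {R : realType} {d : measure_display} {Omega : measurableType d}.
Variables (P : probability Omega R) (F : R -> set_system Omega) (T : R).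

Definition ae_prod (Q : R -> Omega -> Prop) : Prop :=
  {ae (@lebesgue_measure R \x P)%E,
    forall z : R * Omega, 0 < z.1 < T -> Q z.1 z.2}.

Section space.
Variable X : normedModType R.

Definition ae_eq_process (u v : R -> Omega -> X) : Prop :=
  ae_prod (fun t w => u t w = v t w).

Definition adapted_process (u : R -> Omega -> X) : Prop :=
  strongly_measurable (@measurable _ (measurableTypeR R * Omega)%type)
    (`]0, T[%classic `*` [set: Omega]) (fun z => u z.1 z.2) /\
  forall t : R, 0 < t < T -> strongly_measurable (F t) [set: Omega] (u t).

(** [(\int_0^T (E |u t|^s)^(r/s) dt)^(1/r)]; the inner [Lnorm] is
    [(E |u t|^s)^(1/s)]. *)
Definition process_norm (r s : R) (u : R -> Omega -> X) : \bar R :=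
  ((\int[lebesgue_measure]_(t in `]0%R, T[)
      (Lnorm P s%:E (fun w => `|u t w|%:E)) `^ r) `^ r^-1)%E.

Definition in_LF (r s : R) (u : R -> Omega -> X) : Prop :=
  adapted_process u /\ (process_norm r s u < +oo)%E.

(** Elements of the topological dual of the space of processes; boundedness
    makes [Lam] constant on a.e. classes. *)
Definition LF_dual (r s : R) (Lam : (R -> Omega -> X) -> R) : Prop :=
  (forall (a : R) (u v : R -> Omega -> X), in_LF r s u -> in_LF r s v ->
     Lam (fun t w => a *: u t w + v t w) = a * Lam u + Lam v) /\
  exists C : R, forall u, in_LF r s u ->
    (`|Lam u|%:E <= C%:E * process_norm r s u)%E.

Definition LF_weak_cvg (r s : R) (v_ : nat -> R -> Omega -> X)
    (v : R -> Omega -> X) : Prop :=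
  forall Lam, LF_dual r s Lam -> Lam (v_ k) @[k --> \oo] --> Lam v.

End space.

Section operators.
Variables (X Y : normedModType R) (p1 p2 q1 q2 : R).
Implicit Type G : (R -> Omega -> X) -> R -> Omega -> Y.

(** A bounded linear operator between the spaces of classes, given by its action
    on representatives. *)
Record LF_bounded_operator G : Prop := LFBoundedOperator {
  LF_operator_in : forall u, in_LF p1 p2 u -> in_LF q1 q2 (G u);
  LF_operator_ae : forall u v, in_LF p1 p2 u -> in_LF p1 p2 v ->
    ae_eq_process u v -> ae_eq_process (G u) (G v);
  LF_operator_linear : forall (a : R) u v, in_LF p1 p2 u -> in_LF p1 p2 v ->
    ae_eq_process (G (fun t w => a *: u t w + v t w))
                  (fun t w => a *: G u t w + G v t w);
  LF_operator_bounded : exists C : R, forall u, in_LF p1 p2 u ->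
    (process_norm q1 q2 (G u) <= C%:E * process_norm p1 p2 u)%E }.

Definition LF_opnorm G : \bar R :=
  ereal_sup [set process_norm q1 q2 (G u) |
    u in [set u | in_LF p1 p2 u /\ (process_norm p1 p2 u <= 1)%E]].

(** Since [u] and [G u] are only determined up to a.e. equality, the exceptional
    null set of (t, omega) may depend on [u], while the family [L] does not;
    [L t w] can be taken to be 0 at the points where the operator is not
    specified. *)
Definition pointwise_defined G : Prop :=
  exists2 L : R -> Omega -> {linear X -> Y},
    forall t w, continuous (L t w) &
    forall u, in_LF p1 p2 u -> ae_prod (fun t w => G u t w = L t w (u t w)).

Definition L_pd G : Prop := LF_bounded_operator G /\ pointwise_defined G.

End operators.
End processes.

(* Main.v *)
Require Import Defs.
From HB Require Import structures.
From mathcomp Require Import all_boot all_order all_algebra.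
From mathcomp Require Import all_classical all_reals all_analysis.
From mathcomp Require Import measurable_realfun ring lra.

Set Implicit Arguments.
Unset Strict Implicit.
Unset Printing Implicit Defensive.

Import Order.TTheory GRing.Theory Num.Theory.
Import numFieldNormedType.Exports.

Local Open Scope classical_set_scope.
Local Open Scope ring_scope.

(** A process extended by 0 outside (0, T) is a function on the product of the time
    axis and [Omega]. For the sigma-algebra [adapted_sets], whose sets are measurable
    in the product and have their sections at times of (0, T) in the filtration, joint
    measurability and adaptedness become one condition: the spaces of processes are
    spaces of Bochner measurable functions for a finite measure, normed by a mixed
    norm. The properties of mixed norms that matter are collected in [function_norm],
    for the space of [X]-valued functions, and [reflexive_norm], for the one of
    [Y]-valued functions. The theorem is a case of [pointwise_weak_compactness].

    Let [x] be a dense sequence of [X]. The images of the constant functions [x i]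
    under all the operators take their values in the closed span of a sequence [y] of
    [Y]. By reflexivity the dual of this span is separable:
    [reflexive_norming_family] provides countably many functionals [g s], norming on
    the span, with rational combinations that are dense in its dual. The real
    functions [g s (G_ n (x i))] are bounded in the mixed norm as [n] varies, hence
    uniformly integrable, because functionals are order continuous for exponents
    greater than 1 ([dual_order_continuous]). Along one subsequence all of them
    converge weakly, to functions [beta (i, s)] ([weak_compactness]).

    At almost every point [z] the numbers [beta (i, s) z] are the values of a bounded
    bilinear form at [x i] and [g s]. Here it matters that the operators are defined
    pointwise: a maximum over finitely many indices is attained at a measurable
    index, and the operator commutes with the selection of constants by this index,
    so that the integral of the maximum is bounded independently of the number of
    indices ([form_bounded]). By reflexivity again, the form comes from an operator
    [L z] from [X] to [Y] ([nf_operator]). The function [L z (u z)] is strongly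
    measurable by Pettis's criterion, and its norm is bounded as wanted because the
    mixed norm is lower semicontinuous, being determined by duality with bounded
    functions ([limit_bound]).

    Weak convergence has to be shown against all functionals on the space of
    [Y]-valued functions. Such a functional has real densities at the vectors of [y],
    which make up a bounded form at almost every point; so off a set where the
    functional is uniformly small it is close to one that is built from finitely many
    combinations of the [g s], and against those convergence holds by construction
    ([bdual_weak_cvg]).

    That mixed norms have the required properties is [mixed_reflexive_norm]. The
    completeness of the filtration is what turns the null sets of the product, on which
    the pointwise formulas for the operators may fail, into null sets of the adapted
    sigma-algebra ([ae_prod_adapted]). *)

(** * The Hahn-Banach theorem with rational coefficients *)

Section hahn_banach.
Context {R : realType} {V : lmodType R}.
Implicit Types W : V -> Prop.

Definition submodule W := forall (a : R) v w, W v -> W w -> W (a *: v + w).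

Definition linear_in W (f : V -> R) := forall (a : R) v w, W v -> W w ->
  f (a *: v + w) = a * f v + f w.

Definition sublinear_in W (q : V -> R) :=
  (forall v w, W v -> W w -> q (v + w) <= q v + q w) /\
  (forall c v, 0 < c -> W v -> q (c *: v) = c * q v).

Lemma submodule0 W v : submodule W -> W v -> W 0.
Proof. by move=> sW Wv; move: (sW (-1) _ _ Wv Wv); rewrite scaleN1r addNr. Qed.

Lemma submoduleD W v w : submodule W -> W v -> W w -> W (v + w).
Proof. by move=> sW Wv Ww; move: (sW 1 _ _ Wv Ww); rewrite scale1r. Qed.

Lemma submoduleZ W a v : submodule W -> W v -> W (a *: v).
Proof.
by move=> sW Wv; rewrite -[_ *: _]addr0; apply: (sW) => //; exact: (submodule0 sW Wv).
Qed.

Lemma submoduleN W v : submodule W -> W v -> W (- v).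
Proof. by move=> sW Wv; rewrite -scaleN1r; exact: submoduleZ. Qed.

Lemma submoduleB W v w : submodule W -> W v -> W w -> W (v - w).
Proof. by move=> sW Wv Ww; apply: submoduleD => //; exact: submoduleN. Qed.

Section minimal.
Variables (W : V -> Prop).
Hypothesis sW : submodule W.

Lemma sublinear_in0 q v : sublinear_in W q -> W v -> q 0 = 0.
Proof.
move=> [_ qZ] Wv; have W0 := submodule0 sW Wv.
by have := qZ 2 0 (ltr0n _ 2) W0; rewrite scaler0 => h; lra.
Qed.

Lemma sublinear_inN q v : sublinear_in W q -> W v -> - q (- v) <= q v.
Proof.
move=> sq Wv; have q0 := sublinear_in0 sq Wv.
have := sq.1 v (- v) Wv (submoduleN sW Wv).
by rewrite subrr q0 => h; lra.
Qed.

(** The smallest value of [q] on the ray from [v] directed by [w], the growth [t * q w]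
    being subtracted. It is sublinear and below [q], so that it is equal to a minimal
    [q]. *)
Let along (q : V -> R) w v := inf [set q (v + t *: w) - t * q w | t in [set t | 0 <= t]].

Let along_lb q w v : sublinear_in W q -> W v -> W w ->
  lbound [set q (v + t *: w) - t * q w | t in [set t | 0 <= t]] (- q (- v)).
Proof.
move=> sq Wv Ww _ [t /= t0 <-].
have [->|tn0] := eqVneq t 0.
  by rewrite scale0r addr0 mul0r subr0; exact: sublinear_inN.
have tp : 0 < t by rewrite lt_neqAle eq_sym tn0.
have Wvt : W (v + t *: w) by apply: submoduleD => //; exact: submoduleZ.
have := sq.1 _ _ Wvt (submoduleN sW Wv).
by rewrite addrAC subrr add0r sq.2// => h; lra.
Qed.

Let along_le q w v t : sublinear_in W q -> W v -> W w -> 0 <= t ->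
  along q w v <= q (v + t *: w) - t * q w.
Proof.
move=> sq Wv Ww t0; apply: ge_inf; last by exists t.
by exists (- q (- v)); exact: along_lb.
Qed.

Let along_ge q w v r : sublinear_in W q -> W v -> W w ->
  (forall t, 0 <= t -> r <= q (v + t *: w) - t * q w) -> r <= along q w v.
Proof.
move=> sq Wv Ww h; apply: lb_le_inf.
  by exists (q (v + 0 *: w) - 0 * q w); exists 0 => //=.
by move=> _ [t /= t0 <-]; exact: h.
Qed.

Let along_sublinear q w : sublinear_in W q -> W w -> sublinear_in W (along q w).
Proof.
move=> sq Ww; split.
  move=> v v' Wv Wv'.
  have key t t' : 0 <= t -> 0 <= t' -> along q w (v + v') <=
      (q (v + t *: w) - t * q w) + (q (v' + t' *: w) - t' * q w).
    move=> t0 t'0.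
    have Wt : W (v + t *: w) by apply: submoduleD => //; exact: submoduleZ.
    have Wt' : W (v' + t' *: w) by apply: submoduleD => //; exact: submoduleZ.
    apply: le_trans (along_le sq (submoduleD sW Wv Wv') Ww (addr_ge0 t0 t'0)) _.
    have := sq.1 _ _ Wt Wt'; rewrite addrACA -scalerDl => h; lra.
  rewrite -lerBlDr; apply: along_ge => // t t0.
  rewrite lerBlDr -lerBlDl; apply: along_ge => // t' t'0.
  by rewrite lerBlDl; exact: key.
move=> c v c0 Wv; have Wcv := submoduleZ c sW Wv.
apply/eqP; rewrite eq_le; apply/andP; split.
  rewrite mulrC -ler_pdivrMr//; apply: along_ge => // t t0.
  rewrite ler_pdivrMr// mulrC.
  have Wt : W (v + t *: w) by apply: submoduleD => //; exact: submoduleZ.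
  apply: le_trans (along_le sq Wcv Ww (mulr_ge0 (ltW c0) t0)) _.
  by rewrite -scalerA -scalerDr sq.2// mulrBr mulrA.
apply: along_ge => // t t0.
have tc0 : 0 <= t / c by rewrite divr_ge0// ltW.
have := along_le sq Wv Ww tc0.
have Wt : W (v + (t / c) *: w) by apply: submoduleD => //; exact: submoduleZ.
rewrite -(ler_pM2l c0) => /le_trans; apply.
rewrite mulrBr -(sq.2 _ _ c0 Wt) scalerDr scalerA mulrCA mulfV ?gt_eqF// mulr1 mulrA.
by rewrite mulrCA mulfV ?gt_eqF// mulr1.
Qed.

(** Minimality gives [q <= along q w]; at the parameter 1 of the ray this is the
    superadditivity of [q]. *)
Lemma minimal_sublinear_linear q : sublinear_in W q ->
    (forall q', sublinear_in W q' -> (forall v, W v -> q' v <= q v) ->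
      forall v, W v -> q v <= q' v) ->
  linear_in W q.
Proof.
move=> sq qmin.
have qD v w : W v -> W w -> q (v + w) = q v + q w.
  move=> Wv Ww; apply/eqP; rewrite eq_le sq.1//=.
  have ale v' : W v' -> along q w v' <= q v'.
    move=> Wv'; have := along_le sq Wv' Ww (lexx 0).
    by rewrite scale0r addr0 mul0r subr0.
  have := qmin _ (along_sublinear sq Ww) ale v Wv.
  have := along_le sq Wv Ww ler01; rewrite scale1r mul1r => h1 h2.
  by rewrite -lerBrDr; exact: le_trans h2 h1.
move=> a v w Wv Ww; have Wa := submoduleZ a sW Wv.
rewrite qD//; congr (_ + _).
have q0 := sublinear_in0 sq Wv.
have qN u : W u -> q (- u) = - q u.
  move=> Wu; apply/eqP; rewrite -addr_eq0 -qD//; last exact: submoduleN.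
  by rewrite addNr q0.
have [a0|a0|->] := ltrgtP a 0; last by rewrite scale0r mul0r q0.
- have Na0 : 0 < - a by rewrite oppr_gt0.
  have Wb := submoduleZ (- a) sW Wv.
  by rewrite -[a in LHS]opprK scaleNr qN// sq.2// mulNr opprK.
- by rewrite sq.2.
Qed.

End minimal.

(** Zorn's lemma provides a minimal sublinear functional below [p], as the infimum of a
    chain of sublinear functionals is sublinear. *)
Lemma hahn_banach W (p : V -> R) : submodule W -> sublinear_in W p ->
  exists2 f, linear_in W f & forall v, W v -> f v <= p v.
Proof.
move=> sW sp.
pose Q (q : V -> R) := sublinear_in W q /\ forall v, W v -> q v <= p v.
have Tp : Q p by split.
pose T := {q : V -> R | Q q}.
pose r : rel T := fun a b => `[< forall v, W v -> sval b v <= sval a v >].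
have [||A Atot|q qmin] := ZL_preorder (exist Q p Tp) (R := r).
- by move=> q; exact/asboolP.
- move=> q1 q2 q3 /asboolP h1 /asboolP h2; apply/asboolP => v Wv.
  exact: le_trans (h2 v Wv) (h1 v Wv).
- have [->|/set0P[q0 Aq0]] := eqVneq A set0.
    by exists (exist Q p Tp) => ? [].
  pose S v := [set sval q v | q in A].
  pose m v := inf (S v).
  have mlb v : W v -> lbound (S v) (- p (- v)).
    move=> Wv _ [q Aq <-]; have [sq qp] := svalP q.
    apply: le_trans (sublinear_inN sW sq Wv).
    by rewrite lerN2; apply: qp; exact: submoduleN.
  have mle v q : W v -> A q -> m v <= sval q v.
    move=> Wv Aq; apply: ge_inf; last by exists q.
    by exists (- p (- v)); exact: mlb.
  have mge v x : (forall q, A q -> x <= sval q v) -> x <= m v.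
    move=> h; apply: lb_le_inf; first by exists (sval q0 v); exists q0.
    by move=> _ [q Aq <-]; exact: h.
  have sm : sublinear_in W m.
    split=> [v w Wv Ww|c v c0 Wv].
      rewrite -lerBlDr; apply: (mge) => q Aq.
      rewrite lerBlDr -lerBlDl; apply: (mge) => q' Aq'.
      rewrite lerBlDl; have Wvw := submoduleD sW Wv Ww.
      have [/asboolP h|/asboolP h] := Atot q q' Aq Aq'.
        apply: le_trans (mle _ _ Wvw Aq') _.
        by apply: le_trans ((svalP q').1.1 _ _ Wv Ww) _; rewrite lerD2r h.
      apply: le_trans (mle _ _ Wvw Aq) _.
      by apply: le_trans ((svalP q).1.1 _ _ Wv Ww) _; rewrite lerD2l h.
    have Wcv := submoduleZ c sW Wv.
    apply/eqP; rewrite eq_le; apply/andP; split.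
      rewrite mulrC -ler_pdivrMr//; apply: (mge) => q Aq.
      by rewrite ler_pdivrMr// mulrC -(svalP q).1.2// mle.
    by apply: (mge) => q Aq; rewrite (svalP q).1.2// ler_pM2l// mle.
  have mp v : W v -> m v <= p v.
    by move=> Wv; apply: le_trans (mle v q0 Wv Aq0) _; exact: (svalP q0).2.
  exists (exist Q m (conj sm mp)) => q Aq; apply/asboolP => v Wv /=.
  exact: mle.
exists (sval q); last exact: (svalP q).2.
have [sq qp] := svalP q.
apply: (minimal_sublinear_linear sW sq) => q' sq' q'q v Wv.
have q'p u : W u -> q' u <= p u.
  by move=> Wu; exact: le_trans (q'q u Wu) (qp u Wu).
have : r q (exist Q q' (conj sq' q'p)) by apply/asboolP.
by move=> /qmin/asboolP/(_ v Wv).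
Qed.

End hahn_banach.

Section rational_extension.
Context {R : realType} {V : lmodType R}.

Definition seminorm_in (W : V -> Prop) (N : V -> R) :=
  (forall v w, W v -> W w -> N (v + w) <= N v + N w) /\
  (forall a v, W v -> N (a *: v) = `|a| * N v).

Section seminorm.
Variables (W : V -> Prop) (N : V -> R).
Hypotheses (sW : submodule W) (sN : seminorm_in W N).

Lemma seminorm_inN v : W v -> N (- v) = N v.
Proof. by move=> Wv; rewrite -scaleN1r sN.2// normrN1 mul1r. Qed.

Lemma seminorm_in0 v : W v -> N 0 = 0.
Proof.
move=> Wv; rewrite -(scale0r v).
by rewrite sN.2// normr0 mul0r.
Qed.

Lemma seminorm_in_ge0 v : W v -> 0 <= N v.
Proof.
move=> Wv; have := sN.1 _ _ Wv (submoduleN sW Wv).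
by rewrite subrr (seminorm_in0 Wv) seminorm_inN// => h; lra.
Qed.

End seminorm.

(** The homogeneity at a rational approximation of [a] is transferred to [a] by the
    Lipschitz bound. *)
Lemma rat_homogeneous (h : R -> R) (K : R) (a : R) :
  0 <= K -> 0 < a ->
  (forall x y, 0 < x -> 0 < y -> `|h x - h y| <= K * `|x - y|) ->
  (forall q : rat, 0 < ratr q :> R -> h (ratr q) = ratr q * h 1) ->
  h a = a * h 1.
Proof.
move=> K0 a0 lip hq; apply/eqP; rewrite -subr_eq0 -normr_le0.
apply/ler_addgt0Pr => e e0; rewrite add0r.
pose M := K + `|h 1| + 1; have M0 : 0 < M by rewrite ltr_wpDl// addr_ge0.
have [q] : exists q : rat, ratr q \in `]a, a + e / M[%R.
  by apply: rat_in_itvoo; rewrite ltrDl divr_gt0.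
rewrite in_itv/= => /andP[aq qa]; have q0 := lt_trans a0 aq.
have := lip _ _ a0 q0; rewrite (hq q q0) => h1.
have -> : h a - a * h 1 = (h a - ratr q * h 1) + (ratr q - a) * h 1 by ring.
apply: (le_trans (ler_normD _ _)); rewrite normrM.
rewrite (distrC a) (gtr0_norm (_ : 0 < ratr q - a)) ?subr_gt0// in h1.
rewrite (gtr0_norm (_ : 0 < ratr q - a)) ?subr_gt0//.
have qaM : (ratr q - a) * M <= e by rewrite -ler_pdivlMr// lerBlDl ltW.
apply: le_trans qaM; rewrite [ratr q - a]lock in h1 *.
have : 0 <= locked (ratr q - a) by rewrite -lock subr_ge0 ltW.
set d := locked _ in h1 * => d0; rewrite /M; lra.
Qed.

(** The family [e] is only stable under rational combinations, as are the countable
    families to which this is applied. The sublinear functional to start from is the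
    largest [C]-Lipschitz function below the prescribed values: stability makes it
    subadditive, and homogeneous for rational scalars; the Lipschitz bound extends this
    to real scalars. *)
Lemma rational_hahn_banach (W : V -> Prop) (N : V -> R) (C : R) (I : Type)
    (i0 : I) (e : I -> V) (b : I -> R) :
  submodule W -> seminorm_in W N -> 0 <= C -> (forall i, W (e i)) ->
  (forall (q : rat) i j, exists k, e k = ratr q *: e i + e j /\
     b k = ratr q * b i + b j) ->
  (forall i, `|b i| <= C * N (e i)) ->
  exists f : V -> R, [/\ linear_in W f, forall i, f (e i) = b i &
    forall v, W v -> `|f v| <= C * N v].
Proof.
move=> sW sN C0 We hlin hb.
pose S v := range (fun i => b i + C * N (v - e i)).
pose p v := inf (S v).
have [z [ez bz]] : exists k, e k = 0 /\ b k = 0.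
  have [k [ek bk]] := hlin (-1) i0 i0; exists k.
  by rewrite ek bk rmorphN1 scaleN1r mulN1r !addNr.
have W0 : W 0 by exact: submodule0 (We i0).
have N0 : N 0 = 0 by exact: seminorm_in0 W0.
have lb v : W v -> lbound (S v) (- (C * N v)).
  move=> Wv _ [i _ <-].
  have Wvi := submoduleB sW Wv (We i).
  have := sN.1 _ _ Wv (submoduleN sW Wvi).
  rewrite (seminorm_inN sN Wvi) opprB addrCA subrr addr0 => h.
  have := ler_wpM2l C0 h; rewrite mulrDr.
  by have := hb i; rewrite ler_norml => /andP[h1 _] h2; lra.
have ple v i : W v -> p v <= b i + C * N (v - e i).
  by move=> Wv; apply: ge_inf; [exists (- (C * N v)); exact: lb|exists i].
have pge v x : (forall i, x <= b i + C * N (v - e i)) -> x <= p v.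
  move=> h; apply: lb_le_inf; first by exists (b i0 + C * N (v - e i0)); exists i0.
  by move=> _ [i _ <-]; exact: h.
have plip v w : W v -> W w -> p v <= p w + C * N (v - w).
  move=> Wv Ww; rewrite -lerBlDr; apply: (pge) => i.
  rewrite lerBlDr -addrA -mulrDr; apply: (le_trans (ple v i Wv)).
  rewrite lerD2l; apply: ler_wpM2l => //.
  have -> : v - e i = (w - e i) + (v - w) by rewrite [RHS]addrC addrA subrK.
  by apply: sN.1; apply: submoduleB.
have pQ v (q : rat) : W v -> 0 < ratr q :> R -> p (ratr q *: v) <= ratr q * p v.
  move=> Wv q0; rewrite mulrC -ler_pdivrMr//; apply: (pge) => i.
  have [k [ek bk]] := hlin q i z; rewrite ez bz !addr0 in ek bk.
  rewrite ler_pdivrMr// mulrC mulrDr mulrCA.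
  have -> : ratr q * N (v - e i) = N (ratr q *: (v - e i)).
    by rewrite sN.2 ?gtr0_norm//; exact: submoduleB.
  rewrite scalerBr -ek -bk; apply: ple; exact: submoduleZ.
have pQe v (q : rat) : W v -> 0 < ratr q :> R -> p (ratr q *: v) = ratr q * p v.
  move=> Wv q0; apply/eqP; rewrite eq_le pQ//=.
  have qV0 : 0 < ratr q^-1 :> R by rewrite fmorphV invr_gt0.
  have := pQ _ _ (submoduleZ (ratr q) sW Wv) qV0.
  by rewrite scalerA fmorphV mulVf ?gt_eqF// scale1r ler_pdivlMl.
have sp : sublinear_in W p.
  split=> [v w Wv Ww|c v c0 Wv].
    rewrite -lerBlDr; apply: (pge) => i.
    rewrite lerBlDr -lerBlDl; apply: (pge) => j; rewrite lerBlDl.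
    have [k [ek bk]] := hlin 1 i j; rewrite rmorph1 scale1r mul1r in ek bk.
    apply: (le_trans (ple _ k (submoduleD sW Wv Ww))).
    rewrite ek bk addrACA -mulrDr lerD2l; apply: ler_wpM2l => //.
    by rewrite opprD addrACA; apply: sN.1; apply: submoduleB.
  rewrite (@rat_homogeneous (fun c => p (c *: v)) (C * N v))//.
  - by rewrite scale1r.
  - by rewrite mulr_ge0// (seminorm_in_ge0 sW sN).
  - have half x y : p (x *: v) - p (y *: v) <= C * N v * `|x - y|.
      have := plip _ _ (submoduleZ x sW Wv) (submoduleZ y sW Wv).
      by rewrite -scalerBl sN.2// lerBlDl mulrAC -mulrA.
    move=> x y _ _; rewrite ler_norml half andbT lerNl opprB distrC; exact: half.
  - by move=> q q0; rewrite pQe// scale1r.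
have [f lf fp] := hahn_banach sW sp.
have pC v : W v -> p v <= C * N v.
  by move=> Wv; have := ple v z Wv; rewrite ez bz subr0 add0r.
have fN v : W v -> f (- v) = - f v.
  move=> Wv; have f0 : f 0 = 0.
    by have := lf 1 0 0 W0 W0; rewrite scaler0 addr0 mul1r => h; lra.
  by have := lf (-1) v 0 Wv W0; rewrite scaleN1r f0 !addr0 mulN1r.
have fe i : f (e i) <= b i.
  by apply: le_trans (fp _ (We i)) _; have := ple _ i (We i);
     rewrite subrr N0 mulr0 addr0.
exists f; split => //.
  move=> i; apply/eqP; rewrite eq_le fe/=.
  have [k [ek bk]] := hlin (-1) i z.
  rewrite ez bz !addr0 rmorphN1 scaleN1r mulN1r in ek bk.
  by have := fe k; rewrite ek bk fN// lerN2.
move=> v Wv; rewrite ler_norml (le_trans (fp v Wv) (pC v Wv)) andbT.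
rewrite lerNl -fN// -(seminorm_inN sN Wv).
have WNv := submoduleN sW Wv.
exact: le_trans (fp _ WNv) (pC _ WNv).
Qed.

End rational_extension.

Section rational_combinations.
Context {R : realType}.

Definition comb {V : lmodType R} {J : Type} (x : J -> V) (s : seq (rat * J)) : V :=
  \sum_(c <- s) (ratr c.1 : R) *: x c.2.

Definition comb_axpy {J : Type} (q : rat) (s s' : seq (rat * J)) :=
  [seq (q * c.1, c.2) | c <- s] ++ s'.

Lemma comb_axpyE {V : lmodType R} {J : Type} (x : J -> V) q s s' :
  comb x (comb_axpy q s s') = (ratr q : R) *: comb x s + comb x s'.
Proof.
rewrite /comb big_cat big_map/= scaler_sumr; congr (_ + _).
by apply: eq_bigr => c _; rewrite rmorphM scalerA.
Qed.

Lemma comb_nil {V : lmodType R} {J : Type} (x : J -> V) : comb x [::] = 0.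
Proof. by rewrite /comb big_nil. Qed.

Lemma comb1 {V : lmodType R} {J : Type} (x : J -> V) j : comb x [:: (1, j)] = x j.
Proof. by rewrite /comb big_seq1 rmorph1 scale1r. Qed.

Lemma comb_cons {V : lmodType R} {J : Type} (x : J -> V) c s :
  comb x (c :: s) = (ratr c.1 : R) *: x c.2 + comb x s.
Proof. by rewrite /comb big_cons. Qed.

Lemma comb_map {V V' : lmodType R} {J : Type} (W : V -> Prop) (f : V -> V')
    (x : J -> V) s : submodule W -> (forall j, W (x j)) -> W 0 ->
  (forall (a : R) v w, W v -> W w -> f (a *: v + w) = a *: f v + f w) ->
  W (comb x s) /\ f (comb x s) = comb (f \o x) s.
Proof.
move=> sW Wx W0 lf; elim: s => [|c s [Ws fs]].
  rewrite !comb_nil; split=> //.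
  by have := lf (-1) 0 0 W0 W0; rewrite scaler0 addr0 scaleN1r addNr.
rewrite !comb_cons; split; first exact: sW.
by rewrite lf// fs.
Qed.

End rational_combinations.

(** * Closed spans of sequences in a reflexive space *)

Section duals.
Context {R : realType}.

Lemma setT_submodule (V : lmodType R) : submodule (fun _ : V => True).
Proof. by []. Qed.

Lemma norm_seminorm (V : normedModType R) :
  seminorm_in (fun _ : V => True) (fun v => `|v|).
Proof. by split=> [v w _ _|a v _]; [exact: ler_normD|exact: normrZ]. Qed.

Lemma linear_pack (V W : lmodType R) (f : V -> W) :
  (forall (a : R) u v, f (a *: u + v) = a *: f u + f v) ->
  exists L : {linear V -> W}, forall v, L v = f v.
Proof.
move=> lf.
pose m := GRing.isLinear.Build R V W *:%R f lf.
pose L : {linear V -> W} := HB.pack f m.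
by exists L.
Qed.

Lemma linear_bounded_continuous (V W : normedModType R) (f : {linear V -> W}) C :
  (forall v, `|f v| <= C * `|v|) -> continuous f.
Proof.
move=> fC; apply: bounded_linear_continuous; apply/linear_boundedP.
exists (Num.max C 0); split; first by rewrite realE le_max lexx !orbT.
move=> r Cr v; apply: (le_trans (fC v)); apply: ler_wpM2r => //.
by apply: le_trans (ltW Cr); rewrite le_max lexx.
Qed.

Section dual.
Context {Y : normedModType R}.
Implicit Types f : Y -> R.

Lemma in_dual_linear f a u v : in_dual f -> f (a *: u + v) = a * f u + f v.
Proof. by move=> [lf _]; rewrite lf. Qed.

Lemma in_dual0 f : in_dual f -> f 0 = 0.
Proof.
move=> df; have := in_dual_linear 1 0 0 df.
by rewrite scaler0 addr0 mul1r => h; lra.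
Qed.

Lemma in_dualZ f a v : in_dual f -> f (a *: v) = a * f v.
Proof.
by move=> df; have := in_dual_linear a v 0 df; rewrite !addr0 in_dual0// addr0.
Qed.

Lemma in_dualD f u v : in_dual f -> f (u + v) = f u + f v.
Proof. by move=> df; have := in_dual_linear 1 u v df; rewrite scale1r mul1r. Qed.

Lemma in_dualB f u v : in_dual f -> f (u - v) = f u - f v.
Proof. by move=> df; rewrite in_dualD// -scaleN1r in_dualZ// mulN1r. Qed.

Lemma in_dual_bounded f : in_dual f ->
  exists C, 0 < C /\ forall v, `|f v| <= C * `|v|.
Proof.
move=> [lf cf]; have [L Lf] := @linear_pack Y R^o f lf.
have cL : continuous (L : Y -> R^o) by rewrite (_ : (L : _ -> _) = f)//; exact/funext.
have /linear_boundedP[C [_ hC]] := continuous_linear_bounded (0 : Y) (cL 0).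
exists (Num.max C 0 + 1); split.
  by rewrite ltr_wpDl// le_max lexx orbT.
move=> v; rewrite -Lf; apply: hC.
by rewrite ltr_pwDr// le_max lexx.
Qed.

Lemma bounded_in_dual f C :
  (forall a u v, f (a *: u + v) = a * f u + f v) ->
  (forall v, `|f v| <= C * `|v|) -> in_dual f.
Proof.
move=> lf fC; have [L Lf] := @linear_pack Y R^o f lf; split=> //.
have -> : f = L :> (Y -> R^o) by apply/funext => v; rewrite Lf.
by apply: (@linear_bounded_continuous _ _ L C) => v; rewrite Lf; exact: fC.
Qed.

Lemma in_dual_submodule : submodule (@in_dual R Y : (Y -> R^o) -> Prop).
Proof.
move=> a f g df dg.
have [C [C0 fC]] := in_dual_bounded df; have [D [D0 gD]] := in_dual_bounded dg.
apply: (@bounded_in_dual _ (`|a| * C + D)).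
  move=> b u v; rewrite /= !fctE !in_dual_linear// /GRing.scale/=; ring.
move=> v; rewrite /= fctE; apply: le_trans (ler_normD _ _) _.
rewrite mulrDl; apply: lerD (gD v); rewrite normrM -mulrA; exact: ler_wpM2l.
Qed.

Lemma in_dual_zero : in_dual (0 : Y -> R^o).
Proof.
apply: (@bounded_in_dual _ 0) => [a u v|v] /=.
  by rewrite mulr0 addr0.
by rewrite normr0 mul0r.
Qed.

Lemma dual_norm_ubound f : in_dual f ->
  has_ubound [set `|f y| | y in [set y : Y | `|y| <= 1]].
Proof.
move=> df; have [C [C0 fC]] := in_dual_bounded df; exists C => _ [w /= w1 <-].
by apply: (le_trans (fC w)); rewrite ler_piMr// ltW.
Qed.

Lemma dual_norm_ge0 f : in_dual f -> 0 <= dual_norm f.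
Proof.
move=> df; apply: (le_trans (normr_ge0 (f 0))).
apply: ub_le_sup; first exact: dual_norm_ubound.
by exists 0 => //=; rewrite normr0.
Qed.

Lemma le_dual_norm f v : in_dual f -> `|f v| <= dual_norm f * `|v|.
Proof.
move=> df; have [->|v0] := eqVneq v 0; first by rewrite in_dual0// !normr0 mulr0.
have nv : 0 < `|v| by rewrite normr_gt0.
rewrite -ler_pdivrMr// -[X in _ / X]normr_id -normfV -normrM.
rewrite mulrC -in_dualZ//; apply: ub_le_sup; first exact: dual_norm_ubound.
by exists (`|v|^-1 *: v) => //=; rewrite normrZ normfV normr_id mulVf ?gt_eqF.
Qed.

Lemma norming_functional (v : Y) : exists f : Y -> R,
  [/\ in_dual f, f v = `|v| & forall w, `|f w| <= `|w|].
Proof.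
have [||f [lf fe fN]] := @rational_hahn_banach R Y _ _ 1 rat 0
  (fun q => ratr q *: v) (fun q => ratr q * `|v|) (@setT_submodule Y)
  (norm_seminorm Y) ler01 (fun _ => I).
- move=> q i j; exists (q * i + j); split.
    by rewrite rmorphD rmorphM scalerDl scalerA.
  by rewrite rmorphD rmorphM mulrDl -mulrA.
- by move=> q; rewrite mul1r [leRHS]normrZ (normrM (ratr q)) normr_id.
exists f; split.
- apply: (@bounded_in_dual _ 1) => [a u w|w]; first exact: lf.
  exact: fN.
- by have := fe 1; rewrite rmorph1 scale1r mul1r.
- by move=> w; have := fN w I; rewrite mul1r.
Qed.

Section closed_span.
Variable y : nat -> Y.

(** Defined by annihilation, so that stability under linear combinations is immediate;
    [closed_span_approx] identifies it with the closure of the set of rational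
    combinations. *)
Definition closed_span (v : Y) :=
  forall f, in_dual f -> (forall j, f (y j) = 0) -> f v = 0.

Lemma closed_span_submodule : submodule closed_span.
Proof.
by move=> a u v hu hv f df fy; rewrite in_dual_linear// hu// hv// mulr0 addr0.
Qed.

(** Otherwise the functional equal to 1 at [v] and to 0 at the rational combinations is
    bounded, by the inverse of their distance to [v], and extends to an element of the
    dual that contradicts the definition. *)
Lemma closed_span_approx v e : closed_span v -> 0 < e ->
  exists s, `|v - comb y s| < e.
Proof.
move=> hv e0; apply: contrapT => /forallNP far.
have {}far s : e <= `|v - comb y s| by rewrite leNgt; apply/negP/far.
have eV0 : 0 <= e^-1 by rewrite invr_ge0 ltW.
have [||f [lf fe fN]] := @rational_hahn_banach R Y _ _ e^-1
  (rat * seq (rat * nat)) (0, [::])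
  (fun i => ratr i.1 *: v + comb y i.2) (fun i => ratr i.1) (@setT_submodule Y)
  (norm_seminorm Y) eV0 (fun _ => I).
- move=> q i j; exists (q * i.1 + j.1, comb_axpy q i.2 j.2) => /=; split.
    rewrite comb_axpyE rmorphD rmorphM scalerDl scalerDr scalerA.
    by rewrite addrACA.
  by rewrite rmorphD rmorphM.
- move=> [q s] /=; rewrite mulrC ler_pdivlMr//.
  have [->|q0] := eqVneq q 0; first by rewrite rmorph0 normr0 mul0r.
  have := far (comb_axpy (- q^-1) s [::]).
  rewrite comb_axpyE comb_nil addr0 rmorphN fmorphV scaleNr opprK.
  move=> /(ler_wpM2l (normr_ge0 (ratr q : R))); rewrite -normrZ => /le_trans; apply.
  by rewrite scalerDr scalerA mulfV ?scale1r// fmorph_eq0.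
have df : in_dual f by apply: (@bounded_in_dual _ e^-1) => *; [exact: lf|exact: fN].
have fv : f v = 1.
  by have := fe (1, [::]); rewrite comb_nil rmorph1 scale1r addr0.
suff : f v = 0 by rewrite fv => /eqP; rewrite oner_eq0.
apply: hv => // j; have := fe (0, [:: (1, j)]).
by rewrite comb1 rmorph0 scale0r add0r.
Qed.

Lemma closed_span_closed v : (forall e, 0 < e ->
  exists2 w, closed_span w & `|v - w| < e) -> closed_span v.
Proof.
move=> hv f df fy; apply/eqP; rewrite -normr_le0; apply/ler_addgt0Pr => e e0.
have [C [C0 fC]] := in_dual_bounded df.
have [w cw vw] := hv (e / C) (divr_gt0 e0 C0).
rewrite add0r -[f v]subr0 -(cw f df fy) -in_dualB//.
by apply: (le_trans (fC _)); rewrite mulrC -ler_pdivlMr// ltW.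
Qed.

Lemma closed_span_comb s : closed_span (comb y s).
Proof.
have W0 : closed_span 0 by move=> f df _; exact: in_dual0.
have [] := @comb_map R Y Y nat closed_span id y s closed_span_submodule _ W0 _ => //.
by move=> j f _; exact.
Qed.

(** The norm of the restriction of [f] to the closed span of [y]. *)
Definition span_norm (f : Y -> R) : R :=
  sup (range (fun s => `|f (comb y s)| / `|comb y s|)).

Lemma span_norm_ub f s : in_dual f -> `|f (comb y s)| <= span_norm f * `|comb y s|.
Proof.
move=> df; have [->|v0] := eqVneq (comb y s) 0.
  by rewrite in_dual0// !normr0 mulr0.
have nv : 0 < `|comb y s| by rewrite normr_gt0.
rewrite -ler_pdivrMr//; apply: ub_le_sup; last by exists s.
have [C [C0 fC]] := in_dual_bounded df; exists C => _ [t _ <-].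
have [->|w0] := eqVneq (comb y t) 0; first by rewrite normr0 invr0 mulr0 ltW.
by rewrite ler_pdivrMr ?normr_gt0.
Qed.

Lemma span_norm_le f c : 0 <= c -> (forall s, `|f (comb y s)| <= c * `|comb y s|) ->
  span_norm f <= c.
Proof.
move=> c0 fc; apply: sup_le_ub.
  by exists (`|f (comb y [::])| / `|comb y [::]|); exists [::].
move=> _ [t _ <-].
have [->|w0] := eqVneq (comb y t) 0; first by rewrite normr0 invr0 mulr0.
by rewrite ler_pdivrMr ?normr_gt0.
Qed.

Lemma span_norm_ge0 f : in_dual f -> 0 <= span_norm f.
Proof.
move=> df; have [C [C0 fC]] := in_dual_bounded df.
apply: (@le_trans _ _ (`|f (comb y [::])| / `|comb y [::]|)).
  by rewrite divr_ge0.
apply: ub_le_sup; last by exists [::].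
exists C => _ [t _ <-].
have [->|w0] := eqVneq (comb y t) 0; first by rewrite normr0 invr0 mulr0 ltW.
by rewrite ler_pdivrMr ?normr_gt0.
Qed.

Lemma span_norm_ub_closed f v : in_dual f -> closed_span v ->
  `|f v| <= span_norm f * `|v|.
Proof.
move=> df cv; apply/ler_addgt0Pr => e e0.
have [C [C0 fC]] := in_dual_bounded df; have N0 := span_norm_ge0 df.
have D0 : 0 < C + span_norm f by rewrite ltr_wpDr.
have [s hs] := closed_span_approx cv (divr_gt0 e0 D0).
have h1 := fC (v - comb y s); rewrite in_dualB// in h1.
have h2 := span_norm_ub s df.
have h3 : span_norm f * `|comb y s| <= span_norm f * (`|v| + `|v - comb y s|).
  apply: ler_wpM2l => //; have := ler_normB v (v - comb y s).
  by rewrite opprB addrCA subrr addr0.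
have h4 : `|f v| <= `|f v - f (comb y s)| + `|f (comb y s)|.
  by rewrite -{1}[f v](subrK (f (comb y s))); exact: ler_normD.
have h5 : (C + span_norm f) * `|v - comb y s| <= e.
  by rewrite mulrC -ler_pdivlMr// ltW.
rewrite mulrDl in h5; rewrite mulrDr in h3; lra.
Qed.

Lemma span_norm_seminorm : seminorm_in (@in_dual R Y : (Y -> R^o) -> Prop) span_norm.
Proof.
have ZN a f : in_dual f -> span_norm (a *: (f : Y -> R^o)) <= `|a| * span_norm f.
  move=> df; apply: span_norm_le; first by rewrite mulr_ge0// span_norm_ge0.
  move=> s; rewrite /= fctE normrM -mulrA; apply: ler_wpM2l => //.
  exact: span_norm_ub.
split=> [f g df dg|a f df].
  apply: span_norm_le; first by rewrite addr_ge0// span_norm_ge0.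
  move=> s; rewrite /= fctE mulrDl; apply: le_trans (ler_normD _ _) _.
  by apply: lerD; exact: span_norm_ub.
apply/eqP; rewrite eq_le ZN//=.
have [->|a0] := eqVneq a 0.
  rewrite normr0 mul0r; apply: span_norm_ge0; rewrite scale0r; exact: in_dual_zero.
rewrite mulrC -ler_pdivlMr ?normr_gt0// mulrC -normfV.
have da := submoduleZ a in_dual_submodule df.
by have := ZN a^-1 _ da; rewrite scalerA mulVf// scale1r.
Qed.

End closed_span.
End dual.
End duals.

Section norming_family.
Context {R : realType} {Y : normedModType R}.
Local Notation QS := (seq (rat * nat)).

(** A substitute for a countable dense set of the dual of the closed span of [y]. The
    rational combinations of [y] index the family, [g s] being a functional that attains
    its norm at [comb y s]. *)
Record norming_family (y : nat -> Y) (g : QS -> (Y -> R^o)) : Prop := NormingFamily {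
  nf_dual : forall s, in_dual (g s : Y -> R);
  nf_le : forall s v, `|g s v| <= `|v|;
  nf_norm : forall s, g s (comb y s) = `|comb y s|;
  nf_dense : forall (f : Y -> R) e, in_dual f -> 0 < e -> exists t,
    forall s, `|f (comb y s) - comb g t (comb y s)| <= e * `|comb y s| }.

Section family.
Variables (y : nat -> Y) (g : QS -> (Y -> R^o)).

Lemma comb_funE (J : Type) (h : J -> (Y -> R^o)) t v :
  comb h t v = comb (fun s => h s v : R^o) t.
Proof.
have [] := @comb_map R (Y -> R^o) R^o J (fun _ => True) (fun f => f v) h t => //.
Qed.

Lemma comb_dual (J : Type) (h : J -> (Y -> R^o)) t :
  (forall s, in_dual (h s : Y -> R)) -> in_dual (comb h t : Y -> R).
Proof.
move=> dh.
by have [] := @comb_map R (Y -> R^o) (Y -> R^o) J (@in_dual R Y : (Y -> R^o) -> Prop)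
  id h t in_dual_submodule dh in_dual_zero.
Qed.

Lemma closed_span_separated v :
  (forall s, in_dual (g s : Y -> R)) -> (forall s w, `|g s w| <= `|w|) ->
  (forall s, g s (comb y s) = `|comb y s|) ->
  closed_span y v -> (forall s, g s v = 0) -> v = 0.
Proof.
move=> gd gle gn cv gv; apply/eqP; rewrite -normr_le0; apply/ler_addgt0Pr => e e0.
have e20 : 0 < e / 2 by rewrite divr_gt0.
have [s hs] := closed_span_approx cv e20.
have h1 := gle s (v - comb y s).
rewrite in_dualB// gv gn sub0r normrN normr_id in h1.
have : `|v| <= `|v - comb y s| + `|comb y s|.
  by rewrite -{1}[v](subrK (comb y s)); exact: ler_normD.
lra.
Qed.

End family.

(** If [f] were at a positive distance from the rational combinations of the [g s], an
    element of the bidual would be 1 at [f] and 0 at every [g s]. By reflexivity it is a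
    vector of the closed span of [y]; the [g s] separate the points of this span, so
    this vector is 0. *)
Lemma reflexive_norming_family (y : nat -> Y) : reflexive_space Y ->
  exists g, norming_family y g.
Proof.
move=> rY.
have [g hg] := choice (fun s : QS => norming_functional (comb y s)).
pose h : QS -> (Y -> R^o) := g.
have hd s : in_dual (h s : Y -> R) by have [] := hg s.
have hle s v : `|h s v| <= `|v| by have [] := hg s.
have hn s : h s (comb y s) = `|comb y s| by have [] := hg s.
exists h; split=> // f e df e0; apply: contrapT => /forallNP far.
have eV0 : 0 <= e^-1 by rewrite invr_ge0 ltW.
pose f' : Y -> R^o := f.
have cd t : in_dual (comb h t : Y -> R) by exact: comb_dual.
have {}far t : e <= span_norm y (f' - comb h t).
  rewrite leNgt; apply/negP => lt; apply: (far t) => s.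
  have dd : in_dual (f' - comb h t : Y -> R).
    exact: (submoduleB in_dual_submodule).
  by apply: (le_trans (span_norm_ub y s dd)); apply: ler_wpM2r => //; exact: ltW.
have [|||Phi [lP Pe PN]] := @rational_hahn_banach R (Y -> R^o)
  (@in_dual R Y : (Y -> R^o) -> Prop) (span_norm y) e^-1 (rat * seq (rat * QS)) (0, [::])
  (fun i => ratr i.1 *: f' + comb h i.2) (fun i => ratr i.1) in_dual_submodule
  (span_norm_seminorm y) eV0.
- by move=> i; exact: in_dual_submodule.
- move=> q i j; exists (q * i.1 + j.1, comb_axpy q i.2 j.2) => /=; split.
    rewrite comb_axpyE rmorphD rmorphM scalerDl scalerDr scalerA.
    by rewrite addrACA.
  by rewrite rmorphD rmorphM.
- move=> [q s] /=; rewrite mulrC ler_pdivlMr//.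
  have [->|q0] := eqVneq q 0.
    rewrite rmorph0 normr0 mul0r scale0r add0r; exact: span_norm_ge0.
  have := far (comb_axpy (- q^-1) s [::]).
  rewrite comb_axpyE comb_nil addr0 rmorphN fmorphV scaleNr opprK.
  move=> /(ler_wpM2l (normr_ge0 (ratr q : R))).
  rewrite -(span_norm_seminorm y).2; last first.
    apply: (submoduleD in_dual_submodule) => //; exact: (submoduleZ _ in_dual_submodule).
  move=> /le_trans; apply.
  by rewrite scalerDr scalerA mulfV ?scale1r// fmorph_eq0.
have [|v hv] := rY Phi (fun a f1 f2 d1 d2 => lP a f1 f2 d1 d2).
  exists e^-1 => f1 d1; apply: le_trans (PN _ d1) _; apply: ler_wpM2l => //.
  apply: span_norm_le; first exact: dual_norm_ge0.
  by move=> s; exact: le_dual_norm.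
have cv : closed_span y v.
  move=> f1 d1 f1y; rewrite -hv//; apply/eqP; rewrite -normr_le0.
  apply: (le_trans (PN _ d1)); rewrite pmulr_rle0 ?invr_gt0//.
  apply: span_norm_le => // s.
  by rewrite (closed_span_comb s d1 f1y) normr0 mul0r.
have v0 : v = 0.
  apply: (closed_span_separated hd hle hn cv) => s.
  have := Pe (0, [:: (1, s)]); rewrite comb1 rmorph0 scale0r add0r hv//.
have := Pe (1, [::]); rewrite comb_nil rmorph1 scale1r addr0 hv// v0 in_dual0// => /eqP.
by rewrite eq_sym oner_eq0.
Qed.

Section consequences.
Variables (y : nat -> Y) (g : QS -> (Y -> R^o)).
Hypothesis nf : norming_family y g.

Lemma nf_separated v : closed_span y v -> (forall s, g s v = 0) -> v = 0.
Proof.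
exact: (closed_span_separated (nf_dual nf) (nf_le nf) (nf_norm nf)).
Qed.

Lemma nf_comb_dual t : in_dual (comb g t : Y -> R).
Proof. exact: comb_dual (nf_dual nf). Qed.

(** By [rational_hahn_banach] the form is the restriction of an element of the dual of
    [Y], to which [nf_dense] applies. *)
Lemma nf_form_approx (c : nat -> R^o) (h e : R) : 0 <= h -> 0 < e ->
  (forall s, `|comb c s| <= h * `|comb y s|) ->
  exists t, forall s, `|comb c s - comb g t (comb y s)| <= e * `|comb y s|.
Proof.
move=> h0 e0 hc.
have [||f [lf fe fN]] := @rational_hahn_banach R Y _ _ h QS [::]
  (comb y) (comb c) (@setT_submodule R Y) (norm_seminorm Y) h0 (fun _ => I).
- by move=> q s t; exists (comb_axpy q s t); rewrite !comb_axpyE.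
- exact: hc.
have df : in_dual f by apply: (@bounded_in_dual _ _ _ h) => *; [exact: lf|exact: fN].
have [t ht] := nf_dense nf df e0.
by exists t => s; rewrite -fe.
Qed.

(** The bilinear form is extended to all of [X] in its first variable; for a fixed
    vector of [X] it is then a functional on the span of the [g t], which extends to the
    dual of [Y] and is represented by reflexivity. *)
Lemma nf_operator (rY : reflexive_space Y) (X : normedModType R) (x : nat -> X)
    (b : nat -> QS -> R^o) (h : R) : 0 <= h ->
  (forall v e, 0 < e -> exists s, `|v - comb x s| < e) ->
  (forall s t, `|comb (fun i => comb (b i) t) s| <=
     h * `|comb x s| * span_norm y (comb g t)) ->
  exists L : {linear X -> Y}, [/\ forall v, `|L v| <= h * `|v|,
    forall v, closed_span y (L v) & forall i s, g s (L (x i)) = b i s].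
Proof.
move=> h0 xdense hb.
pose N t := span_norm y (comb g t).
have N0 t : 0 <= N t by exact: span_norm_ge0 (nf_comb_dual t).
have ext t : exists B : X -> R,
    [/\ forall a v w, B (a *: v + w) = a * B v + B w,
        forall s, B (comb x s) = comb (fun i => comb (b i) t) s &
        forall v, `|B v| <= h * N t * `|v|].
  have [||||B [lB Be BN]] := @rational_hahn_banach R X _ _ (h * N t) QS [::]
    (comb x) (comb (fun i => comb (b i) t)) (@setT_submodule R X) (norm_seminorm X).
  - by rewrite mulr_ge0.
  - by [].
  - by move=> q s s'; exists (comb_axpy q s s'); rewrite !comb_axpyE.
  - by move=> s; rewrite mulrAC; exact: hb.
  by exists B; split=> // *; [exact: lB|exact: BN].
have [B hB] := choice ext.
have lB t a v w : B t (a *: v + w) = a * B t v + B t w by have [] := hB t.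
have Be t s : B t (comb x s) = comb (fun i => comb (b i) t) s by have [] := hB t.
have BN t v : `|B t v| <= h * N t * `|v| by have [] := hB t.
have BZ t v w : B t (v - w) = B t v - B t w.
  by rewrite addrC -scaleN1r lB mulN1r addrC.
(* the extensions for different [t] are chosen independently, but all agree with the
   form on the rational combinations of [x], which are dense *)
have Baxpy q t t' v : B (comb_axpy q t t') v = ratr q * B t v + B t' v.
  apply/eqP; rewrite -subr_eq0 -normr_le0; apply/ler_addgt0Pr => e e0.
  pose K := h * N (comb_axpy q t t') + `|ratr q| * (h * N t) + h * N t' + 1.
  have hN u : 0 <= h * N u by rewrite mulr_ge0.
  have K0 : 0 < K by rewrite ltr_wpDl// !addr_ge0// mulr_ge0.
  have [s hs] := xdense v _ (divr_gt0 e0 K0).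
  have E0 : B (comb_axpy q t t') (comb x s) =
      ratr q * B t (comb x s) + B t' (comb x s).
    rewrite !Be -[ratr q * _]/((ratr q : R) *: (_ : R^o)).
    elim: s {hs} => [|c s IH]; first by rewrite !comb_nil scaler0 addr0.
    rewrite !comb_cons IH comb_axpyE !scalerDr addrACA; congr (_ + _ + _).
    by rewrite !scalerA mulrC.
  set u := v - comb x s in hs.
  have -> : B (comb_axpy q t t') v - (ratr q * B t v + B t' v) =
      B (comb_axpy q t t') u - ratr q * B t u - B t' u.
    by rewrite /u !BZ E0; ring.
  rewrite add0r; apply: (@le_trans _ _ (K * `|u|)); last first.
    by rewrite mulrC -ler_pdivlMr// ltW.
  have h1 := BN (comb_axpy q t t') u; have h2 := BN t u; have h3 := BN t' u.
  apply: (le_trans (ler_normB _ _)); apply: (le_trans (lerD (ler_normB _ _) (lexx _))).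
  rewrite (normrM (ratr q)).
  have h4 : `|ratr q| * `|B t u| <= `|ratr q| * (h * N t * `|u|).
    by apply: ler_wpM2l.
  have u0 := normr_ge0 u.
  by rewrite /K !mulrDl mul1r -(mulrA `|ratr q|); lra.
have rep v : exists w : Y, [/\ closed_span y w, `|w| <= h * `|v| &
    forall t, comb g t w = B t v].
  have hv0 : 0 <= h * `|v| by rewrite mulr_ge0.
  have [||Phi [lP Pe PN]] := @rational_hahn_banach R (Y -> R^o)
    (@in_dual R Y : (Y -> R^o) -> Prop) (span_norm y) (h * `|v|) (seq (rat * QS)) [::]
    (comb g) (fun t => B t v) in_dual_submodule (span_norm_seminorm y) hv0 nf_comb_dual.
  - by move=> q t t'; exists (comb_axpy q t t'); rewrite comb_axpyE Baxpy.
  - by move=> t; rewrite mulrAC; exact: BN.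
  have PD f : in_dual f -> `|Phi f| <= h * `|v| * dual_norm f.
    move=> df; apply: le_trans (PN _ df) _; apply: ler_wpM2l => //.
    apply: span_norm_le; first exact: dual_norm_ge0.
    by move=> s; exact: le_dual_norm.
  have [|w hw] := rY Phi (fun a f1 f2 d1 d2 => lP a f1 f2 d1 d2).
    by exists (h * `|v|).
  exists w; split.
  - move=> f df fy; rewrite -hw//; apply/eqP; rewrite -normr_le0.
    apply: (le_trans (PN _ df)); rewrite mulr_ge0_le0//.
    apply: span_norm_le => // s.
    by rewrite (closed_span_comb s df fy) normr0 mul0r.
  - have [f [df fw fle]] := norming_functional w.
    rewrite -fw -hw//; apply: (le_trans (ler_norm _)).
    apply: (le_trans (PN _ df)); rewrite -[X in _ <= X]mulr1; apply: ler_wpM2l => //.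
    by apply: span_norm_le => // s; rewrite mul1r.
  - by move=> t; rewrite -hw//; exact: nf_comb_dual.
have [L0 hL] := choice rep.
have gB s v : g s (L0 v) = B [:: (1, s)] v.
  by have [_ _ <-] := hL v; rewrite comb1.
have lL a v w : L0 (a *: v + w) = a *: L0 v + L0 w.
  apply/eqP; rewrite -subr_eq0; apply/eqP; apply: nf_separated.
    apply: (submoduleB (@closed_span_submodule R Y y)); first by have [] := hL (a *: v + w).
    by apply: closed_span_submodule; [have [] := hL v|have [] := hL w].
  move=> s; have ds := nf_dual nf s.
  by rewrite in_dualB// in_dual_linear// !gB lB subrr.
have [L LE] := linear_pack lL.
exists L; split.
- by move=> v; rewrite LE; have [] := hL v.
- by move=> v; rewrite LE; have [] := hL v.
- move=> i s; rewrite LE gB -(comb1 x i) Be comb1.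
  by rewrite comb1.
Qed.

End consequences.
End norming_family.

(** * Measurable choice of an index and strong measurability *)

Section measurable_selection.
Context {R : realType} {d : measure_display} {Z : measurableType d}.
Implicit Types (a : nat -> Z -> R).

(** The first index at which the maximum over [0..m] is attained. Suprema of countably
    many functions become limits of functions evaluated at a measurable index. *)
Fixpoint argmax a (m : nat) (z : Z) : nat :=
  if m is m'.+1 then
    if a (argmax a m' z) z < a m z then m else argmax a m' z
  else 0%N.

Lemma argmax_le a m z : (argmax a m z <= m)%N.
Proof.
by elim: m => //= m IH; case: ifPn => // _; exact: leq_trans IH (leqnSn m).
Qed.

Lemma argmaxP a m z j : (j <= m)%N -> a j z <= a (argmax a m z) z.
Proof.
elim: m => [|m IH]; first by rewrite leqn0 => /eqP ->.
rewrite leq_eqVlt => /predU1P[->|]; first by rewrite [argmax _ _ _]/=; case: ltP.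
rewrite ltnS => /IH h /=; case: ltP => // h'.
exact: le_trans h (ltW h').
Qed.

Definition measurable_index (sigma : Z -> nat) :=
  forall j, measurable [set z | sigma z = j].

Lemma measurable_selected d' (T : measurableType d') sigma (f : nat -> Z -> T) :
  measurable_index sigma -> (forall j, measurable_fun setT (f j)) ->
  measurable_fun setT (fun z => f (sigma z) z).
Proof.
move=> ms mf _ B mB; rewrite setTI.
rewrite (_ : _ @^-1` B =
    \bigcup_j ([set z | sigma z = j] `&` (setT `&` f j @^-1` B))).
  by apply: bigcup_measurable => j _; apply: measurableI => //; exact: mf.
apply/seteqP; split=> z /=; first by move=> Bz; exists (sigma z).
by move=> [j _ /= [<- []]].
Qed.

Lemma argmax_measurable a m : (forall j, measurable_fun setT (a j)) ->
  measurable_index (argmax a m).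
Proof.
move=> ma; elim: m => [|m IH] j /=.
  have [->|j0] := eqVneq j 0%N; first by rewrite (_ : [set _ | _] = setT)//; exact/seteqP.
  rewrite (_ : [set _ | _] = set0)//; apply/seteqP; split=> // z /= h.
  by rewrite -h eqxx in j0.
have mB : measurable [set z | a (argmax a m z) z < a m.+1 z].
  have := @measurable_fun_ltr _ _ R setT _ _ (measurable_selected IH ma) (ma m.+1).
  by move=> /(_ measurableT [set true] I); rewrite setTI.
rewrite (_ : [set _ | _] =
    ([set z | a (argmax a m z) z < a m.+1 z] `&` [set z | m.+1 = j]) `|`
    ([set z | argmax a m z = j] `\` [set z | a (argmax a m z) z < a m.+1 z])).
  apply: measurableU; last exact: measurableD.
  apply: measurableI => //.
  have [->|h] := eqVneq m.+1 j; first by rewrite (_ : [set _ | _] = setT)//; exact/seteqP.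
  by rewrite (_ : [set _ | _] = set0)//; apply/seteqP; split=> // z /= /eqP; rewrite (negbTE h).
apply/seteqP; split=> z /=; first by case: ifPn => [|/negP] ? <-; [left|right].
move=> [[-> //]|[<- /negP/negbTE -> //]].
Qed.

End measurable_selection.

Section strong_measurability_toolkit.
Context {R : realType} {d : measure_display} {Z : measurableType d}.

Definition smeas {V : topologicalType} (f : Z -> V) :=
  strongly_measurable measurable setT f.

Lemma smeas_ext {V : topologicalType} (f g : Z -> V) :
  f =1 g -> smeas f -> smeas g.
Proof. by move=> fg; rewrite (_ : g = f)//; apply/funext. Qed.

Lemma simple_comp2 (V W U : topologicalType) (s : Z -> V) (t : Z -> W)
    (op : V -> W -> U) :
  simple_on measurable setT s -> simple_on measurable setT t ->
  simple_on measurable setT (fun z => op (s z) (t z)).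
Proof.
move=> [fs ms] [ft mt].
have fst : finite_set ((s @` setT) `*` (t @` setT)) by exact: finite_setX.
split.
  apply: sub_finite_set (finite_image (fun vw => op vw.1 vw.2) fst).
  by move=> _ [z _ <-]; exists (s z, t z) => //; split; exists z.
move=> u; rewrite setTI.
rewrite (_ : _ @^-1` _ = \bigcup_(vw in ((s @` setT) `*` (t @` setT)) `&`
      [set vw | op vw.1 vw.2 = u])
    ((setT `&` s @^-1` [set vw.1]) `&` (setT `&` t @^-1` [set vw.2]))).
  apply: fin_bigcup_measurable; first exact: finite_setIl.
  by move=> vw _; apply: measurableI.
apply/seteqP; split=> z /=.
  move=> <-; exists (s z, t z) => //=; split=> //; split; by exists z.
by move=> [[v w] /= [_ <-] [[_ ->] [_ ->]]].
Qed.

Lemma smeas_comp2 (V W U : topologicalType) (f : Z -> V) (g : Z -> W)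
    (op : V -> W -> U) :
  (forall (a : nat -> V) (b : nat -> W) v w, a n @[n --> \oo] --> v ->
     b n @[n --> \oo] --> w -> op (a n) (b n) @[n --> \oo] --> op v w) ->
  smeas f -> smeas g -> smeas (fun z => op (f z) (g z)).
Proof.
move=> hop [s [ss sf]] [t [st tg]]; exists (fun n z => op (s n z) (t n z)); split.
  by move=> n; apply: simple_comp2.
by move=> z _; apply: hop; [exact: sf|exact: tg].
Qed.

Lemma smeas_comp (V U : topologicalType) (f : Z -> V) (op : V -> U) :
  continuous op -> smeas f -> smeas (fun z => op (f z)).
Proof.
move=> cop mf; apply: (@smeas_comp2 _ _ _ f f (fun v _ => op v)) => //.
by move=> a b v w av _; apply: continuous_cvg => //; exact: cop.
Qed.

Lemma simple_measurable d' (T : measurableType d') (V : Type) (s : Z -> V) (g : V -> T) :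
  finite_set (s @` setT) -> (forall v, measurable (setT `&` s @^-1` [set v])) ->
  measurable_fun setT (fun z => g (s z)).
Proof.
move=> fs ms _ B mB; rewrite setTI.
rewrite (_ : _ @^-1` B = \bigcup_(v in (s @` setT) `&` [set v | B (g v)])
    (setT `&` s @^-1` [set v])).
  by apply: fin_bigcup_measurable => //; exact: finite_setIl.
apply/seteqP; split=> z /=.
  by move=> Bz; exists (s z) => //=; split=> //; exists z.
by move=> [v /= [_ Bv] [_ ->]].
Qed.

Section normed.
Context {V : normedModType R}.
Implicit Types f : Z -> V.

Lemma smeas_norm_measurable f w : smeas f -> measurable_fun setT (fun z => `|f z - w|).
Proof.
move=> [s [ss sf]].
apply: (@measurable_fun_cvg _ _ R setT (fun n z => `|s n z - w|)).
  move=> n; have [fs ms] := ss n.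
  exact: (@simple_measurable _ (measurableTypeR R) V (s n) (fun u => `|u - w|)).
move=> z _; apply: cvg_norm; apply: cvgB; [exact: sf|exact: cvg_cst].
Qed.

Lemma smeas_normr f : smeas f -> measurable_fun setT (fun z => `|f z|).
Proof.
move=> mf; have := smeas_norm_measurable 0 mf.
by congr measurable_fun; apply/funext => z; rewrite subr0.
Qed.

Lemma countable_sequence (D : set V) : countable D -> exists v : nat -> V,
  v 0%N = 0 /\ forall w, D w -> exists n, v n = w.
Proof.
move=> /countable_injP[h hD].
exists (fun n => if n is n'.+1 then xget 0 [set w | D w /\ h w = n'] else 0).
split=> // w Dw; exists (h w).+1.
case: xgetP => [w' _ /= [Dw' hw]|/(_ w)/=]; last by case.
by apply: hD; rewrite ?inE.
Qed.

Lemma smeas_separable f : smeas f -> exists v : nat -> V,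
  v 0%N = 0 /\ forall z e, 0 < e -> exists j, `|f z - v j| < e.
Proof.
move=> [s [ss sf]].
have cD : countable (\bigcup_n (s n @` setT)).
  by apply: bigcup_countable => // n _; apply: finite_set_countable; have [] := ss n.
have [v [v0 hv]] := countable_sequence cD.
exists v; split=> // z e e0.
have /cvgrPdist_lt/(_ e e0)[n _ hn] := sf z I.
have [|j vj] := hv (s n z); first by exists n => //; exists z.
by exists j; rewrite vj; apply: hn => /=.
Qed.

Definition nearest f (v : nat -> V) : nat -> Z -> nat := argmax (fun j z => - `|f z - v j|).

Lemma nearest_measurable f (v : nat -> V) m :
  (forall j, measurable_fun setT (fun z => `|f z - v j|)) ->
  measurable_index (nearest f v m).
Proof. by move=> mf; apply: argmax_measurable => j; exact: measurableT_comp. Qed.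

Lemma nearest_le f (v : nat -> V) m z : `|f z - v (nearest f v m z)| <= `|f z - v 0%N|.
Proof. by rewrite -lerN2; exact: (argmaxP (fun j z => - `|f z - v j|)). Qed.

Lemma nearest_cvg f (v : nat -> V) z : (forall e, 0 < e -> exists j, `|f z - v j| < e) ->
  v (nearest f v m z) @[m --> \oo] --> f z.
Proof.
move=> hf; apply/cvgrPdist_lt => e e0; have [j hj] := hf e e0.
exists j => // m /= jm; apply: le_lt_trans hj.
rewrite -lerN2; exact: (argmaxP (fun j z => - `|f z - v j|)).
Qed.

Lemma selected_simple (v : nat -> V) sigma m : measurable_index sigma ->
  (forall z : Z, (sigma z <= m)%N) ->
  simple_on measurable setT (fun z => v (sigma z)).
Proof.
move=> ms sm; split.
  apply: sub_finite_set (finite_image v (finite_II m.+1)).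
  by move=> _ [z _ <-]; exists (sigma z) => //=; rewrite ltnS.
move=> w; rewrite setTI (_ : _ @^-1` _ = \bigcup_(j in [set j | v j = w])
  [set z | sigma z = j]).
  by apply: bigcup_measurable => j _; exact: ms.
apply/seteqP; split=> z /=; first by move=> <-; exists (sigma z).
by move=> [j /= <- <-].
Qed.

(** The nearest of the first [m] points of a dense sequence is a simple function of [z],
    by the measurability of the distances. *)
Lemma pettis f (v : nat -> V) : (forall j, measurable_fun setT (fun z => `|f z - v j|)) ->
  (forall z e, 0 < e -> exists j, `|f z - v j| < e) -> smeas f.
Proof.
move=> mf hf; exists (fun m z => v (nearest f v m z)); split.
  move=> m; apply: (@selected_simple _ _ m); first exact: nearest_measurable.
  by move=> z; exact: argmax_le.
by move=> z _; apply: nearest_cvg; exact: hf.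
Qed.

Lemma smeasD f g : smeas f -> smeas g -> smeas (fun z => f z + g z).
Proof. by apply: (@smeas_comp2 V V V f g +%R) => a b v w; exact: cvgD. Qed.

Lemma smeasZ (k : Z -> R^o) f : smeas k -> smeas f -> smeas (fun z => k z *: f z).
Proof.
by apply: (@smeas_comp2 R^o V V k f (fun a v => a *: v)) => a b v w; exact: cvgZ.
Qed.

Lemma smeas_cst (w : V) : smeas (fun _ : Z => w).
Proof.
exists (fun _ _ => w); split=> [_|z _]; last exact: cvg_cst.
split=> [|v]; first by apply: sub_finite_set (finite_set1 w) => _ [z _ <-].
rewrite setTI preimage_cst; case: ifP => _ //.
Qed.

Lemma smeasZl (a : R) f : smeas f -> smeas (fun z => a *: f z).
Proof. by apply: smeas_comp => v; exact: scaler_continuous. Qed.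

Lemma smeasB f g : smeas f -> smeas g -> smeas (fun z => f z - g z).
Proof. by apply: (@smeas_comp2 V V V f g (fun a b => a - b)) => a b v w; exact: cvgB. Qed.

Lemma smeas_selected (F : nat -> Z -> V) sigma : measurable_index sigma ->
  (forall j, smeas (F j)) -> smeas (fun z => F (sigma z) z).
Proof.
move=> ms mF.
have [v hv] := choice (fun j => smeas_separable (mF j)).
pose w n := if unpickle n is Some ij then v ij.1 ij.2 else 0.
apply: (@pettis _ w) => [j|z e e0].
  apply: (@measurable_selected _ _ _ (measurableTypeR R) sigma (fun i z => `|F i z - w j|)) => // i.
  exact: smeas_norm_measurable.
have [_ /(_ z e e0)[j hj]] := hv (sigma z).
by exists (pickle (sigma z, j)); rewrite /w pickleK.
Qed.

End normed.

Lemma measurable_smeas (k : Z -> R) : measurable_fun setT k -> smeas (k : Z -> R^o).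
Proof.
move=> mk; pose w n : R^o := if unpickle n is Some q then ratr q else 0.
apply: (@pettis R^o _ w) => [j|z e e0].
  by apply: measurableT_comp => //; exact: measurable_funB.
have [q] : exists q : rat, ratr q \in `]k z - e, k z + e[%R.
  by apply: rat_in_itvoo; lra.
rewrite in_itv/= => /andP[h1 h2].
exists (pickle q); rewrite /w pickleK ltr_norml; apply/andP; split; lra.
Qed.

Lemma smeas_measurable (k : Z -> R) : smeas (k : Z -> R^o) -> measurable_fun setT k.
Proof.
move=> [s [ss sf]]; apply: (@measurable_fun_cvg _ _ R setT s) => // n.
have [fs ms] := ss n; exact: (@simple_measurable _ (measurableTypeR R) R (s n) id).
Qed.

Lemma smeas_indic (V : normedModType R) (A : set Z) (f : Z -> V) : measurable A -> smeas f ->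
  smeas (fun z => (\1_A z : R) *: f z).
Proof.
move=> mA; apply: smeasZ; apply: measurable_smeas; exact: measurable_indic.
Qed.

Lemma smeas_dual (V : normedModType R) (f : Z -> V) (g : V -> R) : in_dual g ->
  smeas f -> measurable_fun setT (fun z => g (f z)).
Proof.
by move=> [_ cg] mf; apply: smeas_measurable; exact: (@smeas_comp V R^o f g cg mf).
Qed.

End strong_measurability_toolkit.

(** * Integrals of real functions *)

Section real_integral.
Context {R : realType} {d : measure_display} {Z : measurableType d}.
Variable mu : {finite_measure set Z -> \bar R}.
Implicit Types (h k : Z -> R) (A B : set Z).

Definition integ h := mu.-integrable setT (EFin \o h).
Local Notation I h := (Rintegral mu setT h).

Lemma integ_measurable h : integ h -> measurable_fun setT h.
Proof. by move=> /integrableP[mh _]; exact/measurable_EFinP. Qed.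

Lemma integ_le h k : measurable_fun setT h -> (forall z, `|h z| <= k z) -> integ k ->
  integ h.
Proof.
move=> mh hk ik; apply: (le_integrable measurableT _ _ ik); first exact/measurable_EFinP.
move=> z _ /=; rewrite lee_fin; exact: le_trans (hk z) (ler_norm _).
Qed.

Lemma integ_bounded h M : measurable_fun setT h -> (forall z, `|h z| <= M) -> integ h.
Proof.
move=> mh hM; apply: (@integ_le h (cst M)) => //.
exact: (finite_measure_integrable_cst mu M measurableT).
Qed.

Lemma integD h k : integ h -> integ k -> integ (fun z => h z + k z).
Proof. by move=> ih ik; exact: (integrableD measurableT ih ik). Qed.

Lemma integZ c h : integ h -> integ (fun z => c * h z).
Proof. by move=> ih; exact: (integrableZl measurableT c ih). Qed.

Lemma integN h : integ h -> integ (fun z => - h z).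
Proof. by move=> /(integZ (-1)); congr integ; apply/funext => z; rewrite mulN1r. Qed.

Lemma integB h k : integ h -> integ k -> integ (fun z => h z - k z).
Proof. by move=> ih /integN ik; exact: (@integD h (fun z => - k z)). Qed.

Lemma integ_norm h : integ h -> integ (fun z => `|h z|).
Proof. by move=> ih; exact: (integrable_norm ih). Qed.

Lemma integ_sum (J : Type) (s : seq J) (h : J -> Z -> R) : (forall j, integ (h j)) ->
  integ (fun z => \sum_(j <- s) h j z).
Proof.
move=> ih; elim: s => [|j s IH].
  rewrite (_ : (fun _ => _) = cst 0); last by apply/funext => z; rewrite big_nil.
  apply: (@integ_bounded _ 0) => [|z]; first exact: measurable_cst.
  by rewrite normr0.
rewrite (_ : (fun _ => _) = (fun z => h j z + \sum_(j <- s) h j z)).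
  exact: integD.
by apply/funext => z; rewrite big_cons.
Qed.

Lemma integM h k M : integ h -> measurable_fun setT k -> (forall z, `|k z| <= M) ->
  integ (fun z => k z * h z).
Proof.
move=> ih mk kM; apply: (@integ_le _ (fun z => M * `|h z|)).
- by apply: measurable_funM => //; exact: integ_measurable.
- by move=> z; rewrite normrM ler_wpM2r.
- exact/integZ/integ_norm.
Qed.

Lemma normr_indic_le1 A z : `|\1_A z : R| <= 1.
Proof. by rewrite indicE; case: (z \in A); rewrite ?normr1 ?normr0. Qed.

Lemma integ_indic A h : measurable A -> integ h -> integ (fun z => \1_A z * h z).
Proof.
by move=> mA ih; apply: (@integM _ _ 1) => //; exact: normr_indic_le1.
Qed.

Lemma int_ext h k : (forall z, h z = k z) -> I h = I k.
Proof. by move=> hk; congr (Rintegral _ _ _); apply/funext. Qed.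

Lemma intD h k : integ h -> integ k -> I (fun z => h z + k z) = I h + I k.
Proof. by move=> ih ik; exact: (RintegralD measurableT ih ik). Qed.

Lemma intZ c h : integ h -> I (fun z => c * h z) = c * I h.
Proof. by move=> ih; exact: (RintegralZl _ measurableT ih). Qed.

Lemma intB h k : integ h -> integ k -> I (fun z => h z - k z) = I h - I k.
Proof. by move=> ih ik; exact: (RintegralB measurableT ih ik). Qed.

Lemma intN h : integ h -> I (fun z => - h z) = - I h.
Proof.
move=> ih; have := intZ (-1) ih; rewrite mulN1r => <-.
by apply: int_ext => z; rewrite mulN1r.
Qed.

Lemma int0 : I (fun _ => 0) = 0.
Proof. by rewrite /Rintegral integral0. Qed.

Lemma int_sum (J : Type) (s : seq J) (h : J -> Z -> R) : (forall j, integ (h j)) ->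
  I (fun z => \sum_(j <- s) h j z) = \sum_(j <- s) I (h j).
Proof.
move=> ih; elim: s => [|j s IH].
  rewrite big_nil (_ : (fun _ => _) = cst 0); last by apply/funext => z; rewrite big_nil.
  exact: int0.
rewrite (_ : (fun _ => _) = (fun z => h j z + \sum_(j <- s) h j z)).
  by rewrite intD//; [rewrite IH big_cons|exact: integ_sum].
by apply/funext => z; rewrite big_cons.
Qed.

Lemma int_le h k : integ h -> integ k -> (forall z, h z <= k z) -> I h <= I k.
Proof. by move=> ih ik hk; apply: (le_Rintegral measurableT). Qed.

Lemma int_ge0 h : (forall z, 0 <= h z) -> 0 <= I h.
Proof. by move=> h0; apply: Rintegral_ge0. Qed.

Lemma int_abs h : integ h -> `|I h| <= I (fun z => `|h z|).
Proof. by move=> ih; exact: (le_normr_Rintegral measurableT ih). Qed.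

Lemma int_ae h k : measurable_fun setT h -> measurable_fun setT k ->
  {ae mu, forall z, h z = k z} -> I h = I k.
Proof.
move=> mh mk hk; congr fine; apply: ae_eq_integral => //; try exact/measurable_EFinP.
by apply: filterS hk => z /= ->.
Qed.

Lemma EFin_int h : integ h -> (I h)%:E = (\int[mu]_z (h z)%:E)%E.
Proof. by move=> ih; rewrite /Rintegral fineK//; exact: (integrable_fin_num measurableT ih). Qed.

Lemma integ_ge0P h : measurable_fun setT h -> (forall z, 0 <= h z) ->
  (\int[mu]_z (h z)%:E < +oo)%E -> integ h.
Proof.
move=> mh h0 hoo; apply/integrableP; split; first exact/measurable_EFinP.
by under eq_integral do rewrite gee0_abs ?lee_fin//.
Qed.

Lemma indicM A B z : (\1_A z * \1_B z : R) = \1_(A `&` B) z.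
Proof. by rewrite indicI. Qed.

(** The integral over the negativity set is both nonnegative and nonpositive. *)
Lemma ae_int_ge0 h : integ h ->
  (forall A, measurable A -> 0 <= I (fun z => \1_A z * h z)) ->
  {ae mu, forall z, 0 <= h z}.
Proof.
move=> ih hA; have mh := integ_measurable ih.
pose A := [set z | h z < 0].
have mA : measurable A.
  have := measurable_fun_ltr mh (@measurable_cst _ _ _ R setT 0).
  by move=> /(_ measurableT [set true] Logic.I); rewrite setTI.
pose k z := \1_A z * - h z.
have k0 z : 0 <= k z.
  rewrite /k indicE; case: (boolP (z \in A)) => [|_]; last by rewrite mul0r.
  by rewrite inE /A/= mul1r oppr_ge0 => /ltW.
have ik : integ k by apply: integ_indic => //; exact: integN.
have Ik : I k = 0.
  apply/eqP; rewrite eq_le int_ge0// andbT.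
  have := intN (integ_indic mA ih); rewrite (@int_ext _ k) => [->|z].
    by rewrite oppr_le0 hA.
  by rewrite /k mulrN.
have : {ae mu, forall z, setT z -> (EFin \o k) z = 0%E}.
  apply/(ae_eq_integral_abs mu measurableT (integrableP _ _ _ ik).1).
  under eq_integral do rewrite /= ger0_norm//.
  by rewrite -EFin_int// Ik.
apply: filterS => z /(_ Logic.I)[kz]; rewrite leNgt; apply/negP => hz.
move: kz; rewrite /k indicE mem_set// mul1r => /eqP.
by rewrite oppr_eq0 lt_eqF.
Qed.

Lemma ae_int_eq0 h : integ h ->
  (forall A, measurable A -> I (fun z => \1_A z * h z) = 0) ->
  {ae mu, forall z, h z = 0}.
Proof.
move=> ih hA.
have h1 : {ae mu, forall z, 0 <= h z} by apply: ae_int_ge0 => // A mA; rewrite hA.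
have h2 : {ae mu, forall z, 0 <= - h z}.
  apply: ae_int_ge0 => [|A mA]; first exact: integN.
  have := intN (integ_indic mA ih); rewrite (@int_ext _ (fun z => \1_A z * - h z)).
    by move=> ->; rewrite hA// oppr0.
  by move=> z; rewrite mulrN.
by apply: filterS2 h1 h2 => z a b; apply/eqP; rewrite eq_le a -oppr_ge0 b.
Qed.

(** By monotone convergence the supremum is integrable, hence almost everywhere finite. *)
Lemma ae_sup_finite (a : nat -> Z -> R) C :
  (forall j, measurable_fun setT (a j)) -> (forall z, a 0%N z = 0) ->
  (forall m, integ (fun z => a (argmax a m z) z)) ->
  (forall m, I (fun z => a (argmax a m z) z) <= C) ->
  {ae mu, forall z, exists2 b, 0 <= b & forall j, a j z <= b}.
Proof.
move=> ma a0 ia iC.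
pose M m z := a (argmax a m z) z.
have M0 m z : 0 <= M m z by have := argmaxP a z (leq0n m); rewrite a0.
have Mm z : {homo M^~ z : m n / (m <= n)%N >-> m <= n}.
  move=> m n mn; apply: (@argmaxP _ _ _ a n z); apply: leq_trans mn; exact: argmax_le.
pose S z := limn (fun m => (M m z)%:E).
have mM m : measurable_fun setT (fun z => (M m z)%:E).
  by apply/measurable_EFinP; exact: integ_measurable (ia m).
have nd z : setT z -> {homo (fun m => (M m z)%:E) : m n / (m <= n)%N >-> (m <= n)%E}.
  by move=> _ m n mn; rewrite lee_fin Mm.
have cvS := cvg_monotone_convergence measurableT mM
  (fun m z _ => (M0 m z : (0%:E <= (M m z)%:E)%E)) nd.
have cvM z : cvgn (fun m => (M m z)%:E) by apply: ereal_nondecreasing_is_cvgn; exact: nd.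
have MS m z : ((M m z)%:E <= S z)%E.
  rewrite /S (cvg_lim _ (ereal_nondecreasing_cvgn (nd z Logic.I)))//.
  by apply: ereal_sup_ubound; exists m.
have S0 z : (0 <= S z)%E by apply: le_trans (MS 0%N z); rewrite lee_fin.
have mS : measurable_fun setT S.
  by apply: (emeasurable_fun_cvg (fun m z => (M m z)%:E)) => // z _; exact: cvM.
have iS : mu.-integrable setT S.
  apply/integrableP; split=> //.
  under eq_integral do rewrite gee0_abs//.
  apply: (@le_lt_trans _ _ C%:E); last exact: ltry.
  rewrite -(cvg_lim _ (cvS mu))//; apply: lime_le; first by apply/cvg_ex; eexists; exact: (cvS mu).
  by apply: nearW => m; have := iC m; rewrite -lee_fin EFin_int.
apply: filterS (integrable_ae measurableT iS) => z /(_ Logic.I) fS.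
exists (fine (S z)); first by rewrite fine_ge0.
move=> j; rewrite -lee_fin fineK//; apply: le_trans (MS j z).
by rewrite lee_fin; exact: argmaxP.
Qed.

End real_integral.

(** * Function norms and spaces of vector-valued functions *)

Section function_norms.
Context {R : realType} {d : measure_display} {Z : measurableType d}.
Variable mu : {finite_measure set Z -> \bar R}.
Implicit Types (h k : Z -> R) (rho : (Z -> R) -> \bar R).
Local Notation mf k := (measurable_fun [set: Z] (k : Z -> R)).
Local Notation I h := (Rintegral mu setT h).

(** A Banach function norm with order continuous norm, on nonnegative measurable
    functions. *)
Record function_norm rho : Prop := FunctionNorm {
  fn_ge0 : forall k, (0 <= rho k)%E;
  fn_le : forall h k, mf h -> mf k -> (forall z, 0 <= h z <= k z) ->
    (rho h <= rho k)%E;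
  fnZ : forall c k, 0 <= c -> mf k -> (forall z, 0 <= k z) ->
    rho (fun z => (c * k z)%R) = (c%:E * rho k)%E;
  fnD : forall h k, mf h -> mf k -> (forall z, 0 <= h z) -> (forall z, 0 <= k z) ->
    (rho (fun z => (h z + k z)%R) <= rho h + rho k)%E;
  fn_ae0 : forall k, mf k -> (forall z, 0 <= k z) ->
    {ae mu, forall z, k z = 0} -> rho k = 0%E;
  fn_cst1 : (rho (fun _ => 1%R) < +oo)%E;
  fn_cvg0 : forall (k_ : nat -> Z -> R) k, (forall n, mf (k_ n)) -> mf k ->
    (forall n z, 0 <= k_ n z <= k z) -> (rho k < +oo)%E ->
    (forall z, k_ n z @[n --> \oo] --> 0) -> rho (k_ n) @[n --> \oo] --> 0%E }.

(** What exponents greater than 1 add for a mixed norm: [rn_disjoint] is a weak form of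
    an upper estimate and makes the norm of the dual space order continuous; [rn_dual]
    says that the norm is determined by duality with bounded functions, and yields lower
    semicontinuity. *)
Record reflexive_norm rho : Prop := ReflexiveNorm {
  rn_norm :> function_norm rho;
  rn_l1 : exists2 c : R, 0 < c & forall k, mf k -> (forall z, 0 <= k z) ->
    (\int[mu]_z (k z)%:E <= c%:E * rho k)%E;
  rn_disjoint : exists2 kappa : R, 1 <= kappa < 2 & forall h k, mf h -> mf k ->
    (forall z, 0 <= h z) -> (forall z, 0 <= k z) -> (forall z, h z * k z = 0) ->
    (rho h <= 1)%E -> (rho k <= 1)%E -> (rho (fun z => (h z + k z)%R) <= kappa%:E)%E;
  rn_dual : forall k C, mf k -> (forall z, 0 <= k z) -> 0 <= C ->
    (forall h M, mf h -> (forall z, 0 <= h z <= M) ->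
      (\int[mu]_z (h z * k z)%:E <= ereal_sup [set \int[mu]_z (h z * k' z)%:E |
         k' in [set k' | [/\ mf k', forall z, (0 <= k' z)%R & rho k' <= C%:E]]])%E) ->
    (rho k <= C%:E)%E }.

Section bochner_space.
Context {V : normedModType R}.
Variable rho : (Z -> R) -> \bar R.
Hypothesis fn : function_norm rho.
Implicit Types f g : Z -> V.

Definition bnorm f := rho (fun z => `|f z|).

(** The Bochner space of [rho]. *)
Definition bspace f := smeas f /\ (bnorm f < +oo)%E.

Lemma bnorm_ge0 f : (0 <= bnorm f)%E.
Proof. exact: fn_ge0 fn _. Qed.

Lemma bspace_fin f : bspace f -> bnorm f \is a fin_num.
Proof. by move=> [_ f1]; rewrite ge0_fin_numE// bnorm_ge0. Qed.

Lemma bnorm_le f (k : Z -> R) : smeas f -> mf k -> (forall z, `|f z| <= k z) ->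
  (bnorm f <= rho k)%E.
Proof.
move=> mf' mk fk; apply: (fn_le fn) => // [|z]; first exact: smeas_normr.
by rewrite normr_ge0 fk.
Qed.

Lemma bnorm_leW f (W : normedModType R) (g : Z -> W) : smeas f -> smeas g ->
  (forall z, `|f z| <= `|g z|) -> (bnorm f <= rho (fun z => `|g z|%R))%E.
Proof. by move=> mf' mg; apply: bnorm_le => //; exact: smeas_normr. Qed.

Lemma bnormD f g : smeas f -> smeas g ->
  (bnorm (fun z => (f z + g z)%R) <= bnorm f + bnorm g)%E.
Proof.
move=> sf sg; have nf := smeas_normr sf; have ng := smeas_normr sg.
apply: le_trans (fnD fn nf ng _ _) => //.
apply: bnorm_le; [exact: smeasD|exact: measurable_funD|move=> z; exact: ler_normD].
Qed.

Lemma bnormZ a f : smeas f -> bnorm (fun z => a *: f z) = (`|a|%:E * bnorm f)%E.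
Proof.
move=> sf; rewrite -(fnZ fn)//; last exact: smeas_normr.
by congr rho; apply/funext => z; rewrite normrZ.
Qed.

Lemma bnormN f : bnorm (fun z => - f z) = bnorm f.
Proof. by congr rho; apply/funext => z; rewrite normrN. Qed.

Lemma bnorm_ae f g : smeas f -> smeas g -> {ae mu, forall z, f z = g z} ->
  bnorm f = bnorm g.
Proof.
move=> sf sg fg.
have half f' g' : smeas f' -> smeas g' -> {ae mu, forall z, f' z = g' z} ->
    (bnorm f' <= bnorm g')%E.
  move=> sf' sg' fg'; have sB := smeasB sf' sg'.
  have : bnorm (fun z => f' z - g' z) = 0%E.
    apply: (fn_ae0 fn) => //; first exact: smeas_normr.
    by apply: filterS fg' => z ->; rewrite subrr normr0.
  move=> e0; rewrite -[leRHS]add0e -e0.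
  apply: le_trans (bnormD sB sg').
  apply: bnorm_leW => //; first exact: smeasD.
  by move=> z; rewrite subrK.
apply/eqP; rewrite eq_le !half//.
by apply: filterS fg => z ->.
Qed.

Lemma bspaceD f g : bspace f -> bspace g -> bspace (fun z => f z + g z).
Proof.
move=> [sf f1] [sg g1]; split; first exact: smeasD.
by apply: le_lt_trans (bnormD sf sg) _; rewrite lte_add_pinfty.
Qed.

Lemma bspaceZ a f : bspace f -> bspace (fun z => a *: f z).
Proof.
move=> bf; have [sf f1] := bf; split; first exact: smeasZl.
by rewrite bnormZ// ltey_eq fin_numM// bspace_fin.
Qed.

Lemma bspaceB f g : bspace f -> bspace g -> bspace (fun z => f z - g z).
Proof.
move=> bf /(bspaceZ (-1)) bg; have := bspaceD bf bg.
by congr bspace; apply/funext => z; rewrite scaleN1r.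
Qed.

Lemma bspace_le f (W : normedModType R) (g : Z -> W) : smeas f -> smeas g ->
  (forall z, `|f z| <= `|g z|) -> (rho (fun z => `|g z|%R) < +oo)%E -> bspace f.
Proof. by move=> sf sg fg; split=> //; exact: le_lt_trans (bnorm_leW sf sg fg) _. Qed.

Lemma fn_cst_lty M : 0 <= M -> (rho (fun _ => M) < +oo)%E.
Proof.
move=> M0; rewrite (_ : (fun _ => M) = (fun _ => M * 1)).
  rewrite (fnZ fn (k := fun _ => 1))// ltey_eq fin_numM//.
  by rewrite ge0_fin_numE ?(fn_cst1 fn)//; exact: fn_ge0 fn _.
by apply/funext => z; rewrite mulr1.
Qed.

Lemma bspace_bounded f M : smeas f -> (forall z, `|f z| <= M) -> bspace f.
Proof.
move=> sf fM; split=> //; apply: le_lt_trans (@fn_cst_lty `|M| (normr_ge0 M)).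
by apply: bnorm_le => // z; exact: le_trans (fM z) (ler_norm M).
Qed.

Lemma normr_indic (A : set Z) (v : V) z : `|(\1_A z : R) *: v| = \1_A z * `|v|.
Proof. by rewrite normrZ ger0_norm. Qed.

Lemma indic_le_norm (A : set Z) (v : V) z : `|(\1_A z : R) *: v| <= `|v|.
Proof.
rewrite normrZ -[leRHS]mul1r ler_wpM2r//; exact: normr_indic_le1.
Qed.

Lemma bspace_indic A f : measurable A -> bspace f ->
  bspace (fun z => (\1_A z : R) *: f z).
Proof.
move=> mA [sf f1]; apply: (bspace_le (g := f)) => //; first exact: smeas_indic.
by move=> z; exact: indic_le_norm.
Qed.

Lemma bnorm_indic A f : measurable A -> smeas f ->
  (bnorm (fun z => (\1_A z : R) *: f z) <= bnorm f)%E.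
Proof.
move=> mA sf; apply: bnorm_leW => //; first exact: smeas_indic.
by move=> z; exact: indic_le_norm.
Qed.

(** Order continuity of the norm, after removal of the intersection of the sequence of
    sets, which is a null set. *)
Lemma bnorm_tail (E : nat -> set Z) f : bspace f -> (forall m, measurable (E m)) ->
  {homo E : m n / (m <= n)%N >-> n `<=` m} -> mu (\bigcap_m E m) = 0%E ->
  bnorm (fun z => (\1_(E m) z : R) *: f z) @[m --> \oo] --> 0%E.
Proof.
move=> [sf f1] mE dE muE; pose N := \bigcap_m E m.
have mN : measurable N by exact: bigcap_measurable.
have mEN m : measurable (E m `\` N) by exact: measurableD.
rewrite (_ : (fun m => _) = (fun m => rho (fun z => \1_(E m `\` N) z * `|f z|))).
  apply: (fn_cvg0 fn (k := fun z => `|f z|)) => //.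
  - move=> m; apply: measurable_funM; [exact: measurable_indic|exact: smeas_normr].
  - exact: smeas_normr.
  - by move=> m z; rewrite mulr_ge0//= ler_piMl.
  - move=> z; have [Nz|Nz] := pselect (N z).
      rewrite (_ : (fun m => _) = (fun _ => 0)); first exact: cvg_cst.
      by apply/funext => m; rewrite indicE memNset ?mul0r// => -[].
    have [m0 hm0] : exists m, ~ E m z.
      by apply: contrapT => /forallNP h; apply: Nz => m _; exact: contrapT (h m).
    apply: cvg_near_cst; exists m0 => // m /= m0m.
    rewrite indicE memNset ?mul0r// => -[/(dE _ _ m0m)/hm0 []].
apply/funext => m.
rewrite (@bnorm_ae _ (fun z => (\1_(E m `\` N) z : R) *: f z)).
- by congr rho; apply/funext => z; rewrite normr_indic.
- exact: smeas_indic.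
- exact: smeas_indic.
- exists N; split=> // z /= h; apply: contrapT => Nz; apply: h.
  congr (_ *: _); rewrite !indicE; congr ((nat_of_bool _)%:R); apply/idP/idP; rewrite !inE.
    by split.
  by case.
Qed.

Definition bdual (Lam : (Z -> V) -> R) :=
  (forall (a : R) f g, bspace f -> bspace g ->
     Lam (fun z => a *: f z + g z) = a * Lam f + Lam g) /\
  exists C : R, forall f, bspace f -> (`|Lam f|%:E <= C%:E * bnorm f)%E.

Lemma bdual_bounded Lam : bdual Lam -> exists2 C : R, 0 < C &
  forall f K, bspace f -> (bnorm f <= K%:E)%E -> `|Lam f| <= C * K.
Proof.
move=> [_ [C hC]]; exists (Num.max C 0 + 1); first by rewrite ltr_wpDl// le_max lexx orbT.
move=> f K bf fK; rewrite -lee_fin; apply: (le_trans (hC f bf)).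
have h0 : (0 <= bnorm f)%E by exact: bnorm_ge0.
rewrite EFinM; apply: (@le_trans _ _ ((Num.max C 0 + 1)%:E * bnorm f)%E).
  apply: lee_wpmul2r => //; rewrite lee_fin.
  by rewrite ler_wpDr// le_max lexx.
apply: lee_wpmul2l => //; rewrite lee_fin addr_ge0// le_max lexx orbT//.
Qed.

Section functional.
Variable Lam : (Z -> V) -> R.
Hypothesis dL : bdual Lam.

Lemma bdual_axpy a f g : bspace f -> bspace g ->
  Lam (fun z => a *: f z + g z) = a * Lam f + Lam g.
Proof. exact: dL.1. Qed.

Lemma bspace0 : bspace (fun _ => 0).
Proof. by apply: (@bspace_bounded _ 0) => [|z]; [exact: smeas_cst|rewrite normr0]. Qed.

Lemma bdual0 : Lam (fun _ => 0) = 0.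
Proof.
have := bdual_axpy 1 bspace0 bspace0.
rewrite (_ : (fun z => _) = (fun _ => 0)) => [h|]; first by lra.
by apply/funext => z; rewrite scaler0 addr0.
Qed.

Lemma bdualZ a f : bspace f -> Lam (fun z => a *: f z) = a * Lam f.
Proof.
move=> bf; have := bdual_axpy a bf bspace0; rewrite bdual0 addr0 => <-.
by congr Lam; apply/funext => z; rewrite addr0.
Qed.

Lemma bdualD f g : bspace f -> bspace g ->
  Lam (fun z => f z + g z) = Lam f + Lam g.
Proof.
move=> bf bg; have := bdual_axpy 1 bf bg; rewrite mul1r => <-.
by congr Lam; apply/funext => z; rewrite scale1r.
Qed.

Lemma bdualB f g : bspace f -> bspace g ->
  Lam (fun z => f z - g z) = Lam f - Lam g.
Proof.
move=> bf bg; have := bdual_axpy (-1) bg bf; rewrite mulN1r addrC => <-.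
by congr Lam; apply/funext => z; rewrite scaleN1r addrC.
Qed.

Lemma bdual_ae f g : bspace f -> bspace g -> {ae mu, forall z, f z = g z} ->
  Lam f = Lam g.
Proof.
move=> bf bg fg; apply/eqP; rewrite -subr_eq0 -bdualB// -normr_le0.
have [C C0 hC] := bdual_bounded dL.
rewrite -(mulr0 C); apply: hC; first exact: bspaceB.
rewrite (@bnorm_ae _ (fun _ => 0)); last 3 first.
- by have [] := bspaceB bf bg.
- exact: smeas_cst.
- by apply: filterS fg => z ->; rewrite subrr.
by rewrite /bnorm (fn_ae0 fn)//; apply: aeW => z; rewrite normr0.
Qed.

Lemma bdual_sum n (f : nat -> Z -> V) : (forall j, bspace (f j)) ->
  bspace (fun z => \sum_(j < n) f j z) /\
  Lam (fun z => \sum_(j < n) f j z) = \sum_(j < n) Lam (f j).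
Proof.
move=> bf; elim: n => [|n [bs IH]].
  rewrite big_ord0 (_ : (fun z => _) = (fun _ => 0)).
    by split; [exact: bspace0|exact: bdual0].
  by apply/funext => z; rewrite big_ord0.
rewrite big_ord_recr/= (_ : (fun z => _) = (fun z => \sum_(j < n) f j z + f n z)).
  by split; [exact: bspaceD|rewrite bdualD// IH].
by apply/funext => z; rewrite big_ord_recr.
Qed.

Lemma bdual_cvg (f_ : nat -> Z -> V) f : (forall n, bspace (f_ n)) -> bspace f ->
  bnorm (fun z => f_ n z - f z) @[n --> \oo] --> 0%E ->
  Lam (f_ n) @[n --> \oo] --> Lam f.
Proof.
move=> bf_ bf f0; have [C C0 hC] := bdual_bounded dL.
apply/cvgrPdist_le => e e0.
have eC : (0 < (e / C)%:E)%E by rewrite lte_fin divr_gt0.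
near=> n; rewrite distrC -bdualB//.
have -> : e = C * (e / C) by rewrite mulrCA mulfV ?mulr1// gt_eqF.
apply: hC; first exact: bspaceB.
near: n.
have : \forall n \near \oo, (bnorm (fun z => (f_ n z - f z)%R) < (e / C)%:E)%E.
  exact: (f0 _ (open_ereal_lt' eC)).
by apply: filterS => n /ltW.
Unshelve. all: by end_near.
Qed.

End functional.

End bochner_space.
End function_norms.

(** * Order continuity of functionals *)

Section order_continuity.
Context {R : realType} {d : measure_display} {Z : measurableType d}.
Variable mu : {finite_measure set Z -> \bar R}.
Local Notation mf k := (measurable_fun [set: Z] (k : Z -> R)).
Local Notation I h := (Rintegral mu setT h).
Variable rho : (Z -> R) -> \bar R.
Hypothesis rn : reflexive_norm mu rho.
Let fn : function_norm mu rho := rn.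

Lemma lt_nat (x : R) : exists n : nat, x < n%:R.
Proof.
by exists (Num.bound `|x|); apply: le_lt_trans (ler_norm _) _; exact: archi_boundP.
Qed.

Lemma geometric_unbounded (theta C : R) : 1 < theta -> exists n, C < theta ^+ n.
Proof.
move=> t1; have t10 : 0 < theta - 1 by rewrite subr_gt0.
have bern n : 1 + n%:R * (theta - 1) <= theta ^+ n.
  elim: n => [|n IH]; first by rewrite mul0r addr0 expr0.
  rewrite exprS; apply: le_trans (ler_wpM2l (le_trans ler01 (ltW t1)) IH).
  rewrite -subr_ge0 -natr1.
  have -> : theta * (1 + n%:R * (theta - 1)) - (1 + (n%:R + 1) * (theta - 1)) =
     n%:R * (theta - 1) ^+ 2 by ring.
  by rewrite mulr_ge0// sqr_ge0.
have [m] := lt_nat (C / (theta - 1)).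
exists m; apply: lt_le_trans (bern m).
by rewrite ltr_wpDl// -ltr_pdivrMr.
Qed.

Section dual.
Context {V : normedModType R}.
Variable Lam : (Z -> V) -> R.
Hypothesis dL : bdual rho Lam.

(** If [Lam] stays larger than [delta] on unit vectors supported by every set of a
    sequence decreasing to a null set, gluing one such vector to another one living
    further down the sequence gives the same with [delta] multiplied by a constant
    greater than 1, as the norm of the sum of two disjoint unit vectors is bounded by
    [kappa < 2]; iterating contradicts the boundedness of [Lam]. *)
Lemma dual_order_continuous (E : nat -> set Z) e : (forall m, measurable (E m)) ->
  {homo E : m n / (m <= n)%N >-> n `<=` m} -> mu (\bigcap_m E m) = 0%E -> 0 < e ->
  exists m, forall f, bspace rho f -> (bnorm rho f <= 1)%E ->
    `|Lam (fun z => (\1_(E m) z : R) *: f z)| <= e.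
Proof.
move=> mE dE muE e0.
pose P delta := forall m, exists f, [/\ bspace rho f, (bnorm rho f <= 1)%E,
  forall z, ~ E m z -> f z = 0 & delta < Lam f].
have [kappa /andP[k1 k2] hk] := rn_disjoint rn.
have k0 : 0 < kappa by exact: lt_le_trans k1.
(* strictly between 1 and [2 / kappa], which leaves room for the error [eta] *)
pose theta := (2 + kappa) / (2 * kappa).
have theta1 : 1 < theta by rewrite ltr_pdivlMr ?mulr_gt0//; lra.
have step delta : 0 < delta -> P delta -> P (theta * delta).
  move=> d0 Pd m.
  have [f1 [bf1 f11 f1E f1d]] := Pd m.
  pose eta := (1 - kappa / 2) * delta / 2.
  have eta0 : 0 < eta by rewrite divr_gt0// mulr_gt0//; lra.
  have bfE n : bspace rho (fun z => (\1_(E n) z : R) *: f1 z).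
    exact: (bspace_indic fn).
  have cv : Lam (fun z => (\1_(E n) z : R) *: f1 z) @[n --> \oo] --> 0.
    rewrite -(bdual0 fn dL); apply: (bdual_cvg fn dL) => //; first exact: (bspace0 fn).
    rewrite (_ : (fun n => _) = (fun n => bnorm rho (fun z => (\1_(E n) z : R) *: f1 z))).
      exact: (bnorm_tail fn).
    by apply/funext => n; congr bnorm; apply/funext => z; rewrite subr0.
  have /cvgrPdist_lt/(_ eta eta0)[n0 _ hn0] := cv.
  pose n := maxn n0 m.
  have Ln : `|Lam (fun z => (\1_(E n) z : R) *: f1 z)| < eta.
    by have := hn0 n (leq_maxl _ _); rewrite /= sub0r normrN.
  have [f2 [bf2 f21 f2E f2d]] := Pd n.
  pose g1 z := f1 z - (\1_(E n) z : R) *: f1 z.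
  have bg1 : bspace rho g1 by exact: (bspaceB fn).
  have g1le : forall z, `|g1 z| <= `|f1 z|.
    move=> z; rewrite /g1 indicE; case: (z \in E n).
      by rewrite scale1r subrr normr0.
    by rewrite scale0r subr0.
  have g11 : (bnorm rho g1 <= 1)%E.
    by apply: le_trans f11; apply: (bnorm_leW fn) => //; [case: bg1|case: bf1].
  have bs : bspace rho (fun z => g1 z + f2 z) by exact: (bspaceD fn).
  exists (fun z => kappa^-1 *: (g1 z + f2 z)); split.
  - exact: (bspaceZ fn).
  - rewrite (bnormZ fn); last by case: bs.
    rewrite ger0_norm ?invr_ge0 ?(ltW k0)//.
    have : (bnorm rho (fun z => g1 z + f2 z)%R <= kappa%:E)%E.
      have [sg1 _] := bg1; have [sf2 _] := bf2; have [sgf _] := bs.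
      apply: le_trans (hk (fun z => `|g1 z|) (fun z => `|f2 z|) _ _ _ _ _ _ _) => //.
      + apply: (bnorm_le fn) => //.
          by apply: measurable_funD; exact: smeas_normr.
        by move=> z; exact: ler_normD.
      + exact: smeas_normr.
      + exact: smeas_normr.
      + move=> z; have [Ez|Ez] := pselect (E n z).
          by rewrite /g1 indicE mem_set// scale1r subrr normr0 mul0r.
        by rewrite f2E// normr0 mulr0.
    move=> /(@lee_wpmul2l _ (kappa^-1%:E)); rewrite lee_fin invr_ge0 (ltW k0).
    by move=> /(_ isT) /le_trans; apply; rewrite -EFinM mulVf ?gt_eqF.
  - move=> z Ez; rewrite /g1 f1E// scaler0 subr0 add0r f2E ?scaler0//.
    by move=> /(dE _ _ (leq_maxr n0 m)).
  - rewrite (bdualZ fn dL)// (bdualD dL)// (bdualB dL)//.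
    have kt : kappa * theta = 1 + kappa / 2 by rewrite /theta; field; rewrite gt_eqF.
    rewrite -(ltr_pM2l k0) mulrA kt mulrA mulfV ?gt_eqF// mul1r.
    have kd : kappa * delta < 2 * delta by rewrite ltr_pM2r.
    move: Ln; rewrite ltr_norml /eta => /andP[_ Ln]; lra.
apply: contrapT => /forallNP far.
have [C C0 hC] := bdual_bounded fn dL.
have Pe : P e.
  move=> m; have := far m => /existsNP[f /not_implyP[bf /not_implyP[f1]]].
  move=> /negP; rewrite -ltNge => fe.
  pose g z := (\1_(E m) z : R) *: f z.
  have bg : bspace rho g by exact: (bspace_indic fn).
  have g1 : (bnorm rho g <= 1)%E.
    by apply: le_trans f1; apply: (bnorm_indic fn) => //; case: bf.
  have gE z : ~ E m z -> g z = 0 by move=> Ez; rewrite /g indicE memNset// scale0r.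
  have [Lg|Lg] := leP 0 (Lam g).
    by exists g; split=> //; move: fe; rewrite ger0_norm.
  exists (fun z => -1 *: g z); split.
  - exact: (bspaceZ fn).
  - by rewrite (bnormZ fn) ?normrN1 ?mul1e//; case: bg.
  - by move=> z Ez; rewrite gE// scaler0.
  - by rewrite (bdualZ fn dL)// mulN1r; move: fe; rewrite ltr0_norm.
have Pn n : P (theta ^+ n * e).
  elim: n => [|n IH]; first by rewrite expr0 mul1r.
  rewrite exprS -mulrA; apply: step => //.
  by rewrite mulr_gt0// exprn_gt0// (lt_trans _ theta1).
have [n hn] := geometric_unbounded (C / e) theta1.
have [f [bf f1 _ Lf]] := Pn n 0%N.
have := hC f 1 bf f1; rewrite mulr1 => h.
have : C < C.
  apply: lt_le_trans (le_trans (ler_norm (Lam f)) h).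
  by apply: lt_trans Lf; rewrite -ltr_pdivrMr.
by rewrite ltxx.
Qed.

End dual.

(** If the property held for sets of arbitrarily small measure, it would hold for the
    tails of a sequence of such sets with summable measures, which decrease to a null
    set. *)
Lemma small_sets (Bad : set Z -> Prop) :
  (forall A B, measurable A -> measurable B -> A `<=` B -> Bad A -> Bad B) ->
  (forall E : nat -> set Z, (forall m, measurable (E m)) ->
    {homo E : m n / (m <= n)%N >-> n `<=` m} -> mu (\bigcap_m E m) = 0%E ->
    exists m, ~ Bad (E m)) ->
  exists2 delta : R, 0 < delta & forall A, measurable A -> (mu A <= delta%:E)%E -> ~ Bad A.
Proof.
move=> monoB seqB; apply: contrapT => far.
have /choice[A hA] : forall n : nat, exists A, [/\ measurable A,
    (mu A <= (1 / (2 ^ n.+1)%:R)%:E)%E & Bad A].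
  move=> n; apply: contrapT => h; apply: far.
  exists (1 / (2 ^ n.+1)%:R); first by rewrite divr_gt0// ltr0n expn_gt0.
  by move=> A mA muA BA; apply: h; exists A.
pose E m := \bigcup_(n in [set n | (m <= n)%N]) A n.
have mA n : measurable (A n) by have [] := hA n.
have [|||m] := seqB E.
- by move=> m; apply: bigcup_measurable => n _.
- by move=> m n mn z [k /= nk Akz]; exists k => //=; exact: leq_trans nk.
- apply: (@lim_sup_set_cvg0 _ _ _ mu A) => //.
  apply: (@le_lt_trans _ _ (\big[+%E/0%R]_(0 <= n <oo) (1 / (2 ^ n.+1)%:R)%:E)%E).
    by apply: lee_nneseries => [n _ _|n _]; [exact: measure_ge0|have [_ h _] := hA n; exact: h].
  have := epsilon_trick0 xpredT (ler01 : (0 : R) <= 1).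
  by move=> /le_lt_trans; apply; exact: ltry.
apply; apply: (monoB (A m)) => //.
- by apply: bigcup_measurable => n _.
- by move=> z Az; exists m => /=.
- by have [] := hA m.
Qed.

Section dual.
Context {V : normedModType R}.
Variable Lam : (Z -> V) -> R.
Hypothesis dL : bdual rho Lam.

(** The order continuity of [Lam] along decreasing sequences becomes uniform by
    [small_sets]. *)
Lemma dual_uniform e : 0 < e -> exists2 delta : R, 0 < delta &
  forall A f, measurable A -> (mu A <= delta%:E)%E -> bspace rho f ->
    (bnorm rho f <= 1)%E -> `|Lam (fun z => (\1_A z : R) *: f z)| <= e.
Proof.
move=> e0.
pose Bad A := exists f, [/\ bspace rho f, (bnorm rho f <= 1)%E &
  e < `|Lam (fun z => (\1_A z : R) *: f z)|].
have [||delta d0 hd] := @small_sets Bad.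
- move=> A B mA mB AB [f [bf f1 Lf]].
  exists (fun z => (\1_A z : R) *: f z); split.
  + exact: (bspace_indic fn).
  + by apply: le_trans f1; apply: (bnorm_indic fn) => //; case: bf.
  + move: Lf; congr (_ < `|Lam _|); apply/funext => z.
    rewrite scalerA indicM; congr (_ *: _); congr (\1__ z).
    by rewrite setIidr.
- move=> E mE dE muE.
  have [m hm] := dual_order_continuous dL mE dE muE e0.
  by exists m => -[f [bf f1]]; rewrite ltNge hm.
exists delta => // A f mA muA bf f1; rewrite leNgt; apply/negP => Lf.
by apply: (hd A mA muA); exists f.
Qed.

End dual.

Lemma bspace_integ (k : Z -> R) : mf k -> (rho (fun z => `|k z|%R) < +oo)%E ->
  integ mu k.
Proof.
move=> mk k1; have [c c0 hc] := rn_l1 rn.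
apply: (@integ_le _ _ _ mu k (fun z => `|k z|)) => //.
apply: integ_ge0P => //; first exact: measurableT_comp.
apply: le_lt_trans (hc _ _ _) _ => //; first exact: measurableT_comp.
by rewrite lte_mul_pinfty// ?lee_fin ?ltW// (fn_ge0 fn).
Qed.

Lemma int_le_norm : exists2 c : R, 0 < c & forall (k : Z -> R) K, mf k ->
  (forall z, 0 <= k z) -> (rho k <= K%:E)%E -> I k <= c * K.
Proof.
have [c c0 hc] := rn_l1 rn; exists c => // k K mk k0 kK.
have ik : integ mu k.
  apply: bspace_integ => //; rewrite (_ : (fun z => _) = k).
    by apply: le_lt_trans kK _; exact: ltry.
  by apply/funext => z; rewrite ger0_norm.
rewrite -lee_fin EFin_int//; apply: (le_trans (hc k mk k0)).
by rewrite EFinM; apply: lee_wpmul2l => //; rewrite lee_fin ltW.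
Qed.

Lemma integral_bdual : bdual rho (fun k : Z -> R^o => I k).
Proof.
have [c c0 hc] := rn_l1 rn.
have ib (k : Z -> R^o) : bspace rho k -> integ mu k.
  by move=> [sk k1]; apply: bspace_integ => //; exact: smeas_measurable.
split=> [a f g bf bg|].
  rewrite intD; [by rewrite intZ//; exact: ib| |exact: ib].
  by apply: integZ; exact: ib.
exists c => k bk; have ik := ib k bk.
apply: (@le_trans _ _ (I (fun z => `|k z|))%:E).
  by rewrite lee_fin; exact: int_abs.
rewrite EFin_int; last exact: integ_norm.
apply: hc => //; apply: measurableT_comp => //; exact: integ_measurable ik.
Qed.

(** This is [dual_uniform] for the integral, a bounded functional by [rn_l1]. *)
Lemma uniform_integrability K e : 0 <= K -> 0 < e -> exists2 delta : R, 0 < delta &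
  forall A (k : Z -> R), measurable A -> (mu A <= delta%:E)%E -> mf k ->
    (rho (fun z => `|k z|%R) <= K%:E)%E -> I (fun z => \1_A z * `|k z|) <= e.
Proof.
move=> K0 e0.
have K1 : 0 < K + 1 by rewrite ltr_wpDl.
have [delta d0 hd] := dual_uniform integral_bdual (divr_gt0 e0 K1).
exists delta => // A k mA muA mk kK.
pose f z : R^o := (K + 1)^-1 * `|k z|.
have mkn : mf (fun z => `|k z|) by exact: measurableT_comp.
have mff : mf f by apply: measurable_funM.
have nf : bnorm rho f = ((K + 1)^-1%:E * rho (fun z => `|k z|%R))%E.
  rewrite -(fnZ fn)// ?invr_ge0 ?(ltW K1)//; congr rho; apply/funext => z.
  by rewrite ger0_norm// mulr_ge0// invr_ge0 ltW.
have f1 : (bnorm rho f <= 1)%E.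
  rewrite nf; apply: (@le_trans _ _ ((K + 1)^-1%:E * K%:E)%E).
    by apply: lee_wpmul2l => //; rewrite lee_fin invr_ge0 ltW.
  by rewrite -EFinM lee_fin mulrC ler_pdivrMr// mul1r lerDl.
have bf : bspace rho f.
  split; first exact: measurable_smeas.
  by apply: le_lt_trans f1 _; exact: ltry.
have := hd A f mA muA bf f1.
have ik : integ mu (fun z => `|k z|).
  apply: integ_norm; apply: bspace_integ => //.
  by apply: le_lt_trans kK _; exact: ltry.
rewrite (_ : (fun z => _) = (fun z => (K + 1)^-1 * (\1_A z * `|k z|))); last first.
  by apply/funext => z; rewrite /f /GRing.scale/= mulrCA.
rewrite intZ; last exact: integ_indic.
rewrite normrM gtr0_norm ?invr_gt0// mulrC ler_pdivrMr// mulfVK ?gt_eqF//.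
by move=> h; apply: le_trans (ler_norm _) h.
Qed.

(** By Chebyshev's inequality the sets where [M < |k|] are uniformly small. *)
Lemma uniform_truncation K e : 0 <= K -> 0 < e -> exists2 M : nat, True &
  forall k : Z -> R, mf k -> (rho (fun z => `|k z|%R) <= K%:E)%E ->
    I (fun z => \1_[set z | M%:R < `|k z|] z * `|k z|) <= e.
Proof.
move=> K0 e0; have [delta d0 hd] := uniform_integrability K0 e0.
have [c c0 hc] := int_le_norm.
have [m hm] := lt_nat (c * K / delta); pose M := m.+1.
have M0 : (0 : R) < M%:R by rewrite ltr0n.
exists M => // k mk kK.
have mkn : mf (fun z => `|k z|) by exact: measurableT_comp.
have mA : measurable [set z | M%:R < `|k z|].
  have := measurable_fun_ltr (@measurable_cst _ _ _ R setT M%:R) mkn.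
  by move=> /(_ measurableT [set true] Logic.I); rewrite setTI.
have ik : integ mu (fun z => `|k z|).
  by apply/integ_norm/bspace_integ => //; apply: le_lt_trans kK _; exact: ltry.
apply: hd => //.
have iA : integ mu (\1_[set z | M%:R < `|k z|] : Z -> R).
  apply: (@integ_bounded _ _ _ mu _ 1); first exact: measurable_indic.
  exact: normr_indic_le1.
have : I (fun z => M%:R * \1_[set z | M%:R < `|k z|] z) <= c * K.
  apply: le_trans (hc _ _ mkn _ kK) => //.
  apply: int_le => //; first exact: integZ.
  move=> z; rewrite indicE; case: (boolP (z \in _)); rewrite ?mulr0// inE/= mulr1.
  exact: ltW.
rewrite intZ// -lee_fin EFinM EFin_int// integral_indic// setIT => h.
rewrite -[X in (_ * X)%E]fineK in h; last exact: fin_num_measure.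
rewrite -EFinM lee_fin in h.
rewrite -[leLHS]fineK; last exact: fin_num_measure.
rewrite lee_fin.
rewrite mulrC -ler_pdivlMr// in h; apply: (le_trans h).
rewrite ler_pdivrMr// -ler_pdivrMl// mulrC.
by apply: (le_trans (ltW hm)); rewrite ler_nat.
Qed.

End order_continuity.

(** * Weak sequential compactness of real functions *)

Section subsequences.
Context {R : realType}.

(** A cluster point of the sequence in the compact product of the intervals
    provides the subsequence. *)
Lemma bounded_diagonal (a : nat -> nat -> R) (K : nat -> R) :
  (forall c n, `|a c n| <= K c) -> exists n_ : nat -> nat,
  {homo n_ : i j / (i < j)%N} /\ forall c, cvgn (fun k => a c (n_ k)).
Proof.
move=> aK.
pose T := prod_topology (fun _ : nat => (R : topologicalType)).
have cK := @tychonoff nat (fun _ => (R : topologicalType))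
  (fun c => `[- K c, K c]%classic) (fun c => @segment_compact R (- K c) (K c)).
pose u n : T := fun c => a c n.
have uK : (u n @[n --> \oo]) [set f : T | forall c, `[- K c, K c]%classic (f c)].
  by exists 0%N => // n _ c; rewrite /= in_itv/= -ler_norml; exact: aK.
have [x [_ clx]] := cK _ _ uK.
have pick N k : exists n, (N <= n)%N /\
    forall c, (c <= k)%N -> `|x c - a c n| < k.+1%:R^-1.
  have B0 : nbhs x [set y : T | forall c, (c <= k)%N -> `|x c - y c| < k.+1%:R^-1].
    have k0 : 0 < k.+1%:R^-1 :> R by rewrite invr_gt0 ltr0n.
    have h c : nbhs x [set y : T | `|x c - y c| < k.+1%:R^-1].
      exact: (@proj_continuous nat (fun _ => (R : topologicalType)) c x _
        (nbhsx_ballx (x c) _ k0)).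
    elim: {1}k => [|j IH].
      by apply: filterS (h 0%N) => y h1 c; rewrite leqn0 => /eqP ->.
    apply: filterS2 IH (h j.+1) => y h1 h2 c.
    by rewrite leq_eqVlt => /predU1P[->//|]; exact: h1.
  have A0 : (u n @[n --> \oo]) [set u n | n in [set n | (N <= n)%N]].
    by exists N => // n /= Nn; exists n.
  have [y [[n /= Nn <-] h]] := clx _ _ A0 B0.
  by exists n.
have /choice[f hf] : forall Nk : nat * nat, exists n, (Nk.1 <= n)%N /\
    forall c, (c <= Nk.2)%N -> `|x c - a c n| < Nk.2.+1%:R^-1.
  by move=> [N k]; exact: pick.
pose n_ := fix n_ k := if k is k'.+1 then f ((n_ k').+1, k) else f (0, 0)%N.
have nS k : (n_ k < n_ k.+1)%N by have [] := hf ((n_ k).+1, k.+1).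
have nx k c : (c <= k)%N -> `|x c - a c (n_ k)| < k.+1%:R^-1.
  by case: k => [|k] ck; [have [_] := hf (0, 0)%N|have [_] := hf ((n_ k).+1, k.+1)]; exact.
exists n_; split.
  by apply: homo_ltn => // i j k; exact: ltn_trans.
move=> c; apply/cvg_ex; exists (x c); apply/cvgrPdist_lt => e e0.
have [m hm] : exists m : nat, e^-1 < m%:R.
  by exists (Num.bound e^-1); apply: archi_boundP; rewrite invr_ge0 ltW.
exists (maxn m c) => // k /=; rewrite geq_max => /andP[mk ck].
apply: lt_le_trans (nx k c ck) _.
rewrite -[leRHS]invrK lef_pV2 ?posrE ?invr_gt0 ?ltr0n//.
by apply: le_trans (ltW hm) _; rewrite ler_nat ltnW.
Qed.

Lemma uniform_approx_cvg (u : nat -> R) :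
  (forall e, 0 < e -> exists v : nat -> R, cvgn v /\ forall n, `|u n - v n| <= e) ->
  cvgn u.
Proof.
move=> h; apply: cauchy_cvg; apply: cauchy_exP => e e0.
have e20 : 0 < e / 2 by rewrite divr_gt0.
have [v [/cvg_ex[l /= cv] uv]] := h _ e20.
have /cvgrPdist_lt/(_ _ e20)[N _ hN] := cv.
exists l; exists N => // n /= /hN /= h1; have h2 := uv n.
rewrite /ball/= -(subrK (v n) l) -addrA; apply: le_lt_trans (ler_normD _ _) _.
by rewrite (splitr e); apply: ltr_leD => //; rewrite distrC.
Qed.

Lemma cvg_sum_ord m (u : nat -> nat -> R) (l : nat -> R) :
  (forall j, u j k @[k --> \oo] --> l j) ->
  \sum_(j < m) u j k @[k --> \oo] --> \sum_(j < m) l j.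
Proof.
move=> ul; elim: m => [|m IH].
  rewrite big_ord0; under eq_fun do rewrite big_ord0; exact: cvg_cst.
by rewrite big_ord_recr/=; under eq_fun do rewrite big_ord_recr/=; apply: cvgD.
Qed.

End subsequences.

Section weak_limits.
Context {R : realType} {d : measure_display} {Z : measurableType d}.
Variable mu : {finite_measure set Z -> \bar R}.
Local Notation mf k := (measurable_fun [set: Z] (k : Z -> R)).
Local Notation I h := (Rintegral mu setT h).

(** Projection argument in the pre-Hilbert space of bounded functions. The functions
    on which the sequence converges weakly form a subspace containing the sequence
    itself; if [h - s] almost realizes the distance of [h] to this subspace, then it
    is almost orthogonal to every [phi n]. *)
Lemma prehilbert_weak_cvg (phi : nat -> Z -> R) M :
  (forall n, mf (phi n)) -> (forall n z, `|phi n z| <= M) ->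
  (forall m, cvgn (fun n => I (fun z => phi n z * phi m z))) ->
  forall h K, mf h -> (forall z, `|h z| <= K) ->
    cvgn (fun n => I (fun z => phi n z * h z)).
Proof.
move=> mphi phiM cphi h K mh hK.
pose bd (s : Z -> R) := mf s /\ exists C, forall z, `|s z| <= C.
have ibd s : bd s -> integ mu s by move=> [ms [C sC]]; exact: (@integ_bounded _ _ _ mu s C).
have bdM s t : bd s -> bd t -> bd (fun z => s z * t z).
  move=> [ms [C sC]] [mt [D tD]]; split; first exact: measurable_funM.
  by exists (C * D) => z; rewrite normrM; exact: ler_pM.
have bdD a s t : bd s -> bd t -> bd (fun z => s z + a * t z).
  move=> [ms [C sC]] [mt [D tD]]; split.
    by apply: measurable_funD => //; exact: measurable_funM.
  exists (C + `|a| * D) => z; apply: le_trans (ler_normD _ _) _.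
  by apply: lerD => //; rewrite normrM ler_wpM2l.
have bphi n : bd (phi n) by split=> //; exists M.
have bh : bd h by split=> //; exists K.
pose S s := bd s /\ cvgn (fun n => I (fun z => phi n z * s z)).
have SD a s m : S s -> S (fun z => s z + a * phi m z).
  move=> [bs cs]; split; first exact: bdD.
  rewrite (_ : (fun n => _) = (fun n => I (fun z => phi n z * s z) +
      a * I (fun z => phi n z * phi m z))).
    by apply: is_cvgD => //; apply: is_cvgMr; exact: cphi.
  apply/funext => n; rewrite -intZ -?intD.
  - by apply: int_ext => z; rewrite mulrDr mulrCA.
  - by apply/ibd/bdM.
  - by apply/integZ/ibd/bdM.
  - by apply/ibd/bdM.
have S0 : S (fun _ => 0).
  split; first by split; [exact: measurable_cst|exists 0 => z; rewrite normr0].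
  rewrite (_ : (fun n => _) = (fun _ => 0)); first exact: is_cvg_cst.
  by apply/funext => n; rewrite -[RHS](int0 mu); apply: int_ext => z; rewrite mulr0.
pose q s := I (fun z => s z * s z).
pose dist := [set q (fun z => h z - s z) | s in S].
have dist0 : has_inf dist.
  split; first by exists (q (fun z => h z - 0)); exists (fun _ => 0).
  by exists 0 => _ [s _ <-]; apply: int_ge0 => z; rewrite -expr2 sqr_ge0.
pose L := `|I (fun _ => M * M)| + 1; have L0 : 0 < L by rewrite ltr_wpDl.
apply: uniform_approx_cvg => e e0.
pose eta := e / L; have eta0 : 0 < eta by rewrite divr_gt0.
have eta20 : 0 < eta ^+ 2 by rewrite exprn_gt0.
have [_ [s Ss <-] hs] := inf_adherent eta20 dist0.
exists (fun n => I (fun z => phi n z * s z)); split; first by case: Ss.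
move=> n; have [bs _] := Ss.
pose w z := h z - s z.
have bw : bd w.
  by have := bdD (-1) _ _ bh bs; congr bd; apply/funext => z; rewrite mulN1r.
rewrite -intB; [|by apply/ibd/bdM|by apply/ibd/bdM].
rewrite (@int_ext _ _ _ mu _ (fun z => phi n z * w z)); last first.
  by move=> z; rewrite mulrBr.
(* [w - t phi n] is still a difference of [h] and a function of the subspace, so that
   its square norm is not smaller than the infimum; then take [t] equal to [eta] and to
   [- eta] *)
have key t : 2 * t * I (fun z => phi n z * w z) <= eta ^+ 2 + t ^+ 2 * L.
  have h1 : inf dist <= q (fun z => w z - t * phi n z).
    apply: ge_inf; first exact: dist0.2.
    exists (fun z => s z + t * phi n z); first exact: SD.
    by congr q; apply/funext => z; rewrite /w opprD addrA.
  have h2 : q (fun z => w z - t * phi n z) =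
      q w - 2 * t * I (fun z => phi n z * w z) + t ^+ 2 * q (phi n).
    have i1 : integ mu (fun z => w z * w z) by apply/ibd/bdM.
    have i2 : integ mu (fun z => phi n z * w z) by apply/ibd/bdM.
    have i3 : integ mu (fun z => phi n z * phi n z) by apply/ibd/bdM.
    rewrite /q -(intZ (2 * t) i2) -(intZ (t ^+ 2) i3) -(intB i1 (integZ _ i2)).
    rewrite -(intD (integB i1 (integZ _ i2)) (integZ _ i3)).
    by apply: int_ext => z; ring.
  have h3 : q (phi n) <= L.
    apply: (@le_trans _ _ (I (fun _ => M * M))).
      apply: int_le; first by apply/ibd/bdM.
        by apply: (@integ_bounded _ _ _ mu _ `|M * M|) => //; exact: measurable_cst.
      move=> z; rewrite -[leLHS]ger0_norm -?expr2 ?sqr_ge0// normrX !expr2.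
      exact: ler_pM.
    by apply: le_trans (ler_norm _) _; rewrite /L lerDl.
  have h4 : t ^+ 2 * q (phi n) <= t ^+ 2 * L by rewrite ler_wpM2l ?sqr_ge0.
  rewrite -/w -/(q w) in hs; lra.
have k1 := key (eta / L ^+ 0); have k2 := key (- eta).
rewrite expr0 divr1 in k1.
set x := I _ in k1 k2 *.
have L1 : 1 <= L by rewrite /L lerDr.
have le1 x' : 2 * eta * x' <= eta ^+ 2 + eta ^+ 2 * L -> x' <= e.
  move=> h'; have -> : e = eta * L by rewrite /eta mulfVK ?gt_eqF.
  have h2 : 2 * eta * x' <= 2 * eta * (eta * L).
    apply: (le_trans h'); have : eta ^+ 2 <= eta ^+ 2 * L by rewrite ler_peMr// ltW.
    by rewrite expr2; lra.
  by move: h2; rewrite ler_pM2l//; lra.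
rewrite ler_norml; apply/andP; split; last exact: le1.
rewrite lerNl; apply: le1; move: k2; rewrite sqrrN; lra.
Qed.

(** Absolute continuity in the epsilon-delta sense makes the finitely additive [nu]
    countably additive, hence a charge. *)
Lemma radon_nikodym_density (nu : set Z -> R) :
  (forall A B, measurable A -> measurable B -> A `&` B = set0 ->
    nu (A `|` B) = nu A + nu B) ->
  (forall e, 0 < e -> exists2 delta : R, 0 < delta &
    forall A, measurable A -> (mu A <= delta%:E)%E -> `|nu A| <= e) ->
  exists g, integ mu g /\ forall A, measurable A -> nu A = I (fun z => \1_A z * g z).
Proof.
move=> nuD nuc.
have nu0 : nu set0 = 0.
  have := nuD set0 set0 measurable0 measurable0 (setI0 _).
  by rewrite setU0 => h; lra.
pose nuE A := (nu A)%:E.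
have nuE0 : nuE set0 = 0%E by rewrite /nuE nu0.
have nuEfin A : measurable A -> nuE A \is a fin_num by [].
have nuEs : semi_sigma_additive nuE.
  move=> F mF tF mUF.
  pose T n := \bigcup_(i in [set i | (n <= i)%N]) F i.
  have mT n : measurable (T n) by apply: bigcup_measurable.
  have TS n : T n = F n `|` T n.+1.
    apply/seteqP; split=> z.
      move=> [i /= ni Fi]; move: ni; rewrite leq_eqVlt => /predU1P[->|ni]; first by left.
      by right; exists i.
    by move=> [Fz|[i /= ni Fi]]; [exists n => /=|exists i => //=; exact: ltnW].
  have FT n : F n `&` T n.+1 = set0.
    apply/seteqP; split=> // z [Fn [i /= ni Fi]].
    have ni' : n = i by apply: (tF n i Logic.I Logic.I); exists z.
    by rewrite ni' ltnn in ni.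
  have sumE n : (\sum_(0 <= i < n) nuE (F i))%E = (nu (\bigcup_i F i) - nu (T n))%:E.
    elim: n => [|n IH].
      rewrite big_nil (_ : T 0%N = \bigcup_i F i) ?subrr//.
      by apply/seteqP; split=> z [i _ Fi]; exists i.
    rewrite big_nat_recr//= IH /nuE -EFinD; congr EFin.
    by rewrite (TS n) nuD//; lra.
  have T0 : \bigcap_n T n = set0.
    apply/seteqP; split=> // z Tz.
    have [i _ Fi] := Tz 0%N Logic.I; have [j /= ij Fj] := Tz i.+1 Logic.I.
    by have : (F i `&` T i.+1) z; [split=> //; exists j|rewrite FT].
  have muT : mu (T n) @[n --> \oo] --> 0%E.
    rewrite -(measure0 mu) -T0; apply: nonincreasing_cvg_mu => //.
    - by rewrite ltey_eq fin_num_measure.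
    - by rewrite T0.
    - apply/nonincreasing_seqP => n; apply/subsetPset => z [i /= ni Fi].
      by exists i => //=; exact: ltnW.
  rewrite (_ : (fun n => _) = (fun n => (nu (\bigcup_i F i) - nu (T n))%:E)); last first.
    by apply/funext => n; exact: sumE.
  apply: cvg_EFin; first exact: nearW.
  rewrite -[X in _ --> X]subr0; apply: cvgB; first exact: cvg_cst.
  apply/cvgrPdist_le => e e0; have [delta d0 hd] := nuc e e0.
  have : \forall n \near \oo, (mu (T n) < delta%:E)%E.
    by apply: (muT _ (open_ereal_lt' _)); rewrite lte_fin.
  by apply: filterS => n Tn; rewrite sub0r normrN; apply: hd => //; exact: ltW.
pose m := isCharge.Build _ _ _ nuE nuE0 nuEfin nuEs.
pose nuC : {charge set Z -> \bar R} := HB.pack nuE m.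
have dom : nuC `<< mu.
  move=> N N0 A mA AN; rewrite [LHS]/(nuE A) /nuE; congr EFin.
  apply/eqP; rewrite -normr_le0; apply/ler_addgt0Pr => e e0; rewrite add0r.
  have [delta d0 hd] := nuc e e0; apply: hd => //.
  by rewrite (N0 A mA AN) lee_fin ltW.
pose f := Radon_Nikodym nuC mu.
have ff z : f z \is a fin_num by exact: Radon_Nikodym_fin_num.
have fi : mu.-integrable setT f by exact: Radon_Nikodym_integrable.
have fE : EFin \o (fine \o f) = f by apply/funext => z /=; rewrite fineK.
exists (fine \o f); split; first by rewrite /integ fE.
move=> A mA; have := Radon_Nikodym_integral dom mA.
rewrite [nuC A]/(nuE A) /nuE -/f -[LHS]/((nu A)%:E) integral_mkcond => h.
rewrite -[LHS]/(fine (nu A)%:E) h /Rintegral; congr fine; apply: eq_integral => z _.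
rewrite /patch/= indicE; case: (z \in A); last by rewrite mul0r.
by rewrite mul1r fineK.
Qed.

End weak_limits.

Section weak_compactness.
Context {R : realType} {d : measure_display} {Z : measurableType d}.
Variable mu : {finite_measure set Z -> \bar R}.
Local Notation mf k := (measurable_fun [set: Z] (k : Z -> R)).
Local Notation I h := (Rintegral mu setT h).
Variable rho : (Z -> R) -> \bar R.
Hypothesis rn : reflexive_norm mu rho.

Definition truncate (M : nat) (k : Z -> R) z := if `|k z| <= M%:R then k z else 0.

Lemma truncate_measurable M k : mf k -> mf (truncate M k).
Proof.
move=> mk; apply: measurable_fun_ifT => //.
by apply: measurable_fun_ler => //; exact: measurableT_comp.
Qed.

Lemma truncate_bounded M k z : `|truncate M k z| <= M%:R.
Proof. by rewrite /truncate; case: ifP => // _; rewrite normr0. Qed.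

Lemma indic_disjointU (A B : set Z) z : A `&` B = set0 ->
  \1_(A `|` B) z = \1_A z + \1_B z :> R.
Proof.
move=> AB; rewrite !indicE in_setU.
case: (boolP (z \in A)) => zA; case: (boolP (z \in B)) => zB; rewrite ?addr0 ?add0r//.
have : (A `&` B) z by split; [move: zA|move: zB]; rewrite inE.
by rewrite AB.
Qed.

Lemma truncate_diff M k z :
  `|k z - truncate M k z| = \1_[set z | M%:R < `|k z|] z * `|k z|.
Proof.
rewrite /truncate indicE; case: leP => h.
  by rewrite subrr normr0 memNset ?mul0r//= ltNge h.
by rewrite subr0 mem_set// mul1r.
Qed.

(** Truncation, which is harmless by uniform integrability, reduces to uniformly bounded
    functions; there it is enough that the countably many scalar products of terms of
    the sequence converge. The limits of set integrals have densities by
    [radon_nikodym_density]. *)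
Lemma weak_compactness (J : countType) (psi : J -> nat -> Z -> R) (K : J -> R) :
  (forall j n, mf (psi j n)) ->
  (forall j n, (rho (fun z => `|psi j n z|%R) <= (K j)%:E)%E) ->
  exists (n_ : nat -> nat) (beta : J -> Z -> R),
    [/\ {homo n_ : i j / (i < j)%N}, forall j, integ mu (beta j) &
      forall j A, measurable A ->
        I (fun z => \1_A z * psi j (n_ k) z) @[k --> \oo] -->
        I (fun z => \1_A z * beta j z)].
Proof.
move=> mpsi psiK.
have K0 j : 0 <= K j.
  by rewrite -lee_fin; apply: le_trans (psiK j 0%N); exact: (fn_ge0 rn).
have ipsi j n : integ mu (psi j n).
  apply: (bspace_integ rn) => //; apply: le_lt_trans (psiK j n) _; exact: ltry.
(* [c] codes an index [j], a truncation level [M] and a rank [m] in the sequence *)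
pose a c n := if unpickle c is Some jMm then
    I (fun z => truncate jMm.1.2 (psi jMm.1.1 n) z *
                truncate jMm.1.2 (psi jMm.1.1 jMm.2) z) else 0.
pose D c := if @unpickle (J * nat * nat)%type c is Some jMm then
    I (fun _ => jMm.1.2%:R * jMm.1.2%:R) else 0.
have itr M k : mf k -> integ mu (truncate M k).
  move=> mk; apply: (@integ_bounded _ _ _ mu _ M%:R).
    exact: truncate_measurable.
  exact: truncate_bounded.
have itrM M k h N : mf k -> mf h -> (forall z, `|h z| <= N) ->
    integ mu (fun z => truncate M k z * h z).
  move=> mk mh hN; apply: (@integM _ _ _ mu h _ M%:R).
  - exact: (@integ_bounded _ _ _ mu _ N).
  - exact: truncate_measurable.
  - exact: truncate_bounded.
have [|n_ [n_lt cn_]] := @bounded_diagonal R a D.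
  move=> c n; rewrite /a /D; case: unpickle => [[[j M] m]|]/=; last by rewrite normr0.
  have ip : integ mu (fun z => truncate M (psi j n) z * truncate M (psi j m) z).
    by apply: itrM => //; [exact: truncate_measurable|exact: truncate_bounded].
  apply: le_trans (int_abs ip) _; apply: int_le.
  - exact: integ_norm.
  - by apply: (@integ_bounded _ _ _ mu _ `|M%:R * M%:R|) => //; exact: measurable_cst.
  - by move=> z; rewrite normrM; apply: ler_pM => //; exact: truncate_bounded.
have ctr j M h N : mf h -> (forall z, `|h z| <= N) ->
    cvgn (fun k => I (fun z => truncate M (psi j (n_ k)) z * h z)).
  move=> mh hN.
  apply: (@prehilbert_weak_cvg _ _ _ mu (fun k => truncate M (psi j (n_ k))) M%:R _ _ _ h N)
    => // [k|k z|m].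
  - exact: truncate_measurable.
  - exact: truncate_bounded.
  - have := cn_ (pickle (j, M, n_ m)); rewrite /a.
    by under eq_fun do rewrite pickleK.
have cA j A : measurable A -> cvgn (fun k => I (fun z => \1_A z * psi j (n_ k) z)).
  move=> mA; apply: uniform_approx_cvg => e e0.
  have [M _ hM] := uniform_truncation rn (K0 j) e0.
  exists (fun k => I (fun z => truncate M (psi j (n_ k)) z * \1_A z)); split.
    apply: (@ctr j M _ 1); [exact: measurable_indic|exact: normr_indic_le1].
  move=> k; set p := psi j (n_ k); have ip : integ mu p by exact: ipsi.
  have i1 : integ mu (fun z => \1_A z * p z) by exact: integ_indic.
  have i2 : integ mu (fun z => truncate M p z * \1_A z).
    by apply: (@itrM _ _ _ 1) => //; [exact: mpsi|exact: normr_indic_le1].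
  rewrite -intB//; apply: le_trans (int_abs (integB i1 i2)) _.
  apply: le_trans (hM p (mpsi _ _) (psiK _ _)).
  apply: int_le.
  - exact/integ_norm/integB.
  - rewrite (_ : (fun z => _) = (fun z => `|p z - truncate M p z|)).
      by apply/integ_norm/integB => //; apply: itr; exact: mpsi.
    by apply/funext => z; rewrite truncate_diff.
  - move=> z; rewrite -truncate_diff [truncate _ _ _ * _]mulrC -mulrBr normrM.
    by rewrite ler_piMl// normr_indic_le1.
pose nu j A := limn (fun k => I (fun z => \1_A z * psi j (n_ k) z)).
have nuE j A : measurable A -> I (fun z => \1_A z * psi j (n_ k) z) @[k --> \oo] --> nu j A.
  by move=> /(cA j).
have den j : exists g, integ mu g /\ forall A, measurable A -> nu j A = I (fun z => \1_A z * g z).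
  apply: radon_nikodym_density.
    move=> A B mA mB AB; apply/cvg_lim => //.
    rewrite (_ : (fun k => _) = (fun k => I (fun z => \1_A z * psi j (n_ k) z) +
        I (fun z => \1_B z * psi j (n_ k) z))).
      by apply: cvgD; exact: nuE.
    apply/funext => k; rewrite -intD; [|exact: integ_indic|exact: integ_indic].
    apply: int_ext => z; rewrite -mulrDl; congr (_ * _).
    exact: indic_disjointU.
  move=> e e0; have [delta d0 hd] := uniform_integrability rn (K0 j) e0.
  exists delta => // A mA muA.
  have cv : `|I (fun z => \1_A z * psi j (n_ k) z)| @[k --> \oo] --> `|nu j A|.
    by apply: cvg_norm; exact: nuE.
  apply: (cvgr_to_le cv); apply: nearW => k.
  apply: le_trans (int_abs (integ_indic mA (ipsi j (n_ k)))) _.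
  rewrite (@int_ext _ _ _ mu _ (fun z => \1_A z * `|psi j (n_ k) z|)).
    exact: hd.
  by move=> z; rewrite normrM ger0_norm.
have /choice[beta hbeta] := den.
exists n_, beta; split=> // [j|j A mA]; first by have [] := hbeta j.
by have [_ <-] := hbeta j; [exact: nuE|exact: mA].
Qed.

End weak_compactness.

(** * Weak convergence of vector-valued functions *)

Section enumeration.

(** Index 0 is reserved for [t0], at which the functions maximized by [argmax] are meant
    to vanish: their maximum is then nonnegative. *)
Definition enumerate (T : countType) (t0 : T) (n : nat) : T :=
  if n is n'.+1 then odflt t0 (unpickle n') else t0.

Lemma enumerateP (T : countType) (t0 t : T) : exists n, enumerate t0 n = t.
Proof. by exists (pickle t).+1; rewrite /= pickleK. Qed.

End enumeration.

Section selections.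
Context {R : realType} {d : measure_display} {Z : measurableType d}.
Variable mu : {finite_measure set Z -> \bar R}.
Local Notation mf k := (measurable_fun [set: Z] (k : Z -> R)).
Local Notation I h := (Rintegral mu setT h).

Definition bounded_index (sigma : Z -> nat) (m : nat) :=
  measurable_index sigma /\ forall z, (sigma z <= m)%N.

Lemma selected_sumE (V : lmodType R) (sigma : Z -> nat) m (F : nat -> Z -> V) z :
  (sigma z <= m)%N ->
  F (sigma z) z = \sum_(j < m.+1) (\1_[set z | sigma z = j] z : R) *: F j z.
Proof.
move=> sm; have sm1 : (sigma z < m.+1)%N by rewrite ltnS.
rewrite (bigD1 (Ordinal sm1))//= indicE mem_set// scale1r big1 ?addr0// => j jn.
rewrite indicE memNset ?scale0r//= => h; move/eqP: jn; apply.
by apply: val_inj; rewrite /= h.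
Qed.

Lemma int_selected sigma m (F : nat -> Z -> R) : bounded_index sigma m ->
  (forall j, integ mu (F j)) ->
  integ mu (fun z => F (sigma z) z) /\
  I (fun z => F (sigma z) z) =
    \sum_(j < m.+1) I (fun z => \1_[set z | sigma z = j] z * F j z).
Proof.
move=> [ms sm] iF.
have E : (fun z => F (sigma z) z) =
    (fun z => \sum_(j < m.+1) \1_[set z | sigma z = j] z * F j z).
  by apply/funext => z; rewrite (@selected_sumE R^o _ m F z).
have iS (j : 'I_m.+1) : integ mu (fun z => \1_[set z | sigma z = j] z * F j z).
  exact: integ_indic.
by rewrite E; split; [exact: integ_sum|exact: int_sum].
Qed.

Variable rho : (Z -> R) -> \bar R.
Hypothesis fn : function_norm mu rho.

Lemma bdual_selected (V : normedModType R) (Lam : (Z -> V) -> R) sigma m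
    (F : nat -> Z -> V) : bdual rho Lam -> bounded_index sigma m ->
  (forall j, bspace rho (F j)) ->
  bspace rho (fun z => F (sigma z) z) /\
  Lam (fun z => F (sigma z) z) =
    \sum_(j < m.+1) Lam (fun z => (\1_[set z | sigma z = j] z : R) *: F j z).
Proof.
move=> dL [ms sm] bF.
rewrite (_ : (fun z => F (sigma z) z) =
    (fun z => \sum_(j < m.+1) (\1_[set z | sigma z = j] z : R) *: F j z)).
  apply: (@bdual_sum _ _ _ mu _ _ fn Lam dL m.+1
    (fun j z => (\1_[set z | sigma z = j] z : R) *: F j z)) => j.
  exact: (bspace_indic fn).
by apply/funext => z; exact: selected_sumE.
Qed.

Lemma nearest_bounded_index (V : normedModType R) (f : Z -> V) (v : nat -> V) m :
  smeas f -> bounded_index (nearest f v m) m.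
Proof.
move=> sf; split; last by move=> z; exact: argmax_le.
by apply: nearest_measurable => j; exact: smeas_norm_measurable.
Qed.

(** As 0 is one of the points, the nearest one is at distance at most [|f z|] from [f
    z], and dominated convergence applies. *)
Lemma nearest_approx (V : normedModType R) (f : Z -> V) (v : nat -> V) :
  bspace rho f -> v 0%N = 0 ->
  (forall z e, 0 < e -> exists j, `|f z - v j| < e) ->
  (forall m, bspace rho (fun z => v (nearest f v m z))) /\
  bnorm rho (fun z => v (nearest f v m z) - f z) @[m --> \oo] --> 0%E.
Proof.
move=> bf v0 vd; have [sf f1] := bf.
have sv m : smeas (fun z => v (nearest f v m z)).
  have [ms _] := nearest_bounded_index v m sf.
  by apply: (@smeas_selected _ _ _ _ (fun j _ => v j)) => // j; exact: smeas_cst.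
have le m z : `|v (nearest f v m z) - f z| <= `|f z|.
  by have := nearest_le f v m z; rewrite v0 subr0 distrC.
have sd m : smeas (fun z => v (nearest f v m z) - f z) by exact: smeasB.
have bd m : bspace rho (fun z => v (nearest f v m z) - f z).
  exact: (bspace_le fn (g := f)).
split=> [m|].
  have := bspaceD fn (bd m) bf; congr bspace; apply/funext => z; exact: subrK.
apply: (fn_cvg0 fn (k := fun z => `|f z|)) => //.
- by move=> m; exact: smeas_normr.
- exact: smeas_normr.
- by move=> m z; rewrite normr_ge0 le.
- move=> z; rewrite -(normr0 V) -(subrr (f z)); apply: cvg_norm; apply: cvgB.
    by apply: nearest_cvg; exact: vd.
  exact: cvg_cst.
Qed.

End selections.

Section weak_convergence.
Context {R : realType} {d : measure_display} {Z : measurableType d}.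
Variable mu : {finite_measure set Z -> \bar R}.
Local Notation mf k := (measurable_fun [set: Z] (k : Z -> R)).
Local Notation I h := (Rintegral mu setT h).
Variable rho : (Z -> R) -> \bar R.
Hypothesis rn : reflexive_norm mu rho.
Let fn : function_norm mu rho := rn.

Section scaling.
Context {V : normedModType R}.
Variable Lam : (Z -> V) -> R.
Hypothesis dL : bdual rho Lam.

Lemma unit_ball_scale A e f (K : R) : 0 < K -> measurable A -> bspace rho f ->
  (forall f, bspace rho f -> (bnorm rho f <= 1)%E ->
    `|Lam (fun z => (\1_A z : R) *: f z)| <= e / K) ->
  (bnorm rho f <= K%:E)%E -> `|Lam (fun z => (\1_A z : R) *: f z)| <= e.
Proof.
move=> K0 mA bf h fK.
have fK1 : (bnorm rho (fun z => (K^-1 *: f z)%R) <= 1)%E.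
  rewrite (bnormZ fn); last by case: bf.
  rewrite ger0_norm ?invr_ge0 ?(ltW K0)//.
  apply: (@le_trans _ _ (K^-1%:E * K%:E)%E).
    by apply: lee_wpmul2l => //; rewrite lee_fin invr_ge0 ltW.
  by rewrite -EFinM mulVf// gt_eqF.
have := h _ (bspaceZ fn K^-1 bf) fK1.
rewrite (_ : (fun z => _) = (fun z => K^-1 *: ((\1_A z : R) *: f z))); last first.
  by apply/funext => z; rewrite !scalerA mulrC.
rewrite (bdualZ fn dL); last exact: (bspace_indic fn).
by rewrite normrM gtr0_norm ?invr_gt0// mulrC ler_pM2r ?invr_gt0.
Qed.

Lemma bdual_indic A : measurable A -> bdual rho (fun f => Lam (fun z => (\1_A z : R) *: f z)).
Proof.
move=> mA; have [C C0 hC] := bdual_bounded fn dL; split=> [a f g bf bg|].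
  rewrite -(bdual_axpy dL); [|exact: (bspace_indic fn)|exact: (bspace_indic fn)].
  by congr Lam; apply/funext => z; rewrite scalerDr !scalerA mulrC.
exists C => f bf; have ff := bspace_fin fn bf.
rewrite -(fineK ff) -EFinM lee_fin; apply: hC; first exact: (bspace_indic fn).
by rewrite fineK//; apply: (bnorm_indic fn) => //; case: bf.
Qed.

(** Radon-Nikodym; absolute continuity is [dual_uniform]. *)
Lemma bdual_density (v : V) : exists g, integ mu g /\ forall A, measurable A ->
  Lam (fun z => (\1_A z : R) *: v) = I (fun z => \1_A z * g z).
Proof.
have bv : bspace rho (fun _ => v).
  by apply: (bspace_bounded fn (M := `|v|)) => //; exact: smeas_cst.
apply: (@radon_nikodym_density _ _ _ mu (fun A => Lam (fun z => (\1_A z : R) *: v))).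
  move=> A B mA mB AB; rewrite -(bdualD dL); try exact: (bspace_indic fn).
  by congr Lam; apply/funext => z; rewrite indic_disjointU// scalerDl.
move=> e e0; pose K := fine (bnorm rho (fun _ => v)) + 1.
have K0 : 0 < K by rewrite ltr_wpDl// fine_ge0// (bnorm_ge0 fn).
have [delta d0 hd] := dual_uniform rn dL (divr_gt0 e0 K0).
exists delta => // A mA muA; apply: (unit_ball_scale K0 mA bv).
  by move=> f bf f1; exact: hd.
rewrite -(fineK (bspace_fin fn bv)) lee_fin /K lerDl//.
Qed.

End scaling.

Section norming.
Context {Y : normedModType R} (y : nat -> Y) (g : seq (rat * nat) -> (Y -> R^o)).
Hypothesis nf : norming_family y g.
Local Notation QS := (seq (rat * nat)).
Local Notation enumQ := (enumerate ([::] : QS)).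

Lemma closed_span_near (f : Z -> Y) : (forall z, closed_span y (f z)) ->
  forall z e, 0 < e -> exists j, `|f z - comb y (enumQ j)| < e.
Proof.
move=> cf z e e0; have [s hs] := closed_span_approx (cf z) e0.
by have [j js] := enumerateP [::] s; exists j; rewrite js.
Qed.

Lemma comb_integ (J : Type) (gam : J -> Z -> R) s : (forall j, integ mu (gam j)) ->
  integ mu (fun z => comb (fun j => (gam j z : R^o)) s).
Proof.
move=> ig; elim: s => [|c s IH].
  rewrite (_ : (fun z => _) = (fun _ => 0)); last by apply/funext => z; rewrite comb_nil.
  by apply: (@integ_bounded _ _ _ mu _ 0) => [|z]; [exact: measurable_cst|rewrite normr0].
rewrite (_ : (fun z => _) = (fun z => ratr c.1 * gam c.2 z + comb (fun j => (gam j z : R^o)) s)).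
  by apply: integD => //; exact: integZ.
by apply/funext => z; rewrite comb_cons.
Qed.

Section one_functional.
Variable Lam : (Z -> Y) -> R.
Hypothesis dL : bdual rho Lam.

Lemma bdual_comb_density : exists gam : nat -> Z -> R,
  (forall i, integ mu (gam i)) /\ forall s A, measurable A ->
  Lam (fun z => (\1_A z : R) *: comb y s) =
  I (fun z => \1_A z * comb (fun i => (gam i z : R^o)) s).
Proof.
have /choice[gam hg] := fun i => bdual_density dL (y i).
have ig i : integ mu (gam i) by have [] := hg i.
exists gam; split=> // s A mA; elim: s => [|c s IH].
  rewrite comb_nil (_ : (fun z => _) = (fun _ => 0)); last by apply/funext => z; rewrite scaler0.
  rewrite (bdual0 fn dL) -[LHS](int0 mu); apply: int_ext => z.
  by rewrite comb_nil mulr0.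
have bv (v : Y) : bspace rho (fun z => (\1_A z : R) *: v).
  apply: (bspace_indic fn) => //.
  by apply: (bspace_bounded fn (M := `|v|)) => //; exact: smeas_cst.
rewrite comb_cons (_ : (fun z => _) =
    (fun z => ratr c.1 *: ((\1_A z : R) *: y c.2) + (\1_A z : R) *: comb y s)); last first.
  by apply/funext => z; rewrite scalerDr !scalerA mulrC.
rewrite (bdual_axpy dL)// IH; have [_ ->//] := hg c.2.
have i1 : integ mu (fun z => \1_A z * gam c.2 z) by exact: integ_indic.
rewrite -intZ// -intD//; last 2 first.
- exact: integZ.
- by apply: integ_indic => //; exact: comb_integ.
by apply: int_ext => z; rewrite comb_cons mulrDr mulrCA.
Qed.

Variable gam : nat -> Z -> R.
Hypothesis ig : forall i, integ mu (gam i).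
Hypothesis hg : forall s A, measurable A -> Lam (fun z => (\1_A z : R) *: comb y s) =
  I (fun z => \1_A z * comb (fun i => (gam i z : R^o)) s).
Let gamE s z : R := comb (fun i => (gam i z : R^o)) s.
Let igE s : integ mu (gamE s) := comb_integ s ig.

Lemma bspace_cst (v : Y) : bspace rho (fun _ => v).
Proof. by apply: (bspace_bounded fn (M := `|v|)) => //; exact: smeas_cst. Qed.

(** The real densities [gam] of [Lam] at the vectors of [y] stand for a function with
    values in the dual of [Y], which would represent [Lam]. *)
Lemma bdual_simple (B : set Z) (s : nat -> QS) (c : nat -> R) sigma m :
  measurable B -> bounded_index sigma m ->
  Lam (fun z => (\1_B z : R) *: (c (sigma z) *: comb y (s (sigma z)))) =
  I (fun z => \1_B z * (c (sigma z) * gamE (s (sigma z)) z)).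
Proof.
move=> mB bs; have [ms _] := bs.
have bF j : bspace rho (fun z => (\1_B z : R) *: (c j *: comb y (s j))).
  by apply: (bspace_indic fn) => //; exact: bspace_cst.
have [_ ->] := bdual_selected fn (F := fun j z => (\1_B z : R) *: (c j *: comb y (s j)))
  dL bs bF.
have iF j : integ mu (fun z => \1_B z * (c j * gamE (s j) z)).
  by apply: integ_indic => //; exact: integZ.
have [_ ->] := int_selected (F := fun j z => \1_B z * (c j * gamE (s j) z)) bs iF.
apply: eq_bigr => j _.
have mj : measurable ([set z | sigma z = j] `&` B) by exact: measurableI.
transitivity (c j * Lam (fun z => (\1_([set z | sigma z = j] `&` B) z : R) *: comb y (s j))).
  rewrite -(bdualZ fn dL); last first.
    by apply: (bspace_indic fn) => //; exact: bspace_cst.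
  by congr Lam; apply/funext => z; rewrite -indicM !scalerA; congr (_ *: _); ring.
rewrite hg// -intZ; last exact: (integ_indic mj (igE _)).
by apply: int_ext => z; rewrite -indicM /gamE; ring.
Qed.

(** The maximum of finitely many normalized densities is attained at a measurable index;
    its integral is the value of [Lam] at a function with values in the unit ball. *)
Lemma bdual_density_bounded : {ae mu, forall z, exists2 b, 0 <= b &
  forall s, `|gamE s z| <= b * `|comb y s|}.
Proof.
pose a j z := (`|comb y (enumQ j)|)^-1 * gamE (enumQ j) z.
have ia j : integ mu (a j) by exact: integZ.
have ma j : mf (a j) by exact: integ_measurable (ia j).
have bs m : bounded_index (argmax a m) m.
  by split; [exact: argmax_measurable|move=> z; exact: argmax_le].
have [C C0 hC] := bdual_bounded fn dL.
have r1 : rho (fun _ => 1%R) \is a fin_num.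
  by rewrite ge0_fin_numE ?(fn_cst1 fn)// (fn_ge0 fn).
have h1 : {ae mu, forall z, exists2 b, 0 <= b & forall j, a j z <= b}.
  apply: (@ae_sup_finite _ _ _ mu a (C * fine (rho (fun _ => 1%R)))) => //.
  - by move=> z; rewrite /a /gamE /= !comb_nil mulr0.
  - by move=> m; have [] := int_selected (bs m) ia.
  move=> m.
  pose F j (_ : Z) : Y := (`|comb y (enumQ j)|)^-1 *: comb y (enumQ j).
  have bF : bspace rho (fun z => F (argmax a m z) z).
    by have [] := bdual_selected fn (F := F) dL (bs m) (fun j => bspace_cst _).
  have := bdual_simple enumQ (fun j => (`|comb y (enumQ j)|)^-1) measurableT (bs m).
  rewrite (@int_ext _ _ _ mu _ (fun z => a (argmax a m z) z)); last first.
    by move=> z; rewrite indicT mul1r.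
  move=> <-; apply: le_trans (ler_norm _) _.
  rewrite (_ : (fun z => _) = (fun z => F (argmax a m z) z)); last first.
    by apply/funext => z; rewrite indicT scale1r.
  apply: hC => //; rewrite fineK//.
  apply: (bnorm_le fn) => //; first by case: bF.
  move=> z; rewrite /F normrZ normfV normr_id.
  have [->|n0] := eqVneq `|comb y (enumQ (argmax a m z))| 0; first by rewrite mulr0.
  by rewrite mulVf.
have h2 : {ae mu, forall z, forall j, `|comb y (enumQ j)| = 0 -> gamE (enumQ j) z = 0}.
  apply: ae_foralln => j; have [n0|n0] := eqVneq `|comb y (enumQ j)| 0; last first.
    by apply: aeW => z /eqP; rewrite (negbTE n0).
  have : {ae mu, forall z, gamE (enumQ j) z = 0}.
    apply: ae_int_eq0 => // A mA; rewrite -hg// (normr0_eq0 n0).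
    rewrite -(bdual0 fn dL); congr Lam; apply/funext => z; exact: scaler0.
  by apply: filterS => z ->.
apply: filterS2 h1 h2 => z [b b0 hb] h0; exists b => // s.
have half s' : gamE s' z <= b * `|comb y s'|.
  have [j js] := enumerateP [::] s'.
  have [n0|n0] := eqVneq `|comb y s'| 0.
    by rewrite -js h0 ?js// n0 mulr0.
  have np : 0 < `|comb y s'| by rewrite lt_neqAle eq_sym n0/=.
  by have := hb j; rewrite /a js mulrC ler_pdivrMr.
rewrite ler_norml half andbT lerNl.
have := half (comb_axpy (-1) s [::]).
rewrite /gamE !comb_axpyE !comb_nil !addr0 rmorphN1 !scaleN1r normrN.
exact.
Qed.

End one_functional.

Local Notation DS := (seq (rat * QS)).

Lemma comb_bounded (t : DS) : exists2 C, 0 < C & forall v, `|comb g t v| <= C * `|v|.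
Proof.
by have [C [C0 hC]] := in_dual_bounded (nf_comb_dual nf t); exists C.
Qed.

Lemma comb_integ_bspace (t : DS) (f : Z -> Y) : bspace rho f ->
  integ mu (fun z => comb g t (f z)).
Proof.
move=> [sf f1]; have [C C0 hC] := comb_bounded t.
have mn := smeas_normr sf.
have iff : integ mu (fun z => `|f z|).
  apply: (bspace_integ rn) => //.
  by move: f1; congr (_ < _)%E; congr rho; apply/funext => z; rewrite normr_id.
apply: (@integ_le _ _ _ mu _ (fun z => C * `|f z|)) => //; last exact: integZ.
exact: (smeas_dual (nf_comb_dual nf t)).
Qed.

(** These functionals take finitely many values in the dual of [Y] and are those against
    which convergence is known by construction. *)
Lemma bdual_finite_rank (B : set Z) (t : nat -> DS) tau m :
  measurable B -> bounded_index tau m ->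
  (forall f, bspace rho f -> integ mu (fun z => \1_B z * comb g (t (tau z)) (f z))) /\
  bdual rho (fun f => I (fun z => \1_B z * comb g (t (tau z)) (f z))).
Proof.
move=> mB bt; have [_ tm] := bt.
have iJ f : bspace rho f -> integ mu (fun z => \1_B z * comb g (t (tau z)) (f z)).
  move=> bf; have iF j : integ mu (fun z => \1_B z * comb g (t j) (f z)).
    by apply: integ_indic => //; exact: comb_integ_bspace.
  by have [] := int_selected (F := fun j z => \1_B z * comb g (t j) (f z)) bt iF.
split=> //; split=> [a f h bf bh|].
  rewrite -intZ -?intD; try exact: iJ; last by apply: integZ; exact: iJ.
  apply: int_ext => z; rewrite (in_dual_linear _ _ _ (nf_comb_dual nf _)); ring.
have /choice[C hC] : forall j, exists C, 0 < C /\ forall v, `|comb g (t j) v| <= C * `|v|.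
  by move=> j; have [C C0 hC] := comb_bounded (t j); exists C.
pose D := \sum_(j < m.+1) C j.
have CD z : C (tau z) <= D.
  have sm : (tau z < m.+1)%N by rewrite ltnS.
  rewrite /D (bigD1 (Ordinal sm))//= lerDl sumr_ge0// => j _.
  by apply: ltW; have [] := hC j.
have D0 : 0 <= D by apply: sumr_ge0 => j _; apply: ltW; have [] := hC j.
have [c c0 hc] := rn_l1 rn.
exists (D * c) => f bf; have [sf f1] := bf; have mn := smeas_normr sf.
have iff : integ mu (fun z => `|f z|).
  apply: (bspace_integ rn) => //.
  by move: f1; congr (_ < _)%E; congr rho; apply/funext => z; rewrite normr_id.
apply: (@le_trans _ _ (D * I (fun z => `|f z|))%:E).
  rewrite lee_fin -intZ//; apply: le_trans (int_abs (iJ f bf)) _.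
  apply: int_le; [exact/integ_norm/iJ|exact: integZ|move=> z].
  rewrite normrM; apply: (@le_trans _ _ (1 * (C (tau z) * `|f z|))).
    apply: ler_pM => //; first exact: normr_indic_le1.
    by have [_] := hC (tau z).
  by rewrite mul1r ler_wpM2r.
rewrite EFinM EFinM -muleA EFin_int//.
by apply: lee_wpmul2l; [rewrite lee_fin|exact: hc].
Qed.

Section one_functional.
Variable Lam : (Z -> Y) -> R.
Hypothesis dL : bdual rho Lam.
Variable gam : nat -> Z -> R.
Hypothesis ig : forall i, integ mu (gam i).
Hypothesis hg : forall s A, measurable A -> Lam (fun z => (\1_A z : R) *: comb y s) =
  I (fun z => \1_A z * comb (fun i => (gam i z : R^o)) s).

(** Both sides are continuous in [f], so that they need only be compared on simple
    functions, where [Lam] is integration against its densities. *)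
Lemma bdual_close : exists2 c : R, 0 < c & forall (B : set Z) e (t : nat -> DS)
    (tau : Z -> nat) m (f : Z -> Y) K,
  measurable B -> 0 <= e -> bounded_index tau m -> bspace rho f ->
  (forall z, closed_span y (f z)) -> (bnorm rho f <= K%:E)%E ->
  (forall z, B z -> forall s, `|comb (fun i => (gam i z : R^o)) s -
      comb g (t (tau z)) (comb y s)| <= e * `|comb y s|) ->
  `|Lam (fun z => (\1_B z : R) *: f z) -
    I (fun z => \1_B z * comb g (t (tau z)) (f z))| <= e * (c * K).
Proof.
have [c c0 hc] := int_le_norm rn; exists (c * 2); first by rewrite mulr_gt0.
move=> B e t tau m f K mB e0 bt bf cf fK hB; have [sf f1] := bf.
pose v j := comb y (enumQ j); pose near n := nearest f v n.
have v0 : v 0%N = 0 by rewrite /v /= comb_nil.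
have [bfn fn0] := nearest_approx fn bf v0 (closed_span_near cf).
have [iJ dJ] := bdual_finite_rank t mB bt.
have cU := bdual_cvg fn (bdual_indic dL mB) bfn bf fn0.
have cW := bdual_cvg fn dJ bfn bf fn0.
apply: (cvgr_to_le (cvg_norm (cvgB cU cW))); apply: nearW => n.
have bs : bounded_index (near n) n by exact: nearest_bounded_index.
have E1 := bdual_simple dL ig hg enumQ (fun _ => 1) mB bs.
rewrite (_ : (fun z => _) = (fun z => (\1_B z : R) *: v (nearest f v n z))) in E1; last first.
  by apply/funext => z; rewrite scale1r.
rewrite /= !fctE E1.
have i1 : integ mu (fun z => \1_B z * (1 * comb (fun i => (gam i z : R^o)) (enumQ (near n z)))).
  apply: integ_indic => //.
  have iF j : integ mu (fun z => 1 * comb (fun i => (gam i z : R^o)) (enumQ j)).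
    by apply: integZ; exact: comb_integ.
  by have [] := int_selected (F := fun j z => 1 * comb (fun i => (gam i z : R^o)) (enumQ j)) bs iF.
have i2 := iJ _ (bfn n).
rewrite -intB//; apply: le_trans (int_abs (integB i1 i2)) _.
have mfn : mf (fun z => `|v (near n z)|) by apply: smeas_normr; case: (bfn n).
have ifn : integ mu (fun z => `|v (near n z)|).
  apply: (bspace_integ rn) => //; have [_] := bfn n.
  by congr (_ < _)%E; congr rho; apply/funext => z; rewrite normr_id.
apply: (@le_trans _ _ (I (fun z => e * `|v (near n z)|))).
  apply: int_le; [exact/integ_norm/integB|exact: integZ|move=> z].
  rewrite -mulrBr mul1r normrM indicE; case: (boolP (z \in B)) => zB.
    by rewrite normr1 mul1r; apply: hB; rewrite inE in zB.
  by rewrite normr0 mul0r mulr_ge0.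
rewrite intZ//; apply: ler_wpM2l => //; rewrite -mulrA; apply: hc => //.
have m2 : mf (fun z => 2 * `|f z|) by apply: measurable_funM => //; exact: smeas_normr.
apply: (@le_trans _ _ (rho (fun z => (2 * `|f z|)%R))).
  apply: (fn_le fn) => // z; rewrite normr_ge0/=.
  have := nearest_le f v n z; rewrite v0 subr0 => h.
  rewrite -[v _](subrK (f z)); apply: le_trans (ler_normD _ _) _.
  by rewrite distrC mulrDl mul1r lerD2r.
rewrite (fnZ fn)//; last exact: smeas_normr.
by rewrite EFinM; apply: lee_wpmul2l.
Qed.

End one_functional.

(** The density of [Lam] is bounded almost everywhere, and the rational combinations of
    [g] are dense. Hence off a set on which [Lam] is uniformly small, [Lam] is close to
    a functional as in [bdual_finite_rank]. *)
Lemma bdual_weak_cvg (Lam : (Z -> Y) -> R) (f_ : nat -> Z -> Y) f K :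
  bdual rho Lam -> (forall n, bspace rho (f_ n)) -> bspace rho f ->
  (forall n z, closed_span y (f_ n z)) -> (forall z, closed_span y (f z)) ->
  (forall n, (bnorm rho (f_ n) <= K%:E)%E) -> (bnorm rho f <= K%:E)%E ->
  (forall t A, measurable A -> I (fun z => \1_A z * comb g t (f_ n z)) @[n --> \oo] -->
     I (fun z => \1_A z * comb g t (f z))) ->
  Lam (f_ n) @[n --> \oo] --> Lam f.
Proof.
move=> dL bf_ bf cf_ cf f_K fK wcv.
have K0 : 0 <= K by rewrite -lee_fin; apply: le_trans fK; exact: (bnorm_ge0 fn).
have [gam [ig hg]] := bdual_comb_density dL.
have [c c0 close] := bdual_close dL ig hg.
have bdd := bdual_density_bounded dL ig hg.
apply/cvgrPdist_le => e e0.
pose eps := e / (4 * (c * K + 1)).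
have cK1 : 0 < c * K + 1 by rewrite ltr_wpDl// mulr_ge0// ltW.
have eps0 : 0 < eps by rewrite divr_gt0// mulr_gt0.
have epscK : eps * (c * K) <= e / 4.
  have -> : e / 4 = eps * (c * K + 1) by rewrite /eps; field; rewrite gt_eqF.
  by rewrite ler_pM2l// lerDl.
pose ts := enumerate ([::] : DS).
pose gamE s z : R := comb (fun i => (gam i z : R^o)) s.
pose D j i := [set z | `|gamE (enumQ i) z - comb g (ts j) (comb y (enumQ i))| <=
  eps * `|comb y (enumQ i)|].
(* where the density of [Lam] is within [eps] of the [j]-th combination of [g] *)
pose B j := \bigcap_i D j i.
have mgam s : mf (gamE s) by exact: integ_measurable (comb_integ s ig).
have mB j : measurable (B j).
  apply: bigcapT_measurable => i.
  have m1 : mf (fun z => `|gamE (enumQ i) z - comb g (ts j) (comb y (enumQ i))|).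
    by apply: measurableT_comp => //; exact: measurable_funB.
  have := measurable_fun_ler m1 (@measurable_cst _ _ _ R setT (eps * `|comb y (enumQ i)|)).
  by move=> /(_ measurableT [set true] Logic.I); rewrite setTI.
have BP j z : B j z -> forall s, `|gamE s z - comb g (ts j) (comb y s)| <= eps * `|comb y s|.
  by move=> Bz s; have [i <-] := enumerateP [::] s; exact: Bz.
pose U m := \bigcup_(j in [set j | (j <= m)%N]) B j.
have mU m : measurable (U m) by apply: bigcup_measurable.
pose E m := ~` U m.
have mE m : measurable (E m) by exact: measurableC.
have dE : {homo E : m n / (m <= n)%N >-> n `<=` m}.
  by move=> m n mn z; apply: contra_not => -[j /= jm Bj]; exists j => //=; exact: leq_trans mn.
have muE : mu (\bigcap_m E m) = 0%E.
  apply/eqP; rewrite -measure_le0; have [N [mN N0 hN]] := bdd.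
  rewrite -N0; apply: le_measure; rewrite ?inE//; first exact: bigcap_measurable.
  move=> z Ez; apply: hN => -[b b0 hb].
  have [t ht] := nf_form_approx nf b0 eps0 hb.
  have [j tj] := enumerateP [::] t.
  by apply: (Ez j Logic.I); exists j => //= i _; rewrite /D/= /ts tj; exact: ht.
have K1 : 0 < K + 1 by rewrite ltr_wpDl.
have e80 : 0 < e / 8 by rewrite divr_gt0.
have [m hm] := dual_order_continuous rn dL mE dE muE (divr_gt0 e80 K1).
(* an index [j <= m] with [B j z], if there is one *)
pose tau := argmax (fun j z => \1_(B j) z : R) m.
have bt : bounded_index tau m.
  split; last by move=> z; exact: argmax_le.
  by apply: argmax_measurable => j; exact: measurable_indic.
have tauB z : U m z -> B (tau z) z.
  move=> [j /= jm Bz]; apply: contrapT => nB.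
  have := argmaxP (fun j z => \1_(B j) z : R) z jm.
  by rewrite -/(tau z) !indicE mem_set// memNset//= ler10.
pose A h := I (fun z => \1_(U m) z * comb g (ts (tau z)) (h z)).
have approx h : bspace rho h -> (forall z, closed_span y (h z)) ->
    (bnorm rho h <= K%:E)%E -> `|Lam h - A h| <= e * (3 / 8).
  move=> bh ch hK.
  have h1 : `|Lam (fun z => (\1_(E m) z : R) *: h z)| <= e / 8.
    apply: (unit_ball_scale dL K1 (mE m) bh) => //.
    by apply: le_trans hK _; rewrite lee_fin lerDl.
  have h2 := close (U m) eps ts tau m h K (mU m) (ltW eps0) bt bh ch hK
    (fun z Uz => BP _ _ (tauB z Uz)).
  have -> : Lam h = Lam (fun z => (\1_(E m) z : R) *: h z) +
      Lam (fun z => (\1_(U m) z : R) *: h z).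
    rewrite -(bdualD dL); [|exact: (bspace_indic fn)|exact: (bspace_indic fn)].
    congr Lam; apply/funext => z; rewrite -scalerDl -indic_disjointU ?setICl//.
    by rewrite setvU indicT scale1r.
  rewrite -addrA; apply: le_trans (ler_normD _ _) _.
  apply: le_trans (lerD h1 (le_trans h2 epscK)) _; lra.
have cA : A (f_ n) @[n --> \oo] --> A f.
  pose F h j z := \1_(U m) z * comb g (ts j) (h z : Y).
  have iF h j : bspace rho h -> integ mu (F h j).
    by move=> bh; apply: integ_indic => //; exact: comb_integ_bspace.
  have AE h : bspace rho h ->
      A h = \sum_(j < m.+1) I (fun z => \1_[set z | tau z = j] z * F h j z).
    by move=> bh; have [_] := int_selected (F := F h) bt (fun j => iF h j bh).
  rewrite AE// (_ : (fun n => A (f_ n)) = (fun n =>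
      \sum_(j < m.+1) I (fun z => \1_[set z | tau z = j] z * F (f_ n) j z))); last first.
    by apply/funext => n; exact: AE.
  have [mt _] := bt.
  apply: (cvg_sum_ord (l := fun j => I (fun z => \1_[set z | tau z = j] z * F f j z))
    (u := fun j n => I (fun z => \1_[set z | tau z = j] z * F (f_ n) j z))) => j.
  have E' h : (fun z => \1_[set z | tau z = j] z * F h j z) =
      (fun z => \1_([set z | tau z = j] `&` U m) z * comb g (ts j) (h z)).
    by apply/funext => z; rewrite /F mulrA indicM.
  rewrite E'; under eq_fun do rewrite E'.
  by apply: wcv; exact: measurableI.
have e40 : 0 < e / 4 by rewrite divr_gt0.
have /cvgrPdist_le/(_ _ e40) := cA; apply: filterS => n hn.
have a1 := approx f bf cf fK; have a2 := approx (f_ n) (bf_ n) (cf_ n) (f_K n).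
have -> : Lam f - Lam (f_ n) = (Lam f - A f) + (A f - A (f_ n)) - (Lam (f_ n) - A (f_ n)).
  by ring.
apply: le_trans (ler_normB _ _) _.
apply: le_trans (lerD (ler_normD _ _) (lexx _)) _.
lra.
Qed.

End norming.
End weak_convergence.

(** * Convergence against bounded functions *)

Section bounded_tests.
Context {R : realType} {d : measure_display} {Z : measurableType d}.
Variable mu : {finite_measure set Z -> \bar R}.
Local Notation mf k := (measurable_fun [set: Z] (k : Z -> R)).
Local Notation I h := (Rintegral mu setT h).

Definition test_function (h : Z -> R) := mf h /\ exists M, forall z, 0 <= h z <= M.

Lemma test_indic A : measurable A -> test_function (\1_A).
Proof.
move=> mA; split; first exact: measurable_indic.
by exists 1 => z; rewrite indicE; case: (z \in A); rewrite ?lexx ?ler01.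
Qed.

Lemma test_mul_indic A h : measurable A -> test_function h ->
  test_function (fun z => \1_A z * h z).
Proof.
move=> mA [mh [M hM]]; split; first by apply: measurable_funM => //; exact: measurable_indic.
exists M => z; have /andP[h0 h1] := hM z; rewrite mulr_ge0//=.
by rewrite indicE; case: (z \in A); rewrite ?mul1r ?mul0r// (le_trans h0).
Qed.

Lemma integ_test h k : test_function h -> integ mu k -> integ mu (fun z => h z * k z).
Proof.
move=> [mh [M hM]] ik; apply: (@integM _ _ _ mu k _ M) => // z.
by have /andP[h0 h1] := hM z; rewrite ger0_norm.
Qed.

(** Set integrals determine the integrals against bounded functions, which are uniform
    limits of simple functions. *)
Lemma cvg_bounded_test (u : nat -> Z -> R) (w : Z -> R) K h :
  (forall k, integ mu (u k)) -> integ mu w ->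
  (forall k, I (fun z => `|u k z|) <= K) ->
  (forall A, measurable A ->
    I (fun z => \1_A z * u k z) @[k --> \oo] --> I (fun z => \1_A z * w z)) ->
  test_function h ->
  I (fun z => h z * u k z) @[k --> \oo] --> I (fun z => h z * w z).
Proof.
move=> iu iw uK cA th; have [mh [M hM]] := th.
apply/cvgrPdist_le => e e0.
pose W := I (fun z => `|w z|).
have W0 : 0 <= W by exact: int_ge0.
have K0 : 0 <= K by apply: le_trans (uK 0%N); exact: int_ge0.
pose eta := e / (2 * (K + W + 1)).
have KW : 0 < K + W + 1 by rewrite ltr_wpDl// addr_ge0.
have eta0 : 0 < eta by rewrite divr_gt0// mulr_gt0.
pose sigma z := Num.trunc (h z / eta).
have hs z : (sigma z)%:R <= h z / eta < (sigma z).+1%:R.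
  by apply: truncn_itv; rewrite divr_ge0 ?(ltW eta0)//; have /andP[] := hM z.
pose N := Num.trunc (M / eta).
have bs : bounded_index sigma N.
  split=> [j|z]; last first.
    rewrite /sigma /N; apply: le_truncn; rewrite ler_pM2r ?invr_gt0//.
    by have /andP[] := hM z.
  rewrite (_ : [set z | _] = [set z | j%:R * eta <= h z] `&` [set z | h z < j.+1%:R * eta]).
    apply: measurableI.
      have := measurable_fun_ler (@measurable_cst _ _ _ R setT (j%:R * eta)) mh.
      by move=> /(_ measurableT [set true] Logic.I); rewrite setTI.
    have := measurable_fun_ltr mh (@measurable_cst _ _ _ R setT (j.+1%:R * eta)).
    by move=> /(_ measurableT [set true] Logic.I); rewrite setTI.
  apply/seteqP; split=> z /=.
    by move=> <-; have := hs z; rewrite ler_pdivlMr// ltr_pdivrMr// => /andP.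
  move=> [h1 h2]; apply: truncn_def; rewrite ler_pdivlMr// ltr_pdivrMr//.
  by rewrite h1 h2.
pose h' z : R := (sigma z)%:R * eta.
have hh' z : `|h z - h' z| <= eta.
  have /andP[h1 h2] := hs z; rewrite ler_pdivlMr// in h1; rewrite ltr_pdivrMr// in h2.
  rewrite ger0_norm ?subr_ge0// lerBlDl; move: h2.
  by rewrite -natr1 mulrDl mul1r => /ltW.
have mh' : mf h'.
  have [ms _] := bs.
  apply: (@measurable_selected _ _ _ (measurableTypeR R) sigma
    (fun j _ => j%:R * eta) ms) => j; exact: measurable_cst.
have near k : integ mu k -> `|I (fun z => h z * k z) - I (fun z => h' z * k z)| <=
    eta * I (fun z => `|k z|).
  move=> ik; have i1 := integ_test th ik.
  have i2 : integ mu (fun z => h' z * k z).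
    apply: (@integM _ _ _ mu k _ (eta + `|M|)) => // z.
    rewrite -[h' z](subrK (h z)); apply: le_trans (ler_normD _ _) _.
    rewrite distrC lerD//; have /andP[h0 h1] := hM z.
    by rewrite ger0_norm// (le_trans h1)// ler_norm.
  rewrite -intB// -intZ; last exact: integ_norm.
  apply: le_trans (int_abs (integB i1 i2)) _.
  apply: int_le => [||z]; [exact/integ_norm/integB|exact/integZ/integ_norm|].
  by rewrite -mulrBl normrM ler_wpM2r.
have cs : I (fun z => h' z * u k z) @[k --> \oo] --> I (fun z => h' z * w z).
  have E k : integ mu k -> I (fun z => h' z * k z) =
      \sum_(j < N.+1) (j%:R * eta) * I (fun z => \1_[set z | sigma z = j] z * k z).
    move=> ik.
    have iF (j : nat) : integ mu (fun z => (j%:R * eta) * k z) by exact: integZ.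
    have [_ ->] := int_selected (F := fun j z => (j%:R * eta) * k z) bs iF.
    apply: eq_bigr => j _; have [ms _] := bs.
    rewrite -intZ; last by apply: integ_indic.
    by apply: int_ext => z; rewrite mulrCA.
  rewrite E// (_ : (fun k => _) = (fun k => \sum_(j < N.+1)
      (j%:R * eta) * I (fun z => \1_[set z | sigma z = j] z * u k z))); last first.
    by apply/funext => k; rewrite E.
  apply: (cvg_sum_ord (u := fun j k => (j%:R * eta) * I (fun z => \1_[set z | sigma z = j] z * u k z))
     (l := fun j => (j%:R * eta) * I (fun z => \1_[set z | sigma z = j] z * w z))) => j.
  by apply: cvgMr; apply: cA; have [ms _] := bs.
have e20 : 0 < e / 2 by rewrite divr_gt0.
have /cvgrPdist_le/(_ _ e20) := cs; apply: filterS => k hk.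
have n1 := near _ (iu k); have n2 := near _ iw.
have n3 : eta * I (fun z => `|u k z|) <= eta * K by rewrite ler_wpM2l// ltW.
have n4 : eta * (K + W) <= e / 2.
  have -> : e / 2 = eta * (K + W + 1) by rewrite /eta; field; rewrite gt_eqF.
  by rewrite ler_pM2l// lerDl.
have -> : I (fun z => h z * w z) - I (fun z => h z * u k z) =
  (I (fun z => h z * w z) - I (fun z => h' z * w z)) +
  (I (fun z => h' z * w z) - I (fun z => h' z * u k z)) -
  (I (fun z => h z * u k z) - I (fun z => h' z * u k z)) by ring.
apply: le_trans (ler_normB _ _) _.
apply: le_trans (lerD (ler_normD _ _) (lexx _)) _.
by rewrite mulrDr -/W in n4; rewrite -/W in n2; lra.
Qed.

Lemma cvg_selected_test (u : nat -> nat -> Z -> R) (w : nat -> Z -> R) sigma m :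
  bounded_index sigma m -> (forall j k, integ mu (u j k)) -> (forall j, integ mu (w j)) ->
  (forall j h, test_function h ->
    I (fun z => h z * u j k z) @[k --> \oo] --> I (fun z => h z * w j z)) ->
  [/\ forall k, integ mu (fun z => u (sigma z) k z), integ mu (fun z => w (sigma z) z) &
   forall h, test_function h ->
    I (fun z => h z * u (sigma z) k z) @[k --> \oo] --> I (fun z => h z * w (sigma z) z)].
Proof.
move=> bs iu iw cu; have [ms _] := bs.
split.
- by move=> k; have [] := int_selected (F := fun j => u j k) bs (iu ^~ k).
- by have [] := int_selected bs iw.
move=> h th.
have E (v : nat -> Z -> R) : (forall j, integ mu (v j)) ->
    I (fun z => h z * v (sigma z) z) =
    \sum_(j < m.+1) I (fun z => (\1_[set z | sigma z = j] z * h z) * v j z).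
  move=> iv; have iF j : integ mu (fun z => h z * v j z) by exact: integ_test.
  have [_ ->] := int_selected (F := fun j z => h z * v j z) bs iF.
  by apply: eq_bigr => j _; apply: int_ext => z; rewrite mulrA.
rewrite E// (_ : (fun k => _) = (fun k => \sum_(j < m.+1)
    I (fun z => (\1_[set z | sigma z = j] z * h z) * u j k z))); last first.
  by apply/funext => k; rewrite (E (fun j => u j k)).
apply: (cvg_sum_ord (u := fun j k => I (fun z => (\1_[set z | sigma z = j] z * h z) * u j k z))
  (l := fun j => I (fun z => (\1_[set z | sigma z = j] z * h z) * w j z))) => j.
by apply: cu; exact: test_mul_indic.
Qed.

Lemma cvg_comb_test (J : Type) (u : J -> nat -> Z -> R) (w : J -> Z -> R) s :
  (forall j k, integ mu (u j k)) -> (forall j, integ mu (w j)) ->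
  (forall j h, test_function h ->
    I (fun z => h z * u j k z) @[k --> \oo] --> I (fun z => h z * w j z)) ->
  forall h, test_function h ->
    I (fun z => h z * comb (fun j => (u j k z : R^o)) s) @[k --> \oo] -->
    I (fun z => h z * comb (fun j => (w j z : R^o)) s).
Proof.
move=> iu iw cu h th; elim: s => [|c s IH].
  rewrite (_ : (fun z => _ * comb _ [::]) = (fun _ => 0)); last first.
    by apply/funext => z; rewrite comb_nil mulr0.
  rewrite (_ : (fun k => _) = (fun _ => I (fun _ => 0))); first exact: cvg_cst.
  by apply/funext => k; apply: int_ext => z; rewrite comb_nil mulr0.
have E (v : J -> Z -> R) : (forall j, integ mu (v j)) ->
    I (fun z => h z * comb (fun j => (v j z : R^o)) (c :: s)) =
    ratr c.1 * I (fun z => h z * v c.2 z) + I (fun z => h z * comb (fun j => (v j z : R^o)) s).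
  move=> iv; have ic := comb_integ s iv.
  rewrite -intZ; last exact: integ_test.
  rewrite -intD; [|exact/integZ/integ_test|exact: integ_test].
  by apply: int_ext => z; rewrite comb_cons mulrDr mulrCA.
rewrite E//; under eq_fun do rewrite (E (fun j => u j _))//.
by apply: cvgD => //; apply: cvgMr; exact: cu.
Qed.

Section norming.
Context {Y : normedModType R} (y : nat -> Y) (g : seq (rat * nat) -> (Y -> R^o)).
Hypothesis nf : norming_family y g.
Local Notation QS := (seq (rat * nat)).
Local Notation DS := (seq (rat * QS)).
Local Notation enumQ := (enumerate ([::] : QS)).

(** The norming family, as combinations, preceded by the zero functional, which makes
    the maxima of [norming_sup] nonnegative. *)
Definition norming_seq (j : nat) : DS := if j is i.+1 then [:: (1, enumQ i)] else [::].

Definition norming_sup (f : Z -> Y) (m : nat) (z : Z) : nat :=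
  argmax (fun j z => comb g (norming_seq j) (f z)) m z.

Lemma comb_norming_seq j v : comb g (norming_seq j) v =
  if j is i.+1 then g (enumQ i) v else 0.
Proof. by case: j => [|i]; rewrite /norming_seq ?comb_nil ?comb1. Qed.

Lemma norming_sup_le f m z : 0 <= comb g (norming_seq (norming_sup f m z)) (f z) <= `|f z|.
Proof.
apply/andP; split.
  have := argmaxP (fun j z => comb g (norming_seq j) (f z) : R) z (leq0n m).
  by rewrite comb_norming_seq.
rewrite comb_norming_seq; case: norming_sup => [|i]; first exact: normr_ge0.
by apply: le_trans (ler_norm _) _; exact: nf_le nf _ _.
Qed.

Lemma norming_sup_cvg f z : closed_span y (f z) ->
  comb g (norming_seq (norming_sup f m z)) (f z) @[m --> \oo] --> (`|f z| : R).
Proof.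
move=> cf; apply/cvgrPdist_le => e e0.
have [s hs] := closed_span_approx cf (divr_gt0 e0 (ltr0n R 2)).
have [i si] := enumerateP [::] s.
exists i.+1 => // m /= im.
have /andP[h0 h1] := norming_sup_le f m z.
rewrite ger0_norm ?subr_ge0// lerBlDl.
have := argmaxP (fun j z => comb g (norming_seq j) (f z) : R) z im.
rewrite {1}comb_norming_seq si => h2.
have h3 := nf_le nf s (f z - comb y s); have ds := nf_dual nf s.
rewrite in_dualB// (nf_norm nf) in h3.
have h4 : `|f z| <= `|f z - comb y s| + `|comb y s|.
  by rewrite -{1}[f z](subrK (comb y s)); exact: ler_normD.
have h5 : `|comb y s| - g s (f z) <= `|g s (f z) - `|comb y s| | by rewrite distrC ler_norm.
rewrite -/(norming_sup f m z) in h2; lra.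
Qed.

Lemma norming_sup_measurable f m : (forall s, mf (fun z => g s (f z))) ->
  measurable_index (norming_sup f m).
Proof.
move=> mg; apply: argmax_measurable => j.
rewrite (_ : (fun z => _) = (fun z => if j is i.+1 then g (enumQ i) (f z) else 0)).
  by case: j => [|i]; [exact: measurable_cst|exact: mg].
by apply/funext => z; rewrite comb_norming_seq.
Qed.

Lemma norming_norm_measurable f : (forall z, closed_span y (f z)) ->
  (forall s, mf (fun z => g s (f z))) -> mf (fun z => `|f z|).
Proof.
move=> cf mg.
apply: (measurable_fun_cvg
    (h := fun m z => comb g (norming_seq (norming_sup f m z)) (f z))); last first.
  by move=> z _; exact: norming_sup_cvg.
move=> m; apply: (@measurable_selected _ _ _ (measurableTypeR R) (norming_sup f m)
  (fun j z => comb g (norming_seq j) (f z))); first exact: norming_sup_measurable.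
move=> j; rewrite (_ : (fun z => _) = (fun z => if j is i.+1 then g (enumQ i) (f z) else 0)).
  by case: j => [|i]; [exact: measurable_cst|exact: mg].
by apply/funext => z; rewrite comb_norming_seq.
Qed.

(** The norm of a weakly measurable function with values in the closed span is the
    supremum of countably many measurable functions, so that [pettis] applies. *)
Lemma weak_pettis f : (forall z, closed_span y (f z)) ->
  (forall s, mf (fun z => g s (f z))) -> smeas f.
Proof.
move=> cf mg; apply: (@pettis _ _ _ _ f (fun j => comb y (enumQ j))).
  move=> j; apply: norming_norm_measurable => [z|s].
    apply: (submoduleB (@closed_span_submodule R Y y)) => //; exact: closed_span_comb.
  under eq_fun do rewrite (in_dualB _ _ (nf_dual nf s)).
  by apply: measurable_funB => //; exact: measurable_cst.
exact: closed_span_near.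
Qed.

End norming.
End bounded_tests.

Section fatou.
Context {R : realType} {d : measure_display} {Z : measurableType d}.
Variable mu : {finite_measure set Z -> \bar R}.
Local Notation mf k := (measurable_fun [set: Z] (k : Z -> R)).
Variable rho : (Z -> R) -> \bar R.
Hypothesis rn : reflexive_norm mu rho.

(** Fatou's lemma for the integral against each test function, and [rn_dual]. *)
Lemma rn_fatou (k_ : nat -> Z -> R) k C : (forall n, mf (k_ n)) ->
  (forall n z, 0 <= k_ n z) -> (forall z, k_ n z @[n --> \oo] --> k z) -> 0 <= C ->
  (\forall n \near \oo, (rho (k_ n) <= C%:E)%E) -> (rho k <= C%:E)%E.
Proof.
move=> mk k0 kk C0 [N _ hN].
have mlim : mf k by apply: (measurable_fun_cvg (h := k_)) => // z _; exact: kk.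
have k0' z : 0 <= k z by apply: (cvgr_to_ge (kk z)); apply: nearW.
apply: (rn_dual rn) => // h M mh hM.
have h0 z : 0 <= h z by have /andP[] := hM z.
set S := ereal_sup _.
pose F n z := (h z * k_ (n + N)%N z)%:E.
have mF n : measurable_fun setT (F n).
  by apply/measurable_EFinP; exact: measurable_funM.
have F0 n z : setT z -> (0 <= F n z)%E by rewrite lee_fin mulr_ge0.
have cF z : F n z @[n --> \oo] --> (h z * k z)%:E.
  apply: cvg_EFin; first exact: nearW.
  apply: cvgM; first exact: cvg_cst.
  by have := kk z; rewrite -(@cvg_shiftn N _ (fun n => k_ n z)).
have FS n : (\int[mu]_z F n z <= S)%E.
  apply: ereal_sup_ubound; exists (k_ (n + N)%N) => //; split=> //.
  by apply: hN => /=; exact: leq_addl.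
have -> : (\int[mu]_z (h z * k z)%:E = \int[mu]_z limn_einf (F^~ z))%E.
  apply: eq_integral => z _; rewrite is_cvg_limn_einfE; last by apply/cvg_ex; eexists; exact: cF.
  by apply/esym/cvg_lim => //; exact: cF.
apply: le_trans (fatou mu measurableT mF F0) _.
rewrite limn_einf_lim; apply: lime_le; first exact: is_cvg_einfs.
apply: nearW => n; apply: le_trans (FS n).
by apply: ereal_inf_lbound; exists n => /=.
Qed.

End fatou.

(** * The limit of pointwise defined operators *)

Section pointwise_operators.
Context {R : realType} {d : measure_display} {Z : measurableType d}.
Variable mu : {finite_measure set Z -> \bar R}.
Local Notation mf k := (measurable_fun [set: Z] (k : Z -> R)).
Local Notation I h := (Rintegral mu setT h).
Variables rp rq : (Z -> R) -> \bar R.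
Hypotheses (fp : function_norm mu rp) (rn : reflexive_norm mu rq).
Let fq : function_norm mu rq := rn.
Context {X Y : normedModType R}.
Variable x : nat -> X.
Hypothesis x0 : x 0%N = 0.
Hypothesis xdense : forall v e, 0 < e -> exists i, `|v - x i| < e.
Hypothesis rY : reflexive_space Y.
Variables (T : nat -> (Z -> X) -> Z -> Y) (Ln : nat -> Z -> {linear X -> Y}) (C : R).
Hypothesis C0 : 0 <= C.
Hypothesis Tin : forall n u, bspace rp u -> bspace rq (T n u).
Hypothesis Tae : forall n u, bspace rp u -> {ae mu, forall z, T n u z = Ln n z (u z)}.
Hypothesis TC : forall n u, bspace rp u -> (bnorm rq (T n u) <= C%:E * bnorm rp u)%E.
Local Notation QS := (seq (rat * nat)).
Local Notation DS := (seq (rat * QS)).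
Local Notation enumQ := (enumerate ([::] : QS)).

(** The images of the constant functions with values in the dense sequence; their values
    generate a separable subspace of [Y]. *)
Let f n i : Z -> Y := T n (fun _ => x i).

Let bcst (v : X) : bspace rp (fun _ : Z => v).
Proof. by apply: (bspace_bounded fp (M := `|v|)) => //; exact: smeas_cst. Qed.

Let bf n i : bspace rq (f n i). Proof. exact: Tin. Qed.

Lemma image_span : exists y : nat -> Y, forall n i z, closed_span y (f n i z).
Proof.
have hv ni : exists v : nat -> Y, forall z e, 0 < e -> exists j, `|f ni.1 ni.2 z - v j| < e.
  by have [sf _] := bf ni.1 ni.2; have [v [_ hv]] := smeas_separable sf; exists v.
have [v {}hv] := choice hv.
pose y k := if @unpickle (nat * nat * nat)%type k is Some nij then v nij.1 nij.2 else 0.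
exists y => n i z; apply: closed_span_closed => e e0.
have [j hj] := hv (n, i) z e e0; exists (v (n, i) j) => // h dh hy.
by have := hy (pickle ((n, i), j)); rewrite /y pickleK.
Qed.

Variable y : nat -> Y.
Hypothesis cy : forall n i z, closed_span y (f n i z).
Variable g : QS -> (Y -> R^o).
Hypothesis nf : norming_family y g.

Variable n_ : nat -> nat.
Variable beta : nat * QS -> Z -> R.
Hypothesis ibeta : forall j, integ mu (beta j).
Hypothesis cbeta : forall j A, measurable A ->
  I (fun z => \1_A z * g j.2 (f (n_ k) j.1 z)) @[k --> \oo] -->
  I (fun z => \1_A z * beta j z).

Let igf n i s : integ mu (fun z => g s (f n i z)).
Proof.
have := comb_integ_bspace rn nf [:: (1, s)] (bf n i).
by congr integ; apply/funext => z; rewrite comb1.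
Qed.

Let inorm n i : integ mu (fun z => `|f n i z|).
Proof.
have [sf f1] := bf n i; apply: (bspace_integ rn); first exact: smeas_normr.
by move: f1; congr (_ < _)%E; congr rq; apply/funext => z; rewrite normr_id.
Qed.

Lemma image_test i s h : test_function h ->
  I (fun z => h z * g s (f (n_ k) i z)) @[k --> \oo] --> I (fun z => h z * beta (i, s) z).
Proof.
have [c c0 hc] := int_le_norm rn.
have nb : (C%:E * bnorm rp (fun _ => x i))%E \is a fin_num.
  by rewrite fin_numM// (bspace_fin fp).
move=> th; apply: (@cvg_bounded_test _ _ _ mu (fun k z => g s (f (n_ k) i z)) (beta (i, s))
  (c * fine (C%:E * bnorm rp (fun _ => x i))%E) h).
- by move=> k; exact: igf.
- exact: ibeta.
- move=> k; have [sf _] := bf (n_ k) i.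
  apply: (@le_trans _ _ (I (fun z => `|f (n_ k) i z|))).
    by apply: int_le => [||z]; [exact/integ_norm/igf|exact: inorm|exact: nf_le nf _ _].
  apply: hc => //; first exact: smeas_normr.
  by rewrite fineK//; exact: TC.
- by move=> A mA; exact: (@cbeta (i, s) A mA).
- exact: th.
Qed.

Let b z i s : R^o := beta (i, s) z.

Let ib i t : integ mu (fun z => comb (b z i) t).
Proof. by apply: (comb_integ (gam := fun s z => beta (i, s) z)) => s; exact: ibeta. Qed.

Lemma image_comb_test i t h : test_function h ->
  I (fun z => h z * comb g t (f (n_ k) i z)) @[k --> \oo] -->
  I (fun z => h z * comb (b z i) t).
Proof.
move=> th; have := cvg_comb_test (u := fun s k z => g s (f (n_ k) i z))
  (w := fun s z => beta (i, s) z) (s := t) (fun s k => igf _ _ s) (fun s => ibeta (i, s))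
  (fun s h' th' => @image_test i s h' th') th.
by under eq_fun do under eq_fun do rewrite -comb_funE.
Qed.

Let igt n i t : integ mu (fun z => comb g t (f n i z)).
Proof. exact: (comb_integ_bspace rn nf). Qed.

(** The limit bilinear form, on rational combinations. *)
Let bb z (s : QS) (t : DS) : R := comb (fun i => (comb (b z i) t : R^o)) s.

Let F n (s : QS) z : Y := comb (fun i => f n i z) s.

Let cF n s z : closed_span y (F n s z).
Proof.
have W0 : closed_span y 0 by move=> h dh _; exact: in_dual0.
by have [] := @comb_map R Y Y nat (closed_span y) id (fun i => f n i z) s
  (@closed_span_submodule R Y y) (fun i => cy n i z) W0.
Qed.

Let gF n s t z : comb g t (F n s z) = comb (fun i => (comb g t (f n i z) : R^o)) s.
Proof.
have := @comb_map R Y R^o nat (fun _ => True) (comb g t) (fun i => f n i z) s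
  (fun _ _ _ _ _ => Logic.I) (fun _ => Logic.I) Logic.I.
case=> [a v w _ _|_]; last exact.
exact: in_dual_linear (nf_comb_dual nf t).
Qed.

Let F_ae n s : {ae mu, forall z, F n s z = Ln n z (comb x s)}.
Proof.
have h i := Tae n (bcst (x i)).
have := ae_foralln h; apply: filterS => z hz; rewrite /F.
have [_ ->] := @comb_map R X Y nat (fun _ => True) (Ln n z) x s
  (fun _ _ _ _ _ => Logic.I) (fun _ => Logic.I) Logic.I
  (fun a v w _ _ => linearP (Ln n z) a v w).
by rewrite /comb; apply: eq_bigr => c _ /=; rewrite -hz.
Qed.

Let smF n s : smeas (F n s).
Proof.
rewrite /F; elim: s => [|c s IH].
  by apply: smeas_ext (smeas_cst 0) => z; rewrite comb_nil.
have [sf _] := bf n c.2.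
by apply: smeas_ext (smeasD (smeasZl (ratr c.1) sf) IH) => z; rewrite comb_cons.
Qed.

Lemma comb_comb_test s t h : test_function h ->
  I (fun z => h z * comb g t (F (n_ k) s z)) @[k --> \oo] --> I (fun z => h z * bb z s t).
Proof.
move=> th; have := cvg_comb_test (u := fun i k z => comb g t (f (n_ k) i z))
  (w := fun i z => comb (b z i) t) (s := s) (fun i k => igt _ i t) (fun i => ib i t)
  (fun i h' th' => @image_comb_test i t h' th') th.
by under eq_fun do under eq_fun do rewrite -gF.
Qed.

Let ibb s t : integ mu (fun z => bb z s t).
Proof. by apply: (comb_integ (gam := fun i z => comb (b z i) t)) => i; exact: ib. Qed.

Let igtF n s t : integ mu (fun z => comb g t (F n s z)).
Proof.
have := comb_integ (gam := fun i z => comb g t (f n i z)) s (fun i => igt n i t).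
by congr integ; apply/funext => z; rewrite gF.
Qed.

(** The maximum of finitely many normalized values is attained at a measurable index
    [sigma], and its integral is a limit of integrals of at most [|T u|], where [u z] is
    the normalized combination of [x] with index [sigma z]. It is because [T] is defined
    pointwise that a selection among the images of constant functions is the image of
    the selected function; as [|u| <= 1], the bound on [T] is uniform in the number of
    indices. *)
Lemma form_bounded : {ae mu, forall z, exists2 h, 0 <= h & forall s t,
  `|bb z s t| <= h * `|comb x s| * span_norm y (comb g t)}.
Proof.
have N0 t : 0 <= span_norm y (comb g t) by exact: span_norm_ge0 (nf_comb_dual nf t).
pose st := enumerate ([::] : QS, [::] : DS).
pose w j := `|comb x (st j).1| * span_norm y (comb g (st j).2).
pose a j z := (w j)^-1 * bb z (st j).1 (st j).2.
have ia j : integ mu (a j) by exact: integZ.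
have ma j : mf (a j) by exact: integ_measurable (ia j).
have bs m : bounded_index (argmax a m) m.
  by split; [exact: argmax_measurable|move=> z; exact: argmax_le].
have [c c0 hc] := int_le_norm rn.
have r1 : (C%:E * rp (fun _ => 1%R))%E \is a fin_num.
  by rewrite fin_numM// ge0_fin_numE ?(fn_cst1 fp)// (fn_ge0 fp).
have h1 : {ae mu, forall z, exists2 b, 0 <= b & forall j, a j z <= b}.
  apply: (@ae_sup_finite _ _ _ mu a (c * fine (C%:E * rp (fun _ => 1%R))%E)) => //.
  - by move=> z; rewrite /a /bb /= comb_nil mulr0.
  - by move=> m; have [] := int_selected (bs m) ia.
  move=> m; set sigma := argmax a m.
  pose G j k z := (w j)^-1 * comb g (st j).2 (F (n_ k) (st j).1 z).
  have iG j k : integ mu (G j k) by exact: integZ.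
  have cG j h : test_function h -> I (fun z => h z * G j k z) @[k --> \oo] -->
      I (fun z => h z * a j z).
    move=> th.
    have E (p : Z -> R) : integ mu p ->
        I (fun z => h z * ((w j)^-1 * p z)) = (w j)^-1 * I (fun z => h z * p z).
      move=> ip; rewrite -intZ; last exact: integ_test.
      by apply: int_ext => z; rewrite mulrCA.
    rewrite /a E//; under eq_fun do rewrite E//.
    by apply: cvgMr; exact: comb_comb_test.
  have [iGs ias cv] := cvg_selected_test (bs m) iG ia cG.
  have {}cv := cv _ (test_indic measurableT).
  have -> : I (fun z => a (sigma z) z) = I (fun z => \1_setT z * a (argmax a m z) z).
    by apply: int_ext => z; rewrite indicT mul1r.
  apply: (cvgr_to_le cv); apply: nearW => k.
  pose v j : X := `|comb x (st j).1|^-1 *: comb x (st j).1.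
  pose u z := v (sigma z).
  have su : smeas u.
    have [ms _] := bs m.
    by apply: (@smeas_selected _ _ _ _ (fun j _ => v j)) => // j; exact: smeas_cst.
  have u1 z : `|u z| <= 1.
    rewrite /u /v normrZ normfV normr_id.
    have [->|n0] := eqVneq `|comb x (st (sigma z)).1| 0; first by rewrite mulr0.
    by rewrite mulVf.
  have bu : bspace rp u by exact: (bspace_bounded fp su u1).
  have bTu := Tin (n_ k) bu; have [sTu _] := bTu.
  have iTu : integ mu (fun z => `|T (n_ k) u z|).
    apply: (bspace_integ rn); first exact: smeas_normr.
    have [_] := bTu.
    by congr (_ < _)%E; congr rq; apply/funext => z; rewrite normr_id.
  pose H j z := `|comb x (st j).1|^-1 * `|F (n_ k) (st j).1 z|.
  have mH j : mf (H j) by apply: measurable_funM => //; exact: smeas_normr.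
  (* [T] commutes with the selection *)
  have HE : {ae mu, forall z, H (sigma z) z = `|T (n_ k) u z|}.
    have F_all : {ae mu, forall z, forall j, F (n_ k) (st j).1 z = Ln (n_ k) z (comb x (st j).1)}.
      by apply: ae_foralln => j; exact: F_ae.
    have T_ae := Tae (n_ k) bu.
    apply: filterS2 F_all T_ae => z h1 h2.
    by rewrite h2 /H h1 /u /v linearZ normrZ ger0_norm// invr_ge0.
  have mHs : mf (fun z => H (sigma z) z).
    have [ms _] := bs m.
    exact: (@measurable_selected _ _ _ (measurableTypeR R) sigma H ms mH).
  have iHs : integ mu (fun z => H (sigma z) z).
    apply: integ_ge0P => // [z|]; first by rewrite mulr_ge0// invr_ge0.
    rewrite (_ : (\int[mu]_z _ = \int[mu]_z (`|T (n_ k) u z|)%:E)%E).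
      by rewrite -EFin_int// ltry.
    apply: ae_eq_integral => //; first exact/measurable_EFinP.
      by apply/measurable_EFinP; exact: integ_measurable iTu.
    by apply: filterS HE => z ->.
  apply: (@le_trans _ _ (I (fun z => H (sigma z) z))).
    apply: int_le => // [|z]; first exact: integ_test (test_indic measurableT) (iGs k).
    rewrite indicT mul1r /G /H /w invfM mulrAC -mulrA ler_wpM2l ?invr_ge0//.
    set N := span_norm _ _; set V := comb g _ _; set W := `|F _ _ _|.
    have VN : `|V| <= N * W by exact: span_norm_ub_closed (nf_comb_dual nf _) (cF _ _ _).
    have W0 : 0 <= W by exact: normr_ge0.
    have [Nz|Nn] := eqVneq N 0; first by rewrite Nz invr0 mulr0.
    have Np : 0 < N by rewrite lt_neqAle eq_sym Nn N0.
    by rewrite ler_pdivrMr// mulrC; apply: le_trans (ler_norm _) VN.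
  rewrite (int_ae mHs (integ_measurable iTu) HE).
  apply: hc => //; first exact: smeas_normr.
  rewrite fineK//; apply: (le_trans (TC (n_ k) bu)).
  apply: lee_wpmul2l; first by rewrite lee_fin.
  by apply: (bnorm_le fp) => //; exact: measurable_cst.
have h2 : {ae mu, forall z, forall j, w j = 0 -> bb z (st j).1 (st j).2 = 0}.
  apply: ae_foralln => j; have [n0|n0] := eqVneq (w j) 0; last first.
    by apply: aeW => z /eqP; rewrite (negbTE n0).
  have : {ae mu, forall z, bb z (st j).1 (st j).2 = 0}.
    apply: ae_int_eq0 => // A mA.
    have cv := @comb_comb_test (st j).1 (st j).2 _ (test_indic mA).
    have : I (fun z => \1_A z * comb g (st j).2 (F (n_ k) (st j).1 z)) @[k --> \oo] --> (0 : R).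
      rewrite (_ : (fun k => _) = (fun _ => 0)); first exact: cvg_cst.
      apply/funext => k; rewrite -[RHS](int0 mu); apply: int_ae.
      - by apply: integ_measurable (integ_indic mA (igtF _ _ _)).
      - exact: measurable_cst.
      apply: filterS (F_ae (n_ k) (st j).1) => z hz.
      suff -> : comb g (st j).2 (F (n_ k) (st j).1 z) = 0 by rewrite mulr0.
      apply/eqP; rewrite -normr_le0.
      move/eqP: n0; rewrite /w mulf_eq0 => /orP[/eqP n0|/eqP n0].
        rewrite hz (normr0_eq0 n0) linear0 in_dual0 ?normr0//.
        exact: (nf_comb_dual nf).
      apply: le_trans (span_norm_ub_closed (nf_comb_dual nf _) (cF _ _ _)) _.
      by rewrite n0 mul0r.
    by move=> cv0; exact: (cvg_unique _ cv cv0).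
  by apply: filterS => z ->.
apply: filterS2 h1 h2 => z [h h0 ha] hz; exists h => // s t.
rewrite -mulrA.
have half s' : bb z s' t <= h * (`|comb x s'| * span_norm y (comb g t)).
  have [j js] := enumerateP ([::] : QS, [::] : DS) (s', t).
  have := ha j; have := hz j; rewrite /a /w /st js/=; set wj := _ * span_norm _ _.
  have [->|n0] := eqVneq wj 0; first by move=> -> // _; rewrite mulr0.
  have wp : 0 < wj by rewrite lt_neqAle eq_sym n0 mulr_ge0.
  by move=> _; rewrite mulrC ler_pdivrMr.
rewrite ler_norml half andbT lerNl.
have := half (comb_axpy (-1) s [::]).
rewrite /bb !comb_axpyE !comb_nil !addr0 rmorphN1 !scaleN1r normrN.
exact.
Qed.

(** Almost everywhere [nf_operator] represents the limit form; the operator is set to 0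
    on the exceptional set. *)
Lemma limit_operator : exists (N : set Z) (L : Z -> {linear X -> Y}),
  [/\ measurable N, mu N = 0%E, forall z, continuous (L z),
      forall z v, closed_span y (L z v) &
      forall z i s, g s (L z (x i)) = \1_(~` N) z * beta (i, s) z].
Proof.
have [N [mN N0 hN]] := form_bounded.
have xd v e : 0 < e -> exists s, `|v - comb x s| < e.
  by move=> /(xdense v)[i hi]; exists [:: (1, i)]; rewrite comb1.
have /choice[L hL] : forall z, exists L : {linear X -> Y}, [/\ continuous L,
    forall v, closed_span y (L v) &
    forall i s, g s (L (x i)) = \1_(~` N) z * beta (i, s) z].
  move=> z; have [zN|zN] := pselect (N z).
    have [a v w|L LE] := @linear_pack R X Y (fun _ => 0); first by rewrite scaler0 addr0.
    exists L; split.
    - by apply: (@linear_bounded_continuous _ _ _ L 0) => v; rewrite LE normr0 mul0r.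
    - by move=> v h dh _; rewrite LE in_dual0.
    - move=> i s; rewrite LE (in_dual0 (nf_dual nf s)) indicE.
      by rewrite memNset ?mul0r// => /(_ zN).
  have [h h0 hb] : exists2 h, 0 <= h & forall s t,
      `|bb z s t| <= h * `|comb x s| * span_norm y (comb g t).
    by apply: contrapT => nh; apply: zN; apply: hN.
  have [L [LN Lc Lg]] := nf_operator nf rY h0 xd hb.
  exists L; split=> //; first exact: linear_bounded_continuous LN.
  by move=> i s; rewrite Lg indicE mem_set// mul1r.
by exists N, L; split=> // [z|z v|z i s]; have [] := hL z.
Qed.

Section limit.
Variables (N : set Z) (L : Z -> {linear X -> Y}).
Hypotheses (mN : measurable N) (muN : mu N = 0%E) (Lc : forall z, continuous (L z)).
Hypothesis Lspan : forall z v, closed_span y (L z v).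
Hypothesis Lg : forall z i s, g s (L z (x i)) = \1_(~` N) z * beta (i, s) z.

Let mgL i s : mf (fun z => g s (L z (x i))).
Proof.
under eq_fun do rewrite Lg.
apply: measurable_funM; first exact/measurable_indic/measurableC.
exact: integ_measurable (ibeta (i, s)).
Qed.

Lemma limit_smeas u : smeas u -> smeas (fun z => L z (u z)).
Proof.
move=> su; apply: (weak_pettis nf) => [z|s]; first exact: Lspan.
apply: (measurable_fun_cvg (h := fun m z => g s (L z (x (nearest u x m z))))).
  move=> m; have [ms _] := nearest_bounded_index x m su.
  exact: (@measurable_selected _ _ _ (measurableTypeR R) _
    (fun i z => g s (L z (x i))) ms (fun i => mgL i s)).
move=> z _; have [_ cg] := nf_dual nf s.
apply: (@continuous_cvg _ _ _ _ _ _ (g s) (L z (u z))); first exact: cg.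
apply: (@continuous_cvg _ _ _ _ _ _ (L z) (u z)); first exact: Lc.
exact: nearest_cvg (xdense _).
Qed.

Let LgE i t : {ae mu, forall z, comb g t (L z (x i)) = comb (b z i) t}.
Proof.
exists N; split=> // z /= h; apply: contrapT => zN; apply: h.
rewrite comb_funE; congr comb; apply/funext => s.
by rewrite Lg indicE mem_set// mul1r.
Qed.

Let mgLt i t : mf (fun z => comb g t (L z (x i))).
Proof. exact: smeas_dual (nf_comb_dual nf t) (limit_smeas (smeas_cst (x i))). Qed.

Let igLt i t : integ mu (fun z => comb g t (L z (x i))).
Proof.
have ibt := ib i t; apply/integrableP; split; first exact/measurable_EFinP.
have /integrableP[_] := ibt; congr (_ < _)%E; apply: ae_eq_integral => //.
- by apply: measurableT_comp => //; apply/measurable_EFinP; exact: integ_measurable ibt.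
- by apply: measurableT_comp => //; apply/measurable_EFinP.
- by apply: filterS (LgE i t) => z /= ->.
Qed.

Lemma limit_test sigma m t : bounded_index sigma m ->
  [/\ forall k, integ mu (fun z => comb g t (f (n_ k) (sigma z) z)),
      integ mu (fun z => comb g t (L z (x (sigma z)))) &
      forall h, test_function h ->
        I (fun z => h z * comb g t (f (n_ k) (sigma z) z)) @[k --> \oo] -->
        I (fun z => h z * comb g t (L z (x (sigma z))))].
Proof.
move=> bs.
apply: (cvg_selected_test (u := fun i k z => comb g t (f (n_ k) i z))
  (w := fun i z => comb g t (L z (x i))) bs) => // i h th.
rewrite (_ : I (fun z => h z * comb g t (L z (x i))) = I (fun z => h z * comb (b z i) t)).
  exact: image_comb_test.
have [mh _] := th.
apply: int_ae; first exact: measurable_funM.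
  by apply: measurable_funM => //; exact: integ_measurable (ib i t).
by apply: filterS (LgE i t) => z ->.
Qed.

(** A pointwise defined operator commutes with gluing, up to a null set. *)
Lemma image_selected k sigma m : bounded_index sigma m ->
  bspace rq (fun z => f (n_ k) (sigma z) z) /\
  {ae mu, forall z, f (n_ k) (sigma z) z = T (n_ k) (fun z => x (sigma z)) z}.
Proof.
move=> bs; have [ms sm] := bs.
have bx : bspace rp (fun z => x (sigma z)).
  have dz : bdual rp (fun _ : Z -> X => (0 : R)).
    split=> [a h1 h2 _ _|]; first by rewrite mulr0 addr0.
    by exists 0 => h1 _; rewrite normr0 mul0e.
  by have [] := bdual_selected fp (F := fun i _ => x i) dz bs (fun i => bcst (x i)).
have ae : {ae mu, forall z, f (n_ k) (sigma z) z = T (n_ k) (fun z => x (sigma z)) z}.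
  have h1 := ae_foralln (fun i => Tae (n_ k) (bcst (x i))).
  by apply: filterS2 h1 (Tae (n_ k) bx) => z h1 ->; rewrite -h1.
have sF : smeas (fun z => f (n_ k) (sigma z) z).
  by apply: (@smeas_selected _ _ _ _ (fun i z => f (n_ k) i z)) => // i; have [] := bf (n_ k) i.
have [sT T1] := Tin (n_ k) bx.
by split=> //; split=> //; rewrite (bnorm_ae fq sF sT ae).
Qed.

(** Lower semicontinuity: the integral of [|L u|] against a test function is the
    supremum of integrals against combinations of the norming family chosen at a
    measurable index, along which the images converge; conclude by [rn_dual]. *)
Lemma limit_bound_simple sigma m K : bounded_index sigma m -> 0 <= K ->
  (forall k, (bnorm rq (T (n_ k) (fun z => x (sigma z))) <= K%:E)%E) ->
  (bnorm rq (fun z => L z (x (sigma z))) <= K%:E)%E.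
Proof.
move=> bs K0 TK; have [ms _] := bs.
set Lu := fun z => L z (x (sigma z)).
have sx : smeas (fun z => x (sigma z)).
  by apply: (@smeas_selected _ _ _ _ (fun i _ => x i)) => // i; exact: smeas_cst.
have sL : smeas Lu by exact: limit_smeas.
have mL := smeas_normr sL.
have cL z : closed_span y (Lu z) by exact: Lspan.
apply: (rn_dual rn) => // h M mh hM.
have th : test_function h by split=> //; exists M.
have h0 z : 0 <= h z by have /andP[] := hM z.
set S := ereal_sup _.
have FS k : ((I (fun z => h z * `|f (n_ k) (sigma z) z|))%:E <= S)%E.
  have [[sF F1] Fae] := image_selected k bs.
  have mF := smeas_normr sF.
  have iF : integ mu (fun z => `|f (n_ k) (sigma z) z|).
    apply: (bspace_integ rn) => //; move: F1.
    by congr (_ < _)%E; congr rq; apply/funext => z; rewrite normr_id.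
  rewrite EFin_int; last exact: integ_test.
  apply: ereal_sup_ubound; exists (fun z => `|f (n_ k) (sigma z) z|) => //; split=> //.
  have [_ sT] : True /\ smeas (T (n_ k) (fun z => x (sigma z))).
    split=> //; have dz : bdual rp (fun _ : Z -> X => (0 : R)).
      split=> [a h1 h2 _ _|]; first by rewrite mulr0 addr0.
      by exists 0 => h1 _; rewrite normr0 mul0e.
    have [bx _] := bdual_selected fp (F := fun i _ => x i) dz bs (fun i => bcst (x i)).
    by have [] := Tin (n_ k) bx.
  by rewrite -[X in (X <= _)%E]/(bnorm rq _) (bnorm_ae fq sF sT Fae).
pose tau j := norming_sup g Lu j.
have bt j : bounded_index (tau j) j.
  split; last by move=> z; exact: argmax_le.
  by apply: norming_sup_measurable => s; exact: smeas_dual (nf_dual nf s) sL.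
pose G j z := h z * comb g (norming_seq (tau j z)) (Lu z).
have key j : integ mu (G j) /\ ((I (G j))%:E <= S)%E.
  have hyp i := limit_test (norming_seq i) bs.
  have [iu iw cv] := cvg_selected_test
    (u := fun i k z => comb g (norming_seq i) (f (n_ k) (sigma z) z))
    (w := fun i z => comb g (norming_seq i) (Lu z)) (bt j)
    (fun i k => let: And3 h1 _ _ := hyp i in h1 k)
    (fun i => let: And3 _ h2 _ := hyp i in h2)
    (fun i => let: And3 _ _ h3 := hyp i in h3).
  split; first exact: integ_test.
  have {}cv := cv h th.
  have uS k : ((I (fun z => (h z * comb g (norming_seq (tau j z)) (f (n_ k) (sigma z) z))%R))%:E <= S)%E.
    apply: le_trans (FS k); rewrite lee_fin; apply: int_le.
    - exact: integ_test.
    - have [[sF F1] _] := image_selected k bs.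
      apply: integ_test => //; apply: (bspace_integ rn); first exact: smeas_normr.
      by move: F1; congr (_ < _)%E; congr rq; apply/funext => z; rewrite normr_id.
    - move=> z; apply: ler_wpM2l => //; rewrite comb_norming_seq.
      case: (tau j z) => [|i]; first exact: normr_ge0.
      by apply: le_trans (ler_norm _) _; exact: nf_le nf _ _.
  case: S FS uS => [r| |] FS uS.
  - by rewrite lee_fin; apply: (cvgr_to_le cv); apply: nearW => k; rewrite -lee_fin; exact: uS.
  - exact: leey.
  - by have := FS 0%N; rewrite leeNy_eq.
have mG j : measurable_fun setT (fun z => (G j z)%:E).
  by apply/measurable_EFinP; exact: integ_measurable (key j).1.
have G0 j z : setT z -> (0 <= (G j z)%:E)%E.
  by move=> _; rewrite lee_fin mulr_ge0//; have /andP[] := norming_sup_le nf Lu j z.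
have Gnd z : setT z -> {homo (fun j => (G j z)%:E) : m n / (m <= n)%N >-> (m <= n)%E}.
  move=> _ i j ij; rewrite lee_fin; apply: ler_wpM2l => //.
  apply: (argmaxP (fun j z => comb g (norming_seq j) (Lu z) : R)).
  by apply: leq_trans ij; exact: argmax_le.
have cvG := cvg_monotone_convergence measurableT mG G0 Gnd.
have -> : (\int[mu]_z (h z * `|Lu z|)%:E = \int[mu]_z limn (fun j => (G j z)%:E))%E.
  apply: eq_integral => z _; apply/esym/cvg_lim => //; apply: cvg_EFin; first exact: nearW.
  apply: cvgM; first exact: cvg_cst.
  by have := norming_sup_cvg nf (f := Lu) (cL z).
rewrite -(cvg_lim _ (cvG mu))//; apply: lime_le; first by apply/cvg_ex; eexists; exact: (cvG mu).
by apply: nearW => j; have [iG] := key j; rewrite EFin_int.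
Qed.

Let near (u : Z -> X) m z := nearest u x m z.

(** Approximation of [u] by simple functions and [rn_fatou]. *)
Lemma limit_bound u : bspace rp u ->
  (bnorm rq (fun z => L z (u z)) <= C%:E * bnorm rp u)%E.
Proof.
move=> bu; have [su u1] := bu.
have [bs s0] := nearest_approx fp bu x0 (fun z => xdense (u z)).
have fu := bspace_fin fp bu.
pose U := fine (bnorm rp u); have UE : bnorm rp u = U%:E by rewrite fineK.
have U0 : 0 <= U by rewrite fine_ge0// (bnorm_ge0 fp).
rewrite UE -EFinM; apply/lee_addgt0Pr => e e0; rewrite -EFinD.
have C1 : 0 < C + 1 by rewrite ltr_wpDl.
apply: (rn_fatou rn (k_ := fun m z => `|L z (x (near u m z))|)).
- by move=> m; apply: smeas_normr; apply: limit_smeas; case: (bs m).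
- by [].
- move=> z; apply: cvg_norm.
  apply: (@continuous_cvg _ _ _ _ _ _ (L z) (u z)); first exact: Lc.
  exact: nearest_cvg (xdense _).
- by rewrite addr_ge0 ?(ltW e0)// mulr_ge0.
have eC : (0 < (e / (C + 1))%:E)%E by rewrite lte_fin divr_gt0.
have : \forall m \near \oo,
    (bnorm rp (fun z => (x (nearest u x m z) - u z)%R) < (e / (C + 1))%:E)%E.
  exact: (s0 _ (open_ereal_lt' eC)).
apply: filterS => m hm.
apply: (limit_bound_simple (nearest_bounded_index x m su)).
  by rewrite addr_ge0 ?(ltW e0)// mulr_ge0.
move=> k; apply: (le_trans (TC (n_ k) (bs m))).
have [sm _] := bs m.
have : (bnorm rp (fun z => x (nearest u x m z)) <= (U + e / (C + 1))%:E)%E.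
  have := bnormD fp (smeasB sm su) su.
  rewrite (_ : (fun z => _) = (fun z => x (nearest u x m z))); last first.
    by apply/funext => z; rewrite subrK.
  move=> /le_trans; apply; rewrite UE addeC EFinD.
  by apply: leeD => //; exact: ltW.
move=> h; apply: le_trans (lee_wpmul2l _ h) _; first by rewrite lee_fin.
rewrite -EFinM lee_fin mulrDr lerD2l mulrCA ger_pMr//.
by rewrite ler_pdivrMr// mul1r lerDl.
Qed.

Lemma limit_bspace u : bspace rp u -> bspace rq (fun z => L z (u z)).
Proof.
move=> bu; split; first by apply: limit_smeas; case: bu.
apply: le_lt_trans (limit_bound bu) _.
by rewrite ltey_eq fin_numM// (bspace_fin fp).
Qed.

(** The functionals [Lam (T n _)] are equicontinuous, so that [u] may be taken simple;
    [bdual_weak_cvg] then applies. *)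
Lemma limit_weak_cvg u Lam : bspace rp u -> bdual rq Lam ->
  Lam (T (n_ k) u) @[k --> \oo] --> Lam (fun z => L z (u z)).
Proof.
move=> bu dL; have [su u1] := bu.
have [bs s0] := nearest_approx fp bu x0 (fun z => xdense (u z)).
have [D D0 hD] := bdual_bounded fq dL.
have simple m : Lam (T (n_ k) (fun z => x (near u m z))) @[k --> \oo] -->
    Lam (fun z => L z (x (near u m z))).
  have bi := nearest_bounded_index x m su.
  have bx := bs m; have [sx _] := bx.
  have fx := bspace_fin fp bx.
  rewrite (_ : (fun k => _) = (fun k => Lam (fun z => f (n_ k) (near u m z) z))); last first.
    apply/funext => k; have [bF Fae] := image_selected k bi.
    by apply/esym/(bdual_ae fq dL) => //; exact: Tin.
  apply: (bdual_weak_cvg rn nf (K := fine (C%:E * bnorm rp (fun z => x (near u m z)))%E) dL).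
  - by move=> k; have [] := image_selected k bi.
  - exact: limit_bspace.
  - by move=> k z; exact: cy.
  - by move=> z; exact: Lspan.
  - move=> k; have [[sF _] Fae] := image_selected k bi.
    rewrite fineK ?fin_numM//.
    have [sT _] := Tin (n_ k) bx.
    by rewrite (bnorm_ae fq sF sT Fae); exact: TC.
  - by rewrite fineK ?fin_numM//; exact: limit_bound.
  - move=> t A mA; have [_ _ cv] := limit_test t bi; exact: cv (test_indic mA).
apply/cvgrPdist_le => e e0.
have DC : 0 < D * (C + 1) by rewrite mulr_gt0// ltr_wpDl.
have eta0 : 0 < e / 4 / (D * (C + 1)) by rewrite !divr_gt0.
set eta := e / 4 / (D * (C + 1)) in eta0.
have etaE : (0 < eta%:E)%E by rewrite lte_fin.
have [m _ /(_ m (leqnn m))/= hm] := s0 _ (open_ereal_lt' etaE).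
pose s z := x (near u m z).
have bus : bspace rp (fun z => u z - s z) by exact: (bspaceB fp bu (bs m)).
have nus : (C%:E * bnorm rp (fun z => (u z - s z)%R) <= (C * eta)%:E)%E.
  rewrite EFinM; apply: lee_wpmul2l; first by rewrite lee_fin.
  rewrite (_ : (fun z => _) = (fun z => - (s z - u z))); last first.
    by apply/funext => z; rewrite opprB.
  by rewrite bnormN; exact: ltW.
have DCe : D * (C * eta) <= e / 4.
  have -> : e / 4 = D * ((C + 1) * eta).
    by rewrite /eta mulrA [RHS]mulrC mulfVK// gt_eqF.
  by rewrite ler_pM2l// ler_wpM2r ?(ltW eta0)// lerDl.
have nT k : `|Lam (T (n_ k) u) - Lam (T (n_ k) s)| <= e / 4.
  have bTu := Tin (n_ k) bu; have bTs := Tin (n_ k) (bs m).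
  apply: le_trans DCe; rewrite -(bdualB dL)//; apply: hD; first exact: (bspaceB fq).
  apply: le_trans nus; have bTus := Tin (n_ k) bus.
  rewrite (@bnorm_ae _ _ _ mu _ _ fq _ (T (n_ k) (fun z => u z - s z))).
  - exact: TC.
  - by have [] := bspaceB fq bTu bTs.
  - by case: bTus.
  - apply: filterS3 (Tae (n_ k) bu) (Tae (n_ k) (bs m)) (Tae (n_ k) bus) => z -> -> ->.
    by rewrite linearB.
have nL : `|Lam (fun z => L z (u z)) - Lam (fun z => L z (s z))| <= e / 4.
  have bLu := limit_bspace bu; have bLs := limit_bspace (bs m).
  apply: le_trans DCe; rewrite -(bdualB dL)//; apply: hD; first exact: (bspaceB fq).
  apply: le_trans nus; have := limit_bound bus.
  by under eq_fun do rewrite linearB.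
have e40 : 0 < e / 4 by rewrite divr_gt0.
have /cvgrPdist_le/(_ _ e40) := simple m; apply: filterS => k hk.
have h1 := nT k.
have -> : Lam (fun z => L z (u z)) - Lam (T (n_ k) u) =
  (Lam (fun z => L z (u z)) - Lam (fun z => L z (s z))) +
  (Lam (fun z => L z (s z)) - Lam (T (n_ k) s)) - (Lam (T (n_ k) u) - Lam (T (n_ k) s)) by ring.
apply: le_trans (ler_normB _ _) _.
apply: le_trans (lerD (ler_normD _ _) (lexx _)) _.
by rewrite /s in h1 nL *; lra.
Qed.

End limit.
End pointwise_operators.

Section pointwise_weak_compactness.
Context {R : realType} {d : measure_display} {Z : measurableType d}.
Variable mu : {finite_measure set Z -> \bar R}.

Lemma separable_sequence (X : normedModType R) : separable X ->
  exists x : nat -> X, x 0%N = 0 /\ forall v e, 0 < e -> exists i, `|v - x i| < e.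
Proof.
move=> [D cD dD]; have [x [x0 hx]] := countable_sequence cD.
exists x; split=> // v e e0.
have [|w [bw Dw]] := dD (ball v e) _ (ball_open v e).
  by exists v; exact: ballxx.
by have [i xi] := hx w Dw; exists i; move: bw; rewrite xi -ball_normE.
Qed.

(** The subsequence makes the countably many real functions [g s (T n (x i))] converge
    weakly, where [x] is dense in [X] and [g] is a norming family for a sequence whose
    closed span contains all the values; the operators [L z] are assembled from the
    limits. *)
Theorem pointwise_weak_compactness (rp rq : (Z -> R) -> \bar R)
    (X Y : normedModType R) (T : nat -> (Z -> X) -> Z -> Y)
    (Ln : nat -> Z -> {linear X -> Y}) (C : R) :
  function_norm mu rp -> reflexive_norm mu rq -> separable X -> reflexive_space Y ->
  0 <= C ->
  (forall n u, bspace rp u -> bspace rq (T n u)) ->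
  (forall n u, bspace rp u -> {ae mu, forall z, T n u z = Ln n z (u z)}) ->
  (forall n u, bspace rp u -> (bnorm rq (T n u) <= C%:E * bnorm rp u)%E) ->
  exists (n_ : nat -> nat) (L : Z -> {linear X -> Y}),
    [/\ {homo n_ : i j / (i < j)%N}, forall z, continuous (L z) &
      forall u, bspace rp u ->
        [/\ bspace rq (fun z => L z (u z)),
            (bnorm rq (fun z => L z (u z)) <= C%:E * bnorm rp u)%E &
            forall Lam, bdual rq Lam ->
              Lam (T (n_ k) u) @[k --> \oo] --> Lam (fun z => L z (u z))]].
Proof.
move=> fp rn sX rY C0 Tin Tae TC.
have [x [x0 xd]] := separable_sequence sX.
have bcst (v : X) : bspace rp (fun _ : Z => v).
  by apply: (bspace_bounded fp (M := `|v|)) => //; exact: smeas_cst.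
have [y cy] := image_span fp (rq := rq) x Tin.
have [g nf] := reflexive_norming_family y rY.
pose psi (j : nat * seq (rat * nat)) n z : R := g j.2 (T n (fun _ => x j.1) z).
have nbT i : (C%:E * bnorm rp (fun _ : Z => x i))%E \is a fin_num.
  by rewrite fin_numM// (bspace_fin fp).
have psi_norm j n z : `|psi j n z| <= `|T n (fun _ => x j.1) z| by exact: nf_le nf _ _.
have mpsi j n : measurable_fun setT (psi j n).
  have [sT _] := Tin n _ (bcst (x j.1)).
  exact: smeas_dual (nf_dual nf j.2) sT.
have psiK j n : (rq (fun z => `|psi j n z|%R) <=
    (fine (C%:E * bnorm rp (fun _ : Z => x j.1))%E)%:E)%E.
  have [sT _] := Tin n _ (bcst (x j.1)).
  rewrite fineK//; apply: (le_trans _ (TC n _ (bcst (x j.1)))).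
  apply: (fn_le rn) => // [||z]; last by rewrite normr_ge0 psi_norm.
    exact: measurableT_comp.
  exact: smeas_normr.
have [n_ [beta [n_lt ibeta cbeta]]] := weak_compactness rn mpsi psiK.
have [N [L [mN muN Lc Lspan Lg]]] :=
  limit_operator fp rn xd rY C0 Tin Tae TC cy nf ibeta cbeta.
exists n_, L; split=> // u bu; split.
- exact: (limit_bspace fp rn x0 xd C0 Tin Tae TC nf ibeta cbeta mN muN Lc Lspan Lg).
- exact: (limit_bound fp rn x0 xd C0 Tin Tae TC nf ibeta cbeta mN muN Lc Lspan Lg).
- move=> Lam dL.
  exact: (limit_weak_cvg fp rn x0 xd C0 Tin Tae TC cy nf ibeta cbeta mN muN Lc Lspan Lg).
Qed.

End pointwise_weak_compactness.

(** * Lebesgue norms of extended real functions *)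

Section lnorm_ereal.
Context {R : realType} {d : measure_display} {T : measurableType d}.
Variable mu : {measure set T -> \bar R}.
Local Open Scope ereal_scope.
Implicit Types (a b : T -> \bar R) (r : R).
Local Notation mf a := (measurable_fun [set: T] (a : T -> \bar R)).
Local Notation N r a := ('N[mu]_r%:E[a]).

Lemma LnormE r a : (forall x, 0 <= a x) -> N r a = (\int[mu]_x a x `^ r) `^ r^-1.
Proof.
move=> a0; rewrite unlock; congr (_ `^ _); apply: eq_integral => x _.
by rewrite gee0_abs.
Qed.

Lemma ler_poweR r (x y : \bar R) : (0 <= r)%R -> 0 <= x -> x <= y -> x `^ r <= y `^ r.
Proof.
move=> r0 x0 xy; apply: gt0_ler_poweR => //; rewrite in_itv/= leey andbT//.
exact: le_trans xy.
Qed.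

Lemma measurable_poweR_comp r a : mf a -> mf (fun x => a x `^ r).
Proof. by move=> ma; exact: (measurableT_comp (measurable_poweR r)). Qed.

Lemma Lnorm_le r a b : (0 < r)%R -> mf a -> mf b -> (forall x, 0 <= a x) ->
  {ae mu, forall x, a x <= b x} -> N r a <= N r b.
Proof.
move=> r0 ma mb a0 ab.
have i0 : (0 <= r^-1)%R by rewrite invr_ge0 ltW.
rewrite unlock; apply: ler_poweR => //.
  by apply: integral_ge0 => x _; exact: poweR_ge0.
apply: ae_ge0_le_integral => //.
- by move=> x _; exact: poweR_ge0.
- by apply: measurable_poweR_comp; exact: measurableT_comp.
- by move=> x _; exact: poweR_ge0.
- by apply: measurable_poweR_comp; exact: measurableT_comp.
apply: filterS ab => x ab _; have b0 := le_trans (a0 x) ab.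
by rewrite !gee0_abs//; apply: ler_poweR => //; exact: ltW.
Qed.

Lemma Lnorm_ae r a b : (0 < r)%R -> mf a -> mf b -> (forall x, 0 <= a x) ->
  (forall x, 0 <= b x) -> {ae mu, forall x, a x = b x} -> N r a = N r b.
Proof.
move=> r0 ma mb a0 b0 ab; apply/eqP; rewrite eq_le !Lnorm_le//.
  by apply: filterS ab => x ->.
by apply: filterS ab => x ->.
Qed.

Lemma LnormZ_ge0 r (c : R) a : (0 < r)%R -> mf a -> (forall x, 0 <= a x) -> (0 <= c)%R ->
  N r (fun x => c%:E * a x) = c%:E * N r a.
Proof.
move=> r0 ma a0 c0; have cE : 0 <= c%:E by rewrite lee_fin.
rewrite !LnormE//; last by move=> x; exact: mule_ge0.
under eq_integral do rewrite poweRM//.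
rewrite poweR_EFin ge0_integralZl_EFin//.
- rewrite poweRM ?lee_fin ?powR_ge0//; last by apply: integral_ge0 => x _; exact: poweR_ge0.
  by rewrite poweR_EFin -powRrM mulfV ?gt_eqF// powRr1.
- by move=> x _; exact: poweR_ge0.
- exact: measurable_poweR_comp.
- by rewrite powR_ge0.
Qed.

Lemma Lnorm_lty_ae r a : (0 < r)%R -> mf a -> (forall x, 0 <= a x) -> N r a < +oo ->
  {ae mu, forall x, a x \is a fin_num}.
Proof.
move=> r0 ma a0; have ir0 : (0 < r^-1)%R by rewrite invr_gt0.
rewrite LnormE// => /(lty_poweRy (lt0r_neq0 ir0)) h.
have ia : mu.-integrable setT (fun x => a x `^ r).
  apply/integrableP; split; first exact: measurable_poweR_comp.
  by under eq_integral do rewrite gee0_abs ?poweR_ge0//; exact: h.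
apply: filterS (integrable_ae measurableT ia) => x /(_ Logic.I) fx.
rewrite ge0_fin_numE//; apply: (lty_poweRy (lt0r_neq0 r0)).
by rewrite ltey_eq fx.
Qed.

Lemma Lnorm_fine r a : (0 < r)%R -> mf a -> (forall x, 0 <= a x) -> N r a < +oo ->
  [/\ measurable_fun setT (fine \o a), forall x, (0 <= (fine \o a) x)%R,
      {ae mu, forall x, a x = (EFin \o (fine \o a)) x} &
      N r a = N r (EFin \o (fine \o a))].
Proof.
move=> r0 ma a0 aoo.
have mfa : measurable_fun setT (fine \o a) by exact: measurableT_comp.
have fa0 x : (0 <= (fine \o a) x)%R by exact: fine_ge0.
have ae : {ae mu, forall x, a x = (EFin \o (fine \o a)) x}.
  by apply: filterS (Lnorm_lty_ae r0 ma a0 aoo) => x fx /=; rewrite fineK.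
by split=> //; apply: Lnorm_ae => //; exact/measurable_EFinP.
Qed.

Lemma LnormD_ge0 r a b : (1 <= r)%R -> mf a -> mf b -> (forall x, 0 <= a x) ->
  (forall x, 0 <= b x) -> N r (a \+ b) <= N r a + N r b.
Proof.
move=> r1 ma mb a0 b0; have r0 := lt_le_trans ltr01 r1.
have [aoo|] := ltP (N r a) +oo; last first.
  by rewrite leye_eq => /eqP ->; rewrite addye ?leey// -ltNye (lt_le_trans _ (Lnorm_ge0 _ _ _)).
have [boo|] := ltP (N r b) +oo; last first.
  by rewrite leye_eq => /eqP ->; rewrite addey ?leey// -ltNye (lt_le_trans _ (Lnorm_ge0 _ _ _)).
have [mfa fa0 aae ->] := Lnorm_fine r0 ma a0 aoo.
have [mfb fb0 bae ->] := Lnorm_fine r0 mb b0 boo.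
apply: le_trans (minkowski_EFin mu mfa mfb r1); apply: Lnorm_le => //.
- exact: emeasurable_funD.
- exact/measurable_EFinP/measurable_funD.
- by move=> x; exact: adde_ge0.
- by apply: filterS2 aae bae => x /= -> ->.
Qed.

Lemma hoelder_ge0 p q a b : (0 < p)%R -> (0 < q)%R -> (p^-1 + q^-1 = 1)%R ->
  mf a -> mf b -> (forall x, 0 <= a x) -> (forall x, 0 <= b x) ->
  N p a < +oo -> N q b < +oo ->
  \int[mu]_x (a x * b x) <= N p a * N q b.
Proof.
move=> p0 q0 pq ma mb a0 b0 aoo boo.
have [mfa fa0 aae ->] := Lnorm_fine p0 ma a0 aoo.
have [mfb fb0 bae ->] := Lnorm_fine q0 mb b0 boo.
apply: le_trans (hoelder mu mfa mfb p0 q0 pq); rewrite Lnorm1.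
apply: ae_ge0_le_integral => //.
- by move=> x _; exact: mule_ge0.
- exact: emeasurable_funM.
- by apply: measurableT_comp => //; exact/measurable_EFinP/measurable_funM.
- apply: filterS2 aae bae => x /= -> -> _.
  by rewrite ger0_norm ?EFinM// mulr_ge0//; [exact: fa0|exact: fb0].
Qed.

(** Dominated convergence, on powers. *)
Lemma Lnorm_cvg0 r (a_ : nat -> T -> \bar R) a : (0 < r)%R ->
  (forall n, mf (a_ n)) -> mf a -> (forall n x, 0 <= a_ n x) ->
  {ae mu, forall x, forall n, a_ n x <= a x} -> N r a < +oo ->
  {ae mu, forall x, a_ n x @[n --> \oo] --> 0} ->
  N r (a_ n) @[n --> \oo] --> 0.
Proof.
move=> r0 ma_ ma a_0 aa aoo cva.
have ir0 : (0 < r^-1)%R by rewrite invr_gt0.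
have pow0 (p : R) (u : nat -> \bar R) : (0 < p)%R -> (forall n, 0 <= u n) ->
    u n @[n --> \oo] --> 0 -> u n `^ p @[n --> \oo] --> 0.
  move=> p0 u0 cu.
  have /fine_cvgP[fu uf] := cu.
  apply/fine_cvgP; split.
    by apply: filterS fu => n; exact: fin_num_poweR.
  rewrite (_ : fine \o _ = (fun n => fine (u n) `^ p)%R); last first.
    by apply/funext => n; rewrite /= fine_poweR.
  apply/cvgrPdist_lt => e e0.
  have /cvgrPdist_lt/(_ (e `^ p^-1)%R) := uf.
  rewrite powR_gt0// => /(_ isT); apply: filterS => n; rewrite /= !sub0r !normrN.
  rewrite !ger0_norm ?powR_ge0 ?fine_ge0// => h.
  have := gt0_ltr_powR p0 (_ : fine (u n) \in Num.nneg) (_ : (e `^ p^-1)%R \in Num.nneg) h.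
  rewrite !nnegrE fine_ge0 ?powR_ge0// => /(_ isT isT).
  by rewrite -powRrM mulVf ?gt_eqF// powRr1// ltW.
rewrite (_ : (fun n => _) = (fun n => (\int[mu]_x a_ n x `^ r) `^ r^-1)); last first.
  by apply/funext => n; rewrite LnormE.
apply: (pow0) => // [n|]; first by apply: integral_ge0 => x _; exact: poweR_ge0.
have ia : mu.-integrable setT (fun x => a x `^ r).
  apply/integrableP; split; first exact: measurable_poweR_comp.
  under eq_integral do rewrite gee0_abs ?poweR_ge0//.
  move: aoo; rewrite unlock => /lty_poweRy; rewrite (gt_eqF ir0) => /(_ isT).
  congr (_ < _); apply: ae_eq_integral => //.
  - by apply: measurable_poweR_comp; exact: measurableT_comp.
  - exact: measurable_poweR_comp.
  by apply: filterS aa => x /(_ 0%N) h _; rewrite gee0_abs// (le_trans (a_0 0%N x) h).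
have [|||||_ _] := @dominated_convergence _ T R mu setT measurableT
  (fun n x => a_ n x `^ r) (cst 0) (fun x => a x `^ r).
- by move=> n; exact: measurable_poweR_comp.
- exact: measurable_cst.
- by apply: filterS cva => x cx _; apply: pow0.
- exact: ia.
- apply: filterS aa => x ax n _.
  by rewrite gee0_abs ?poweR_ge0//; apply: ler_poweR => //; exact: ltW.
by rewrite integral0.
Qed.

End lnorm_ereal.

Section lnorm_ereal_limits.
Context {R : realType} {d : measure_display} {T : measurableType d}.
Variable mu : {measure set T -> \bar R}.
Local Open Scope ereal_scope.
Implicit Types (a b : T -> \bar R) (r : R).
Local Notation mf a := (measurable_fun [set: T] (a : T -> \bar R)).
Local Notation N r a := ('N[mu]_r%:E[a]).

Lemma poweRK r (x : \bar R) : r != 0%R -> 0 <= x -> (x `^ r) `^ r^-1 = x.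
Proof. by move=> r0 x0; rewrite -poweRrM mulfV// poweRe1. Qed.

Lemma poweRVK r (x : \bar R) : r != 0%R -> 0 <= x -> (x `^ r^-1) `^ r = x.
Proof. by move=> r0 x0; rewrite -poweRrM mulVf// poweRe1. Qed.

(** Monotone convergence. Describing the limit [a] by its upper bounds makes the passage
    to powers immediate, infinite values included. *)
Lemma Lnorm_sup_le r (a_ : nat -> T -> \bar R) a (C : \bar R) : (0 < r)%R ->
  (forall n, mf (a_ n)) -> (forall n x, 0 <= a_ n x) ->
  (forall x m n, (m <= n)%N -> a_ m x <= a_ n x) ->
  (forall x c, (forall n, a_ n x <= c) -> a x <= c) -> (forall x, 0 <= a x) -> mf a ->
  (forall n, N r (a_ n) <= C) -> N r a <= C.
Proof.
move=> r0 ma_ a_0 nda asup a0 ma aC; have rn0 : r != 0%R by rewrite gt_eqF.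
have ir0 : (0 < r^-1)%R by rewrite invr_gt0.
have C0 : 0 <= C by exact: le_trans (Lnorm_ge0 _ _ _) (aC 0%N).
have nd x : {homo (fun n => a_ n x `^ r) : m n / (m <= n)%N >-> m <= n}.
  by move=> m n mn; apply: ler_poweR; rewrite ?(ltW r0)// nda.
have ip n : \int[mu]_x a_ n x `^ r <= C `^ r.
  have := ler_poweR (ltW r0) (Lnorm_ge0 mu r%:E (a_ n)) (aC n).
  rewrite poweR_Lnorm//; congr (_ <= _); apply: eq_integral => x _.
  by rewrite gee0_abs.
rewrite LnormE// -[leRHS](poweRK rn0)//; apply: ler_poweR => //; first exact: ltW.
  by apply: integral_ge0 => x _; exact: poweR_ge0.
apply: (@le_trans _ _ (\int[mu]_x limn (fun n => a_ n x `^ r))).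
  apply: ge0_le_integral => //.
  - by move=> x _; exact: poweR_ge0.
  - exact: measurable_poweR_comp.
  - apply: (emeasurable_fun_cvg (fun n x => a_ n x `^ r)) => [n|x _].
      exact: measurable_poweR_comp.
    exact: ereal_nondecreasing_is_cvgn.
  move=> x _; rewrite -[leRHS](poweRVK rn0).
    apply: ler_poweR => //; first exact: ltW.
    apply: asup => n; rewrite -[leLHS](poweRK rn0)//; apply: ler_poweR => //.
    - exact: ltW.
    - exact: poweR_ge0.
    - rewrite (cvg_lim _ (ereal_nondecreasing_cvgn (nd x)))//.
      by apply: ereal_sup_ubound; exists n.
  rewrite (cvg_lim _ (ereal_nondecreasing_cvgn (nd x)))//.
  apply: (@le_trans _ _ (a_ 0%N x `^ r)); first exact: poweR_ge0.
  by apply: ereal_sup_ubound; exists 0%N.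
rewrite monotone_convergence//.
- apply: lime_le; last by apply: nearW => n; exact: ip.
  apply: ereal_nondecreasing_is_cvgn => m n mn; apply: ge0_le_integral => //.
  + by move=> x _; exact: poweR_ge0.
  + exact: measurable_poweR_comp.
  + exact: measurable_poweR_comp.
  + by move=> x _; exact: nd.
- by move=> n; exact: measurable_poweR_comp.
- by move=> n x _; exact: poweR_ge0.
Qed.

Lemma Lnorm_poweR r m a : (0 < m)%R -> (0 < r)%R -> (forall x, 0 <= a x) ->
  N r a = N (r / m)%R (fun x => a x `^ m) `^ m^-1.
Proof.
move=> m0 r0 a0; rewrite !LnormE//; last by move=> x; exact: poweR_ge0.
rewrite -poweRrM invfM invrK mulfK ?gt_eqF//.
congr (_ `^ _); apply: eq_integral => x _.
by rewrite -poweRrM mulrC mulfVK ?gt_eqF.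
Qed.

End lnorm_ereal_limits.

Section lnorm_finite_measure.
Context {R : realType} {d : measure_display} {T : measurableType d}.
Variable mu : {finite_measure set T -> \bar R}.
Local Open Scope ereal_scope.
Implicit Types (a b : T -> \bar R) (r : R).
Local Notation mf a := (measurable_fun [set: T] (a : T -> \bar R)).
Local Notation N r a := ('N[mu]_r%:E[a]).

Lemma Lnorm_cst1_fin r : N r (cst 1%E) \is a fin_num.
Proof. by rewrite Lnorm_cst1; apply: fin_num_poweR; exact: fin_num_measure. Qed.

Lemma Lnorm_bounded r a (M : R) : (0 < r)%R -> mf a -> (forall x, 0 <= a x <= M%:E) ->
  N r a < +oo.
Proof.
move=> r0 ma aM; have M0 : (0 <= M)%R.
  by rewrite -lee_fin; have /andP[h /(le_trans h)] := aM point.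
have : N r a <= N r (fun x => M%:E * cst 1%E x).
  apply: Lnorm_le => //; first by move=> x; have /andP[] := aM x.
  by apply: aeW => x; rewrite mule1; have /andP[] := aM x.
move/le_lt_trans; apply; rewrite LnormZ_ge0//.
by rewrite ltey_eq fin_numM// Lnorm_cst1_fin.
Qed.

(** Hoelder's inequality against the constant 1; adding 1 makes the constant positive. *)
Lemma integral_le_Lnorm r a : (1 < r)%R -> mf a -> (forall x, 0 <= a x) ->
  \int[mu]_x a x <= (fine (N (r / (r - 1))%R (cst 1%E)) + 1)%:E * N r a.
Proof.
move=> r1 ma a0; have r0 : (0 < r)%R by exact: lt_trans r1.
have c0 : (0 <= fine (N (r / (r - 1))%R (cst 1%E)))%R by apply: fine_ge0; exact: Lnorm_ge0.
have [aoo|] := ltP (N r a) +oo; last first.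
  by rewrite leye_eq => /eqP ->; rewrite gt0_muley ?leey// lte_fin ltr_wpDl.
apply: (@le_trans _ _ (N r a * N (r / (r - 1))%R (cst 1%E))).
  have := @hoelder_ge0 _ _ _ mu r (r / (r - 1))%R a (cst 1%E).
  under [X in (_ -> _ -> _ -> _ -> _ -> _ -> _ -> _ -> _ -> X <= _) -> _]eq_integral do rewrite /cst mule1.
  apply => //; first by rewrite divr_gt0// subr_gt0.
  - rewrite invf_div; field; rewrite ?gt_eqF//.
  - by rewrite ltey_eq Lnorm_cst1_fin.
rewrite muleC lee_wpmul2r ?Lnorm_ge0// -[leLHS]fineK ?Lnorm_cst1_fin//.
by rewrite lee_fin lerDl.
Qed.

End lnorm_finite_measure.

(** * Mixed norms *)

(** The restriction of a finite measure to a sub-sigma-algebra; the proofs are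
    arguments so that the restriction is a measure by inference. *)
Definition trace_measure {R : realType} {d : measure_display} {T : measurableType d}
    (m : set T -> \bar R) (S : set_system T) (hS : S `<=` measurable)
    (moo : (m setT < +oo)%E) : set (g_sigma_algebraType S) -> \bar R := m.

Section trace_measure.
Context {R : realType} {d : measure_display} {T : measurableType d}.
Variables (m : {measure set T -> \bar R}) (S : set_system T).
Hypotheses (hS : S `<=` measurable) (moo : (m setT < +oo)%E).
Local Notation Z := (g_sigma_algebraType S).
Local Notation mu := (trace_measure hS moo).

Lemma trace_measurable (A : set Z) : measurable A -> measurable (A : set T).
Proof.
by move: A; apply: smallest_sub => //; exact: sigma_algebra_measurable.
Qed.

Lemma trace_measurable_fun {d' : measure_display} {T' : sigmaRingType d'} (f : Z -> T') :
  measurable_fun setT f -> measurable_fun setT (f : T -> T').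
Proof. by move=> mf _ B mB; apply: trace_measurable; exact: mf. Qed.

Let mu0 : mu set0 = 0%E. Proof. exact: measure0. Qed.

Let mu_ge0 A : (0 <= mu A)%E. Proof. exact: measure_ge0. Qed.

Let mu_sigma_additive : semi_sigma_additive mu.
Proof.
move=> A mA tA mUA; have := @measure_semi_sigma_additive _ _ _ m; apply => //.
  by move=> n; apply: trace_measurable; exact: mA.
exact: trace_measurable.
Qed.

HB.instance Definition _ := isMeasure.Build _ Z R mu mu0 mu_ge0 mu_sigma_additive.

Let mu_fin : fin_num_fun mu.
Proof.
move=> A mA; rewrite ge0_fin_numE//.
apply: le_lt_trans moo; apply: le_measure => //; rewrite inE//; exact: trace_measurable.
Qed.

HB.instance Definition _ := @Measure_isFinite.Build _ Z R mu mu_fin.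

Lemma ge0_integral_trace (f : Z -> \bar R) : measurable_fun setT f ->
  (forall z, 0 <= f z)%E -> (\int[mu]_z f z = \int[m]_z f z)%E.
Proof.
move=> mf f0.
have mid : measurable_fun setT (id : T -> Z).
  by move=> _ A mA; rewrite setTI; exact: trace_measurable.
rewrite (eq_measure_integral (pushforward m (id : T -> Z)))//.
by rewrite (ge0_integral_pushforward mid).
Qed.

Lemma ae_trace (Q : set T) : {ae mu, forall z, Q z} -> {ae m, forall z, Q z}.
Proof.
by move=> [A [mA A0 QA]]; exists A; split => //; exact: trace_measurable.
Qed.

End trace_measure.

Section mixed_norm.
Context {R : realType} {d1 d2 : measure_display}.
Context {T1 : measurableType d1} {T2 : measurableType d2}.
Variables (m : {finite_measure set T1 -> \bar R}) (P : probability T2 R).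
Local Open Scope ereal_scope.
Implicit Types (h k : T1 * T2 -> R) (r s : R).
Local Notation joint k := (measurable_fun [set: T1 * T2] (k : T1 * T2 -> R)).
Local Notation mf a := (measurable_fun setT a).

Definition slice_norm s k (t : T1) : \bar R := Lnorm P s%:E (fun w => (k (t, w))%:E).

(** The norm of [L^r (m; L^s (P))]. *)
Definition mixed_norm r s k : \bar R := 'N[m]_r%:E[slice_norm s k].

Lemma measurable_slice k t : joint k -> mf (fun w => (k (t, w))%:E).
Proof. by move=> mk; apply/measurable_EFinP; exact: (measurableT_comp mk). Qed.

Lemma slice_norm_ge0 s k t : 0 <= slice_norm s k t.
Proof. exact: Lnorm_ge0. Qed.

Lemma slice_normE s k t : (forall z, 0 <= k z)%R ->
  slice_norm s k t = (\int[P]_w (k (t, w))%:E `^ s) `^ s^-1.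
Proof. by move=> k0; apply: LnormE => w; rewrite lee_fin. Qed.

Lemma measurable_joint_poweR s k : joint k -> mf (fun z => (k z)%:E `^ s).
Proof. by move=> mk; apply: measurable_poweR_comp; exact/measurable_EFinP. Qed.

Lemma measurable_slice_norm s k : joint k -> (forall z, 0 <= k z)%R ->
  mf (slice_norm s k).
Proof.
move=> mk k0.
rewrite (_ : slice_norm s k = (fun t => (\int[P]_w (k (t, w))%:E `^ s) `^ s^-1)).
  apply: measurable_poweR_comp.
  apply: (@measurable_fun_fubini_tonelli_F _ _ _ _ _ P (fun z => (k z)%:E `^ s)).
    exact: measurable_joint_poweR.
  by move=> z; exact: poweR_ge0.
by apply/funext => t; exact: slice_normE.
Qed.

Lemma integral_slice k : joint k -> (forall z, 0 <= k z)%R ->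
  \int[m \x P]_z (k z)%:E = \int[m]_t \int[P]_w (k (t, w))%:E.
Proof.
move=> mk k0; have mEk : mf (fun z => (k z)%:E) by exact/measurable_EFinP.
have k0E z : 0 <= (k z)%:E by rewrite lee_fin.
exact: (@fubini_tonelli1 _ _ _ _ _ m P _ mEk k0E).
Qed.

Lemma slice_norm_le s h k t : (0 < s)%R -> joint h -> joint k ->
  (forall z, 0 <= h z <= k z)%R -> slice_norm s h t <= slice_norm s k t.
Proof.
move=> s0 mh mk hk; apply: Lnorm_le => //; try exact: measurable_slice.
  by move=> w; rewrite lee_fin; have /andP[] := hk (t, w).
by apply: aeW => w; rewrite lee_fin; have /andP[] := hk (t, w).
Qed.

Lemma mixed_norm_le r s h k : (0 < r)%R -> (0 < s)%R -> joint h -> joint k ->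
  (forall z, 0 <= h z <= k z)%R -> mixed_norm r s h <= mixed_norm r s k.
Proof.
move=> r0 s0 mh mk hk.
have h0 z : (0 <= h z)%R by have /andP[] := hk z.
have k0 z : (0 <= k z)%R by have /andP[h1 /(le_trans h1)] := hk z.
apply: Lnorm_le => //; try exact: measurable_slice_norm.
  by move=> t; exact: slice_norm_ge0.
by apply: aeW => t; exact: slice_norm_le.
Qed.

Lemma mixed_normZ r s c k : (0 < r)%R -> (0 < s)%R -> (0 <= c)%R -> joint k ->
  (forall z, 0 <= k z)%R ->
  mixed_norm r s (fun z => (c * k z)%R) = c%:E * mixed_norm r s k.
Proof.
move=> r0 s0 c0 mk k0; rewrite /mixed_norm.
rewrite (_ : slice_norm s _ = (fun t => c%:E * slice_norm s k t)).
  rewrite LnormZ_ge0//; first exact: measurable_slice_norm.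
  by move=> t; exact: slice_norm_ge0.
apply/funext => t; rewrite /slice_norm -LnormZ_ge0//; last by move=> w; rewrite lee_fin.
exact: measurable_slice.
Qed.

Lemma mixed_normD r s h k : (1 <= r)%R -> (1 <= s)%R -> joint h -> joint k ->
  (forall z, 0 <= h z)%R -> (forall z, 0 <= k z)%R ->
  mixed_norm r s (fun z => (h z + k z)%R) <= mixed_norm r s h + mixed_norm r s k.
Proof.
move=> r1 s1 mh mk h0 k0; have r0 := lt_le_trans ltr01 r1.
have mhk : joint (h \+ k)%R by exact: measurable_funD.
have mnh := measurable_slice_norm s mh h0; have mnk := measurable_slice_norm s mk k0.
apply: le_trans (LnormD_ge0 m r1 mnh mnk (slice_norm_ge0 _ _) (slice_norm_ge0 _ _)).
apply: Lnorm_le => //.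
- by apply: measurable_slice_norm => // z; exact: addr_ge0.
- exact: emeasurable_funD.
- by move=> t; exact: slice_norm_ge0.
apply: aeW => t; have := LnormD_ge0 P s1 (measurable_slice t mh) (measurable_slice t mk).
by apply => w; rewrite lee_fin.
Qed.

(** By Fubini almost every section vanishes almost everywhere. *)
Lemma mixed_norm_ae0 r s k : (0 < r)%R -> (0 < s)%R -> joint k ->
  (forall z, 0 <= k z)%R -> {ae m \x P, forall z, k z = 0%R} -> mixed_norm r s k = 0.
Proof.
move=> r0 s0 mk k0 kae; have mks := measurable_joint_poweR s mk.
have : \int[m]_t \int[P]_w (k (t, w))%:E `^ s = 0.
  rewrite -(@fubini_tonelli1 _ _ _ _ _ m P (fun z => (k z)%:E `^ s))//; last first.
    by move=> z; exact: poweR_ge0.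
  rewrite (ae_eq_integral (cst 0))//; first exact: integral0.
  by apply: filterS kae => z -> _; rewrite poweR0r// gt_eqF.
have mI : mf (fun t => \int[P]_w (k (t, w))%:E `^ s).
  apply: (@measurable_fun_fubini_tonelli_F _ _ _ _ _ P (fun z => (k z)%:E `^ s)) => //.
  by move=> z; exact: poweR_ge0.
have I0 t : 0 <= \int[P]_w (k (t, w))%:E `^ s.
  by apply: integral_ge0 => w _; exact: poweR_ge0.
move=> i0.
have : {ae m, forall t, slice_norm s k t = 0}.
  have : \int[m]_t `|\int[P]_w (k (t, w))%:E `^ s| = 0.
    by under eq_integral do rewrite gee0_abs//; exact: i0.
  move/(ae_eq_integral_abs m measurableT mI) => aez.
  apply: filterS aez => t /(_ Logic.I) tz.
  by rewrite slice_normE// tz poweR0r// invr_neq0// gt_eqF.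
move=> ae0; rewrite /mixed_norm (Lnorm_ae r0 (b := cst 0))//.
- by rewrite Lnorm0// eqe gt_eqF.
- exact: measurable_slice_norm.
- by move=> t; exact: slice_norm_ge0.
Qed.

Lemma slice_norm_bounded s k (M : R) t : (0 < s)%R -> joint k ->
  (forall z, 0 <= k z <= M)%R -> slice_norm s k t <= M%:E.
Proof.
move=> s0 mk kM; have M0 : (0 <= M)%R by have /andP[h /(le_trans h)] := kM point.
have : slice_norm s k t <= Lnorm P s%:E (fun w => M%:E * cst 1 w).
  apply: Lnorm_le => //; first exact: measurable_slice.
    by move=> w; rewrite lee_fin; have /andP[] := kM (t, w).
  by apply: aeW => w; rewrite mule1 lee_fin; have /andP[] := kM (t, w).
rewrite LnormZ_ge0//.
rewrite Lnorm_cst1; have -> : P setT `^ s^-1 = 1 by rewrite probability_setT poweR1r.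
by rewrite mule1.
Qed.

Lemma mixed_norm_bounded r s k (M : R) : (0 < r)%R -> (0 < s)%R -> joint k ->
  (forall z, 0 <= k z <= M)%R -> mixed_norm r s k < +oo.
Proof.
move=> r0 s0 mk kM; have k0 z : (0 <= k z)%R by have /andP[] := kM z.
apply: (@Lnorm_bounded _ _ _ _ _ _ M) => //; first exact: measurable_slice_norm.
by move=> t; rewrite slice_norm_ge0/=; exact: slice_norm_bounded.
Qed.

Lemma mixed_norm_cvg0 r s (k_ : nat -> T1 * T2 -> R) k : (0 < r)%R -> (0 < s)%R ->
  (forall n, joint (k_ n)) -> joint k -> (forall n z, 0 <= k_ n z <= k z)%R ->
  mixed_norm r s k < +oo -> (forall z, k_ n z @[n --> \oo] --> 0%R) ->
  mixed_norm r s (k_ n) @[n --> \oo] --> 0.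
Proof.
move=> r0 s0 mk_ mk kk koo cvk.
have k_0 n z : (0 <= k_ n z)%R by have /andP[] := kk n z.
have k0 z : (0 <= k z)%R by have /andP[h /(le_trans h)] := kk 0%N z.
apply: (@Lnorm_cvg0 _ _ _ _ _ _ (slice_norm s k)) => //.
- by move=> n; exact: measurable_slice_norm.
- exact: measurable_slice_norm.
- by move=> n t; exact: slice_norm_ge0.
- by apply: aeW => t n; exact: slice_norm_le.
have aefin := Lnorm_lty_ae r0 (measurable_slice_norm s mk k0) (slice_norm_ge0 s k) koo.
apply: filterS aefin => t tfin.
apply: (@Lnorm_cvg0 _ _ _ _ _ _ (fun w => (k (t, w))%:E)) => //.
- by move=> n; exact: measurable_slice.
- exact: measurable_slice.
- by move=> n w; rewrite lee_fin.
- by apply: aeW => w n; rewrite lee_fin; have /andP[] := kk n (t, w).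
- by rewrite ltey_eq tfin.
- by apply: aeW => w; apply/fine_cvgP; split; [exact: nearW|exact: cvk].
Qed.

End mixed_norm.

Section mixed_norm_duality.
Context {R : realType} {d1 d2 : measure_display}.
Context {T1 : measurableType d1} {T2 : measurableType d2}.
Variables (m : {finite_measure set T1 -> \bar R}) (P : probability T2 R).
Local Open Scope ereal_scope.
Implicit Types (h k : T1 * T2 -> R) (r s : R).
Local Notation joint k := (measurable_fun [set: T1 * T2] (k : T1 * T2 -> R)).
Local Notation mf a := (measurable_fun setT a).
Local Notation rho := (mixed_norm m P).
Local Notation sl := (slice_norm P).

Lemma mixed_norm_l1 r s : (1 < r)%R -> (1 < s)%R ->
  exists2 c : R, (0 < c)%R & forall k, joint k -> (forall z, 0 <= k z)%R ->
    \int[m \x P]_z (k z)%:E <= c%:E * rho r s k.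
Proof.
move=> r1 s1.
pose c1 := (fine ('N[P]_(s / (s - 1))%:E[cst 1%E]) + 1)%R.
pose c2 := (fine ('N[m]_(r / (r - 1))%:E[cst 1%E]) + 1)%R.
have c10 : (0 < c1)%R by rewrite ltr_wpDl// fine_ge0// Lnorm_ge0.
have c20 : (0 < c2)%R by rewrite ltr_wpDl// fine_ge0// Lnorm_ge0.
exists (c1 * c2)%R; first exact: mulr_gt0.
move=> k mk k0; rewrite integral_slice//.
have mn := measurable_slice_norm P s mk k0.
apply: (@le_trans _ _ (\int[m]_t (c1%:E * sl s k t))).
  apply: ge0_le_integral => //.
  - by move=> t _; apply: integral_ge0 => w _; rewrite lee_fin.
  - apply: (@measurable_fun_fubini_tonelli_F _ _ _ _ _ P (fun z => (k z)%:E)).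
      exact/measurable_EFinP.
    by move=> z; rewrite lee_fin.
  - exact: measurable_funeM.
  move=> t _; apply: integral_le_Lnorm => //; first exact: measurable_slice.
  by move=> w; rewrite lee_fin.
have h := integral_le_Lnorm m r1 mn (slice_norm_ge0 P s k).
rewrite ge0_integralZl_EFin ?(ltW c10)//; last by move=> t _; exact: slice_norm_ge0.
by rewrite EFinM -muleA; apply: lee_wpmul2l h; rewrite lee_fin ltW.
Qed.

Lemma slice_norm_poweR p s k t : (0 < p)%R -> (0 < s)%R -> (forall z, 0 <= k z)%R ->
  sl s k t = sl (s / p)%R (fun z => k z `^ p)%R t `^ p^-1.
Proof.
move=> p0 s0 k0; rewrite /slice_norm (Lnorm_poweR _ p0 s0); last first.
  by move=> w; rewrite lee_fin.
by congr (_ `^ _); congr Lnorm; apply/funext => w; rewrite poweR_EFin.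
Qed.

Lemma mixed_norm_poweR p r s k : (0 < p)%R -> (0 < r)%R -> (0 < s)%R ->
  (forall z, 0 <= k z)%R ->
  rho r s k = rho (r / p)%R (s / p)%R (fun z => k z `^ p)%R `^ p^-1.
Proof.
move=> p0 r0 s0 k0; rewrite /mixed_norm (Lnorm_poweR _ p0 r0); last first.
  by move=> t; exact: slice_norm_ge0.
congr (_ `^ _); congr Lnorm; apply/funext => t.
by rewrite (slice_norm_poweR _ p0 s0 k0) poweRVK ?gt_eqF// slice_norm_ge0.
Qed.

(** With [p] the smaller exponent, the [p]-th power of the norm of a sum of disjoint
    functions is at most the sum of the [p]-th powers, by the triangle inequality for
    the exponents [r / p] and [s / p]. *)
Lemma mixed_norm_disjoint r s : (1 < r)%R -> (1 < s)%R ->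
  exists2 kappa : R, (1 <= kappa < 2)%R & forall h k, joint h -> joint k ->
    (forall z, 0 <= h z)%R -> (forall z, 0 <= k z)%R -> (forall z, h z * k z = 0)%R ->
    rho r s h <= 1 -> rho r s k <= 1 -> rho r s (fun z => h z + k z)%R <= kappa%:E.
Proof.
move=> r1 s1; pose p := Num.min r s.
have p1 : (1 < p)%R by rewrite lt_min r1.
have p0 : (0 < p)%R by exact: lt_trans p1.
have [r0 s0] : (0 < r)%R /\ (0 < s)%R by split; exact: lt_trans ltr01 _.
have rp : (1 <= r / p)%R by rewrite ler_pdivlMr// mul1r ge_min lexx.
have sp : (1 <= s / p)%R by rewrite ler_pdivlMr// mul1r ge_min lexx orbT.
exists (2 `^ p^-1)%R.
  have ip1 : (p^-1 < 1)%R by rewrite invf_lt1.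
  have ip0 : (0 < p^-1)%R by rewrite invr_gt0.
  apply/andP; split; first by rewrite -[leLHS](powRr0 2) ler_powR ?ler1n// ltW.
  rewrite lt_neqAle -{4}[2%R]powRr1// ler_powR ?ler1n ?ltW// andbT.
  apply/eqP => y2; have : (2 `^ (p^-1 - 1) == 1 :> R)%R.
    by rewrite powRB ?y2 ?powRr1 ?divff// pnatr_eq0 implybT.
  by rewrite powR_eq1 subr_eq0 (lt_eqF ip1) orbF => /orP[/eqP|]; lra.
move=> h k mh mk h0 k0 hk h1 k1.
have powm g : joint g -> joint (fun z => g z `^ p)%R.
  by move=> mg; exact: (measurableT_comp (measurable_powR p)).
have powle g : (forall z, 0 <= g z)%R -> rho r s g <= 1 ->
    rho (r / p)%R (s / p)%R (fun z => g z `^ p)%R <= 1.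
  move=> g0; rewrite (mixed_norm_poweR p0 r0 s0 g0) => /(ler_poweR (ltW p0) (poweR_ge0 _ _)).
  by rewrite poweRVK ?gt_eqF ?poweR1r// Lnorm_ge0.
rewrite (mixed_norm_poweR p0 r0 s0); last by move=> z; exact: addr_ge0.
rewrite -poweR_EFin; apply: ler_poweR; [by rewrite invr_ge0 ltW|exact: Lnorm_ge0|].
rewrite (_ : (fun z => _) = (fun z => h z `^ p + k z `^ p)%R).
  apply: le_trans (mixed_normD m P rp sp (powm _ mh) (powm _ mk) _ _) _.
  - by move=> z; exact: powR_ge0.
  - by move=> z; exact: powR_ge0.
  by rewrite -[2%R]/(1 + 1)%R EFinD leeD// powle.
apply/funext => z; have /eqP := hk z; rewrite mulf_eq0 => /orP[] /eqP ->.
  by rewrite add0r powR0 ?gt_eqF// add0r.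
by rewrite addr0 powR0 ?gt_eqF// addr0.
Qed.

(** Hoelder's inequality in each variable. *)
Lemma mixed_norm_hoelder r s r' s' h k : (0 < r)%R -> (0 < s)%R -> (0 < r')%R -> (0 < s')%R ->
  (r^-1 + r'^-1 = 1)%R -> (s^-1 + s'^-1 = 1)%R -> joint h -> joint k ->
  (forall z, 0 <= h z)%R -> (forall z, 0 <= k z)%R ->
  rho r' s' h < +oo -> rho r s k < +oo ->
  \int[m \x P]_z (h z * k z)%:E <= rho r' s' h * rho r s k.
Proof.
move=> r0 s0 r'0 s'0 rr ss mh mk h0 k0 hoo koo.
have mnh := measurable_slice_norm P s' mh h0; have mnk := measurable_slice_norm P s mk k0.
have mhk : joint (fun z => h z * k z)%R by exact: measurable_funM.
have hk0 z : (0 <= h z * k z)%R by exact: mulr_ge0.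
rewrite integral_slice//.
apply: le_trans (hoelder_ge0 r'0 r0 _ mnh mnk (slice_norm_ge0 _ _ _) (slice_norm_ge0 _ _ _) hoo koo).
  2: by rewrite addrC.
apply: ae_ge0_le_integral => //.
- by move=> t _; apply: integral_ge0 => w _; rewrite lee_fin.
- apply: (@measurable_fun_fubini_tonelli_F _ _ _ _ _ P (fun z => (h z * k z)%:E)).
    exact/measurable_EFinP.
  by move=> z; rewrite lee_fin.
- by move=> t _; rewrite mule_ge0 ?slice_norm_ge0.
- exact: emeasurable_funM.
have aeh := Lnorm_lty_ae r'0 mnh (slice_norm_ge0 P s' h) hoo.
have aek := Lnorm_lty_ae r0 mnk (slice_norm_ge0 P s k) koo.
apply: filterS2 aeh aek => t fh fk _.
under eq_integral do rewrite EFinM.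
apply: hoelder_ge0 => //; rewrite ?ltey_eq ?fh ?fk//; try exact: measurable_slice.
- by rewrite addrC.
- by move=> w; rewrite lee_fin.
- by move=> w; rewrite lee_fin.
Qed.

(** Monotone convergence in each variable; [b] is the limit of the slice norms. *)
Lemma mixed_norm_sup_le r s (k_ : nat -> T1 * T2 -> R) k (C : \bar R) :
  (0 < r)%R -> (0 < s)%R -> (forall n, joint (k_ n)) -> joint k ->
  (forall n z, 0 <= k_ n z)%R -> (forall z, 0 <= k z)%R ->
  (forall z i n, (i <= n)%N -> k_ i z <= k_ n z)%R ->
  (forall z c, (forall n, k_ n z <= c) -> k z <= c)%R ->
  (forall n, rho r s (k_ n) <= C) -> rho r s k <= C.
Proof.
move=> r0 s0 mk_ mk k_0 k0 nd ksup kC.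
pose b t := ereal_sup (range (fun n => sl s (k_ n) t)).
have b_n n t : sl s (k_ n) t <= b t by apply: ereal_sup_ubound; exists n.
have b0 t : 0 <= b t by exact: le_trans (slice_norm_ge0 _ _ _ _) (b_n 0%N t).
have ndn t i n : (i <= n)%N -> sl s (k_ i) t <= sl s (k_ n) t.
  by move=> ij; apply: slice_norm_le => // z; rewrite k_0 nd.
have mb : mf b.
  apply: (emeasurable_fun_cvg (fun n => sl s (k_ n))) => [n|t _].
    exact: measurable_slice_norm.
  by apply: ereal_nondecreasing_cvgn => i n; exact: ndn.
apply: (@le_trans _ _ ('N[m]_r%:E[b])).
  apply: Lnorm_le => //; first exact: measurable_slice_norm.
    by move=> t; exact: slice_norm_ge0.
  apply: aeW => t; apply: (Lnorm_sup_le (a_ := fun n w => (k_ n (t, w))%:E)) => //.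
  - by move=> n; exact: measurable_slice.
  - by move=> n w; rewrite lee_fin.
  - by move=> w i n ij; rewrite lee_fin nd.
  - move=> w [c| |] kc.
    + by rewrite lee_fin; apply: ksup => n; rewrite -lee_fin.
    + by rewrite leey.
    + by have := kc 0%N; rewrite leeNy_eq.
  - by move=> w; rewrite lee_fin.
  - exact: measurable_slice.
  - by move=> n; exact: b_n.
apply: (Lnorm_sup_le (a_ := fun n => sl s (k_ n))) => //.
- by move=> n; exact: measurable_slice_norm.
- by move=> n t; exact: slice_norm_ge0.
- by move=> t c kc; apply: ub_ereal_sup => _ [n _ <-].
Qed.

End mixed_norm_duality.

Section mixed_norm_trace.
Context {R : realType} {d1 d2 : measure_display}.
Context {T1 : measurableType d1} {T2 : measurableType d2}.
Variables (m : {finite_measure set T1 -> \bar R}) (P : probability T2 R).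
Variable S : set_system (T1 * T2).
Hypotheses (hS : S `<=` measurable) (moo : ((m \x P) setT < +oo)%E).
Hypothesis hcyl : forall A : set T1, measurable A -> S (A `*` setT).
Local Open Scope ereal_scope.
Local Notation Z := (g_sigma_algebraType S).
Local Notation mu := (trace_measure hS moo : {finite_measure set Z -> \bar R}).
Local Notation mf k := (measurable_fun [set: Z] (k : Z -> R)).
Local Notation joint k := (measurable_fun [set: T1 * T2] (k : T1 * T2 -> R)).
Local Notation rho := (mixed_norm m P).
Local Notation sl := (slice_norm P).
Implicit Types (h k : T1 * T2 -> R) (r s : R).

Lemma measurable_cylinder (b : T1 -> R) : measurable_fun setT b ->
  mf (fun z => b z.1).
Proof.
move=> mb _ B mB; rewrite setTI; apply: sub_sigma_algebra.
rewrite (_ : _ @^-1` B = (b @^-1` B) `*` setT).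
  by apply: hcyl; rewrite -[X in measurable X]setTI; exact: mb.
by apply/seteqP; split => [z|z []] /=.
Qed.

Let joint_mf k : mf k -> joint k. Proof. exact: trace_measurable_fun. Qed.

Section dual.
Variables (r s : R) (k : T1 * T2 -> R) (C : R).
Hypotheses (r1 : (1 < r)%R) (s1 : (1 < s)%R) (mk : mf k) (k0 : forall z, (0 <= k z)%R).
Hypothesis C0 : (0 <= C)%R.
Hypothesis kC : forall h M, mf h -> (forall z, 0 <= h z <= M)%R ->
  \int[mu]_z (h z * k z)%:E <= ereal_sup [set \int[mu]_z (h z * k' z)%:E |
    k' in [set k' | [/\ mf k', forall z, (0 <= k' z)%R & rho r s k' <= C%:E]]].

Let r0 : (0 < r)%R. Proof. exact: lt_trans r1. Qed.
Let s0 : (0 < s)%R. Proof. exact: lt_trans s1. Qed.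
Let rB1 : (0 < r - 1)%R. Proof. by rewrite subr_gt0. Qed.
Let sB1 : (0 < s - 1)%R. Proof. by rewrite subr_gt0. Qed.

(** The test function is the extremal one in Hoelder's inequality, [a (t) ^ (r - s) *
    phi ^ (s - 1)] with [a] the slice norm of [phi]; it is bounded as [a] is bounded
    away from 0 where it does not vanish. *)
Lemma mixed_norm_dual_bounded (phi : T1 * T2 -> R) (M delta : R) : mf phi ->
  (forall z, 0 <= phi z <= M)%R -> (forall z, phi z <= k z)%R -> (0 < delta)%R ->
  (forall t, sl s phi t = 0 \/ delta%:E <= sl s phi t) -> rho r s phi <= C%:E.
Proof.
move=> mphi phiM phik d0 phid.
have mj := joint_mf mphi.
have phi0 z : (0 <= phi z)%R by have /andP[] := phiM z.
have M0 : (0 <= M)%R by have /andP[h /(le_trans h)] := phiM point.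
have rs0 : (r - s + s != 0)%R by rewrite subrK gt_eqF.
pose a t := fine (sl s phi t).
have slE t : sl s phi t = (a t)%:E.
  rewrite fineK// ge0_fin_numE ?slice_norm_ge0//.
  by apply: le_lt_trans (slice_norm_bounded P t s0 mj phiM) _; rewrite ltey.
have a0 t : (0 <= a t)%R by rewrite fine_ge0// slice_norm_ge0.
have aM t : (a t <= M)%R.
  by rewrite -lee_fin -slE; exact: (slice_norm_bounded P t s0 mj phiM).
have ma : measurable_fun setT a.
  by apply: measurableT_comp => //; exact: measurable_slice_norm.
pose b t := (a t `^ (r - s))%R.
have b0 t : (0 <= b t)%R by exact: powR_ge0.
have mb : measurable_fun setT b by exact: (measurableT_comp (measurable_powR _) ma).
pose K := (1 + delta `^ (r - s) + M `^ (r - s))%R.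
have bK t : (b t <= K)%R.
  have p1 := powR_ge0 delta (r - s); have p2 := powR_ge0 M (r - s).
  have [/eqP at0|at0] := boolP (a t == 0%R).
    rewrite /b at0 /K; have : (0 `^ (r - s) <= 1 :> R)%R.
      have [->|n0] := eqVneq (r - s)%R 0%R; first by rewrite powRr0.
      by rewrite powR0// ler01.
    move: p1 p2; lra.
  have da : (delta <= a t)%R.
    have := phid t; rewrite slE lee_fin => -[/eqP|//].
    by rewrite eqe (negbTE at0).
  have [rs|/ltW rs] := leP 0%R (r - s)%R.
    have : (b t <= M `^ (r - s))%R by apply: ge0_ler_powR; rewrite ?nnegrE.
    rewrite /K; move: p1 p2; lra.
  have : (b t <= delta `^ (r - s))%R.
    rewrite /b -(opprK (r - s)%R) !(powRN _ (- (r - s)%R)).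
    rewrite lef_pV2 ?posrE ?powR_gt0//; last exact: lt_le_trans da.
    by apply: ge0_ler_powR; rewrite ?nnegrE ?oppr_ge0// ltW.
  rewrite /K; move: p1 p2; lra.
pose h z := (b z.1 * phi z `^ (s - 1))%R.
have mp : mf (fun z => phi z `^ (s - 1))%R.
  exact: (measurableT_comp (measurable_powR _) mphi).
have mh : mf h by apply: measurable_funM => //; exact: measurable_cylinder.
have p0 z : (0 <= phi z `^ (s - 1))%R by exact: powR_ge0.
have h0 z : (0 <= h z)%R by exact: mulr_ge0.
have hM z : (0 <= h z <= K * M `^ (s - 1))%R.
  rewrite h0 ler_pM//; have /andP[_ ?] := phiM z.
  by apply: ge0_ler_powR; rewrite ?nnegrE// ltW.
have mjh := joint_mf mh.
have slh t : sl (s / (s - 1))%R h t = (a t)%:E `^ (r - 1).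
  rewrite [LHS](_ : _ = (b t)%:E * sl (s / (s - 1))%R (fun z => phi z `^ (s - 1))%R t).
    have -> : sl (s / (s - 1))%R (fun z => phi z `^ (s - 1))%R t = (a t)%:E `^ (s - 1).
      rewrite -slE (slice_norm_poweR _ _ sB1 s0 phi0) poweRVK ?gt_eqF//.
      exact: slice_norm_ge0.
    have rsE : (r - s + (s - 1) = r - 1)%R by rewrite addrA subrK.
    by rewrite !poweR_EFin -EFinM /b -powRD rsE// (gt_eqF rB1).
  rewrite /slice_norm -LnormZ_ge0//.
  - by rewrite divr_gt0.
  - exact: measurable_slice (joint_mf mp).
  - by move=> w; rewrite lee_fin.
have rhoh : rho (r / (r - 1))%R (s / (s - 1))%R h = rho r s phi `^ (r - 1).
  rewrite /mixed_norm (Lnorm_poweR m rB1 r0 (slice_norm_ge0 P s phi)).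
  rewrite poweRVK ?gt_eqF ?Lnorm_ge0//; congr Lnorm.
  by apply/funext => t; rewrite slh slE.
have rhofin : rho r s phi \is a fin_num.
  by rewrite ge0_fin_numE ?Lnorm_ge0// (mixed_norm_bounded m P r0 s0 mj phiM).
have int_h : \int[mu]_z (h z * phi z)%:E = rho r s phi `^ r.
  have mhphi : mf (fun z => h z * phi z)%R by exact: measurable_funM.
  have hphi0 z : (0 <= h z * phi z)%R by exact: mulr_ge0.
  rewrite ge0_integral_trace//; last exact/measurable_EFinP.
  rewrite integral_slice//; last exact: joint_mf.
  rewrite /mixed_norm poweR_Lnorm ?gt_eqF//; apply: eq_integral => t _.
  rewrite gee0_abs ?slice_norm_ge0// slE.
  have -> : (a t)%:E `^ r = (b t)%:E * (a t)%:E `^ s.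
    by rewrite !poweR_EFin -EFinM /b -powRD subrK // (gt_eqF r0).
  rewrite -slE /slice_norm poweR_Lnorm ?gt_eqF//.
  rewrite -ge0_integralZl_EFin//.
  - apply: eq_integral => w _; rewrite gee0_abs ?lee_fin// poweR_EFin -EFinM /h/=.
    by rewrite -mulrA [X in (_ * X)%R]mulrC mulr_powRB1.
  - by move=> w _; exact: poweR_ge0.
  - by apply: measurable_poweR_comp; apply: measurableT_comp => //; exact: measurable_slice.
have ineq : rho r s phi `^ r <= C%:E * rho r s phi `^ (r - 1).
  rewrite -int_h; apply: (@le_trans _ _ (\int[mu]_z (h z * k z)%:E)).
    apply: ge0_le_integral => //.
    - by move=> z _; rewrite lee_fin mulr_ge0.
    - by apply/measurable_EFinP; exact: measurable_funM.
    - by apply/measurable_EFinP; exact: measurable_funM.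
    - by move=> z _; rewrite lee_fin ler_wpM2l.
  apply: le_trans (kC mh hM) _; apply: ub_ereal_sup => _ [k' [mk' k'0 k'C] <-].
  have mhk' : mf (fun z => h z * k' z)%R by exact: measurable_funM.
  rewrite ge0_integral_trace; [|exact/measurable_EFinP|by move=> z; rewrite lee_fin mulr_ge0].
  apply: le_trans (@mixed_norm_hoelder _ _ _ _ _ m P r s (r / (r - 1))%R (s / (s - 1))%R h k'
    r0 s0 _ _ _ _ mjh (joint_mf mk') h0 k'0 _ _) _.
  - by rewrite divr_gt0.
  - by rewrite divr_gt0.
  - by rewrite invf_div; field; rewrite gt_eqF.
  - by rewrite invf_div; field; rewrite gt_eqF.
  - by rewrite rhoh ltey_eq fin_num_poweR.
  - by rewrite (le_lt_trans k'C) ?ltey.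
  by rewrite rhoh muleC lee_wpmul2r// poweR_ge0.
move: ineq; rewrite -(fineK rhofin) !poweR_EFin -EFinM !lee_fin.
have := fine_ge0 (Lnorm_ge0 m r%:E (sl s phi)); rewrite -/(rho r s phi).
set x := fine _; rewrite le_eqVlt => /predU1P[<- //|x0].
by rewrite -(mulr_powRB1 (ltW x0) r0) ler_pM2r// powR_gt0.
Qed.

(** The truncations [psi i] of [phi n] to the times where its slice norm is at least [1
    / (i + 1)] satisfy the assumptions of [mixed_norm_dual_bounded]; then [i] and [n]
    tend to infinity. *)
Lemma mixed_norm_dual : rho r s k <= C%:E.
Proof.
pose phi n z := Num.min (k z) n%:R%R.
have mphi n : mf (phi n) by apply: measurable_minr => //; exact: measurable_cst.
have phi0 n z : (0 <= phi n z)%R by rewrite le_min k0 ler0n.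
have phin n z : (phi n z <= n%:R)%R by rewrite ge_min lexx orbT.
have phik n z : (phi n z <= k z)%R by rewrite ge_min lexx.
apply: (@mixed_norm_sup_le _ _ _ _ _ m P r s phi) => //.
- by move=> n; exact: joint_mf.
- exact: joint_mf.
- by move=> z i n ij; rewrite [leRHS]/phi le_min phik/= (le_trans (phin i z))// ler_nat.
- move=> z c kc; have := kc (Num.trunc (k z)).+1.
  by rewrite /phi min_l// ltW// truncnS_gt.
move=> n; pose a := sl s (phi n).
have ma : measurable_fun setT a by apply: measurable_slice_norm => //; exact: joint_mf.
pose B i := [set t | (i.+1%:R^-1)%:E <= a t].
have mB i : measurable (B i).
  by rewrite -[B i]setTI; exact: (emeasurable_fun_c_infty measurableT).
pose psi i z := (\1_(B i) z.1 * phi n z)%R.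
have slpsi i t : sl s (psi i) t = (\1_(B i) t)%:E * a t.
  rewrite /slice_norm /a -LnormZ_ge0//.
    exact: (measurable_slice _ (joint_mf (mphi n))).
  by move=> w; rewrite lee_fin.
have psi0 i z : (0 <= psi i z)%R by rewrite mulr_ge0.
have psiphi i z : (psi i z <= phi n z)%R by rewrite ler_piMl// indicE; case: (_ \in _).
have mpsi i : mf (psi i).
  by apply: measurable_funM => //; apply: measurable_cylinder; exact: measurable_indic.
have psiC i : rho r s (psi i) <= C%:E.
  apply: (@mixed_norm_dual_bounded (psi i) n%:R i.+1%:R^-1) => // [z|z|t].
  - by rewrite psi0 (le_trans (psiphi i z)).
  - exact: le_trans (psiphi i z) (phik n z).
  rewrite slpsi indicE; case: (boolP (t \in B i)) => [|_]; last by left; rewrite mul0e.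
  by rewrite inE => Bt; right; rewrite mul1e.
rewrite /mixed_norm; apply: (@Lnorm_sup_le _ _ _ m r (fun i => sl s (psi i))) => //.
- by move=> i; apply: measurable_slice_norm => //; exact: joint_mf.
- by move=> i t; exact: slice_norm_ge0.
- move=> t i j ij; rewrite !slpsi lee_wpmul2r ?slice_norm_ge0// lee_fin !indicE.
  case: (boolP (t \in B i)) => [|_]; last exact: ler0n.
  rewrite inE => Bt; rewrite mem_set//; apply: le_trans Bt.
  by rewrite lee_fin lef_pV2 ?posrE// ler_nat.
- move=> t c ac; have := slice_norm_ge0 P s (phi n) t; rewrite -/(a t).
  rewrite le_eqVlt => /predU1P[at0|at0].
    by have := ac 0%N; rewrite slpsi -at0 mule0.
  have [i ia] : exists i : nat, B i t.
    have afin : a t \is a fin_num.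
      rewrite ge0_fin_numE ?slice_norm_ge0//.
      apply: le_lt_trans (@slice_norm_bounded _ _ _ _ _ P s (phi n) n%:R t s0 _ _) (ltey _).
        exact: joint_mf.
      by move=> z; rewrite phi0 phin.
    have fa : (0 < fine (a t))%R by rewrite fine_gt0// at0 ltey_eq afin.
    exists (Num.trunc (fine (a t))^-1); rewrite /B/= -(fineK afin) lee_fin.
    by rewrite invf_ple ?posrE// ltW// truncnS_gt.
  by have := ac i; rewrite slpsi indicE mem_set// mul1e.
- by move=> t; exact: slice_norm_ge0.
Qed.

End dual.

Lemma mixed_function_norm r s : (1 <= r)%R -> (1 <= s)%R -> function_norm mu (rho r s).
Proof.
move=> r1 s1; have r0 := lt_le_trans ltr01 r1; have s0 := lt_le_trans ltr01 s1.
split.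
- by move=> k; exact: Lnorm_ge0.
- by move=> h k mh mk hk; apply: mixed_norm_le => //; exact: joint_mf.
- by move=> c k c0 mk k0; apply: mixed_normZ => //; exact: joint_mf.
- by move=> h k mh mk h0 k0; apply: mixed_normD => //; exact: joint_mf.
- move=> k mk k0 kae; apply: mixed_norm_ae0 => //; first exact: joint_mf.
  exact: ae_trace kae.
- apply: (@mixed_norm_bounded _ _ _ _ _ _ _ _ _ _ 1%R) => // z.
  by rewrite ler01 lexx.
- move=> k_ k mk_ mk kk koo ck; apply: (@mixed_norm_cvg0 _ _ _ _ _ _ _ _ _ _ k) => //.
    by move=> n; exact: joint_mf.
  exact: joint_mf.
Qed.

Lemma mixed_reflexive_norm r s : (1 < r)%R -> (1 < s)%R -> reflexive_norm mu (rho r s).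
Proof.
move=> r1 s1; split; first by apply: mixed_function_norm; exact: ltW.
- have [c c0 H] := mixed_norm_l1 m P r1 s1; exists c => // k mk k0.
  rewrite ge0_integral_trace; [|exact/measurable_EFinP|by move=> z; rewrite lee_fin].
  by apply: H => //; exact: joint_mf.
- have [c c0 H] := mixed_norm_disjoint m P r1 s1; exists c => // h k mh mk.
  by apply: H; exact: joint_mf.
- by move=> k C mk k0 C0 kC; exact: mixed_norm_dual.
Qed.

End mixed_norm_trace.

(** * The sigma-algebra of adapted sets *)

Section restricted_integral.
Context {R : realType} {d : measure_display} {T : measurableType d}.
Variables (mu : {measure set T -> \bar R}) (D : set T) (mD : measurable D).
Hypothesis moo : (mu D < +oo)%E.
Local Open Scope ereal_scope.

Lemma ge0_integral_mfrestr (f : T -> \bar R) : measurable_fun setT f ->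
  (forall x, 0 <= f x) -> \int[mfrestr mD moo]_x f x = \int[mu]_(x in D) f x.
Proof.
move=> mf f0; rewrite [RHS]integral_mkcond.
pose m1 : {measure set T -> \bar R} := mfrestr mD moo.
pose m2 : {measure set T -> \bar R} := mrestr mu (measurableC mD).
have mfD : measurable_fun setT (f \_ D).
  by apply/(measurable_restrictT _ mD); exact: measurable_funS mf.
have fD0 x : 0 <= (f \_ D) x by rewrite patchE; case: ifP.
have -> : \int[mfrestr mD moo]_x f x = \int[m1]_x (f \_ D) x.
  apply: ae_eq_integral => //; exists (~` D); split; first exact: measurableC.
    by rewrite /m1/= /mfrestr /mrestr setICl measure0.
  by move=> x /= h Dx; apply: h => _; rewrite patchE mem_set.
(* [mu] is the sum of its restrictions to [D] and to the complement of [D] *)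
rewrite [RHS](eq_measure_integral (measure_add m1 m2)); last first.
  move=> A mA _; rewrite [RHS](measure_addE m1 m2 A) /m1/m2/= /mfrestr /mrestr -measureU//.
  - by rewrite -setIUr setUCr setIT.
  - exact: measurableI.
  - by apply: measurableI => //; exact: measurableC.
  - by rewrite setIACA setICr setI0.
rewrite ge0_integral_measure_add// [X in _ + X](_ : _ = 0) ?adde0//.
rewrite (ae_eq_integral (cst 0))//; first exact: integral0.
exists D; split => //; first by rewrite /m2/= /mrestr setICr measure0.
by move=> x /= h; apply: contrapT => Dx; apply: h => _; rewrite patchE memNset.
Qed.

End restricted_integral.

Section adapted_sigma_algebra.
Context {R : realType} {d : measure_display} {Omega : measurableType d}.
Variables (P : probability Omega R) (F : R -> set_system Omega) (T : R).
Hypotheses (hF : complete_filtration P F) (T0 : 0 < T).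

Local Notation TO := (measurableTypeR R * Omega)%type.

(** Measurability for this sigma-algebra is joint measurability together with
    adaptedness at the times in (0, T). *)
Definition adapted_sets : set_system TO :=
  [set A | measurable A /\ forall t, 0 < t < T -> F t (xsection A t)].

Let sigmaF t : 0 < t < T -> sigma_algebra setT (F t).
Proof. by move=> /andP[/ltW t0 _]; exact: filtration_sigma_algebra hF _ t0. Qed.

Lemma adapted_sets_sigma : sigma_algebra setT adapted_sets.
Proof.
split.
- by split=> // t tT; rewrite xsection0; have [] := sigmaF tT.
- move=> A [mA sA]; split; first by rewrite setTD; exact: measurableC.
  move=> t tT; have [_ FC _] := sigmaF tT; rewrite xsectionD xsectionE preimage_setT.
  exact/FC/sA.
- move=> A AA; split; first by apply: bigcupT_measurable => n; have [] := AA n.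
  move=> t tT; rewrite xsection_bigcup; have [_ _ FU] := sigmaF tT.
  by apply: FU => n; have [_] := AA n; exact.
Qed.

Lemma adapted_sets_measurable : adapted_sets `<=` measurable.
Proof. by move=> A []. Qed.

Lemma adapted_sets_cylinder (A : set (measurableTypeR R)) : measurable A ->
  adapted_sets (A `*` setT).
Proof.
move=> mA; split; first exact: measurableX.
move=> t tT; have [F0 FC _] := sigmaF tT.
have [At|At] := pselect (A t).
  by rewrite in_xsectionX ?inE// -(setD0 setT); exact: FC.
by rewrite notin_xsectionX// notin_setE.
Qed.

Let mI : measurable (`]0, T[%classic : set (measurableTypeR R)).
Proof. exact: measurable_itv. Qed.

Let mIoo : (lebesgue_measure (`]0%R, T[%classic : set (measurableTypeR R)) < +oo)%E.
Proof. by rewrite lebesgue_measure_itv/= lte_fin T0 -EFinB ltey. Qed.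

Definition time_measure : {finite_measure set (measurableTypeR R) -> \bar R} :=
  mfrestr mI mIoo.

Lemma time_product_fin : ((time_measure \x P)%E setT < +oo)%E.
Proof.
rewrite -setXTT product_measure1E// [X in (_ * X)%E](probability_setT P) mule1.
by rewrite ltey_eq fin_num_measure.
Qed.

Local Notation Z := (g_sigma_algebraType adapted_sets).

Definition adapted_measure : {finite_measure set Z -> \bar R} :=
  trace_measure adapted_sets_measurable time_product_fin.

Lemma adapted_measurable (A : set Z) : measurable A = adapted_sets A.
Proof. by rewrite (measurable_g_measurableTypeE adapted_sets_sigma). Qed.

End adapted_sigma_algebra.

(** * Processes as functions on the adapted sigma-algebra *)

Section processes_as_functions.
Context {R : realType} {d : measure_display} {Omega : measurableType d}.
Variables (P : probability Omega R) (F : R -> set_system Omega) (T : R).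
Hypotheses (hF : complete_filtration P F) (T0 : 0 < T).

Local Notation TO := (measurableTypeR R * Omega)%type.
Local Notation Z := (g_sigma_algebraType (adapted_sets F T : set_system TO)).
Local Notation mu := (adapted_measure P F T0).
Local Notation m := (time_measure T0).
Local Notation rho := (mixed_norm m P).
Local Notation Zspace r s f := (@bspace R _ Z _ (rho r s) f).
Local Notation Znorm r s f := (@bnorm R _ Z _ (rho r s) f).

Let sigmaF t : 0 < t < T -> sigma_algebra setT (F t).
Proof. by move=> /andP[/ltW t0 _]; exact: filtration_sigma_algebra hF _ t0. Qed.

(** Values at times outside (0, T) do not matter; setting them to 0 makes a process a
    function on the whole product. *)
Definition extend (V : normedModType R) (u : R -> Omega -> V) : Z -> V :=
  fun z => if 0 < z.1 < T then u z.1 z.2 else 0.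

Definition curried (V : normedModType R) (f : Z -> V) : R -> Omega -> V :=
  fun t w => f (t, w).

Let joint d' (V : measurableType d') (f : Z -> V) :
  measurable_fun setT f -> measurable_fun setT (f : TO -> V).
Proof. by apply: trace_measurable_fun; exact: adapted_sets_measurable. Qed.

Lemma adapted_measurable_fun d' (V : measurableType d') (f : TO -> V) :
  measurable_fun setT f ->
  (forall t B, 0 < t < T -> measurable B -> F t [set w | B (f (t, w))]) ->
  measurable_fun setT (f : Z -> V).
Proof.
move=> mf sf _ B mB; rewrite setTI (adapted_measurable hF); split.
  by rewrite -[X in measurable X]setTI; exact: mf.
by move=> t tT; rewrite xsectionE; exact: sf.
Qed.

Lemma measurable_window : measurable ([set z | 0 < z.1 < T] : set Z).
Proof.
rewrite (adapted_measurable hF).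
rewrite (_ : [set _ | _] = `]0, T[%classic `*` setT).
  by apply: (adapted_sets_cylinder T hF); exact: measurable_itv.
by apply/seteqP; split => z /=; rewrite in_itv/=; [move=> ->|case].
Qed.

Section space.
Variable V : normedModType R.
Implicit Types (u v : R -> Omega -> V) (f : Z -> V).

Lemma extendE u t w : 0 < t < T -> extend u (t, w) = u t w.
Proof. by rewrite /extend /= => ->. Qed.

Lemma extend_lin a u v :
  extend (fun t w => a *: u t w + v t w) = (fun z => a *: extend u z + extend v z).
Proof. by apply/funext => z; rewrite /extend; case: ifP; rewrite // scaler0 addr0. Qed.

Lemma process_norm_curried r s f : 0 < r -> 0 < s -> smeas f ->
  process_norm P T r s (curried f) = Znorm r s f.
Proof.
move=> r0 s0 sf; rewrite /process_norm /bnorm /mixed_norm.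
have mf := joint (smeas_normr sf).
rewrite LnormE; last by move=> t; exact: slice_norm_ge0.
congr (_ `^ _)%E.
rewrite (@ge0_integral_mfrestr _ _ _ lebesgue_measure)//.
- by apply: measurable_poweR_comp; exact: measurable_slice_norm.
- by move=> t; exact: poweR_ge0.
Qed.

Lemma process_norm_extend r s u :
  process_norm P T r s u = process_norm P T r s (curried (extend u)).
Proof.
congr (_ `^ _)%E; apply: eq_integral => t; rewrite inE/= in_itv/= => tT.
congr (_ `^ _)%E; congr Lnorm; apply/funext => w.
by rewrite /curried extendE.
Qed.

Lemma process_normE r s u : 0 < r -> 0 < s -> smeas (extend u) ->
  process_norm P T r s u = Znorm r s (extend u).
Proof. by move=> r0 s0 su; rewrite process_norm_extend process_norm_curried. Qed.

(** The simple functions that approximate [u] on the product and those that approximate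
    [u t] at each time are unrelated. By [pettis] it is enough that the distances to a
    dense sequence be measurable for the adapted sigma-algebra, and this is checked
    separately on the product and on each section. *)
Lemma adapted_process_smeas u : adapted_process F T u -> smeas (extend u).
Proof.
move=> [[s [ss su]] au].
have mD : measurable (`]0, T[%classic `*` setT : set TO).
  by apply: measurableX => //; exact: measurable_itv.
have Dz (z : TO) : (`]0, T[%classic `*` setT) z = (0 < z.1 < T) :> Prop.
  by apply/propext; split => /=; rewrite in_itv/=; [move=> []|].
have jsu : @smeas _ TO V (extend u).
  exists (fun n z => if 0 < z.1 < T then s n z else 0); split=> [n|z _]; last first.
    rewrite /extend; case: ifP => zT; last exact: cvg_cst.
    by apply: su; rewrite Dz.
  have [fs ms] := ss n; split.
    have fs0 : finite_set (s n @` (`]0, T[%classic `*` setT) `|` [set 0]).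
      by rewrite finite_setU; split.
    apply: sub_finite_set fs0 => _ [z _ <-] /=.
    by case: ifP => zT; [left; exists z; rewrite ?Dz|right].
  move=> v; rewrite setTI.
  have := ms v; set D := _ `*` _ => mDv; have {}Dz z : D z = (0 < z.1 < T) :> Prop by exact: Dz.
  have [v0|v0] := pselect (v = 0).
    rewrite (_ : _ @^-1` _ = (D `&` s n @^-1` [set v]) `|` ~` D).
      by apply: measurableU => //; exact: measurableC.
    apply/seteqP; split => z /=.
      by case: ifP => zT; [left; split; rewrite ?Dz//|right; rewrite Dz zT].
    by case=> [[]|]; rewrite Dz; [move=> ->|move=> /negP/negbTE ->].
  rewrite (_ : _ @^-1` _ = D `&` s n @^-1` [set v])//.
  apply/seteqP; split => z /=; last by case; rewrite Dz => ->.
  by case: ifP => zT; [split; rewrite ?Dz//|move=> /esym].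
have [v [_ vd]] := smeas_separable jsu.
apply: (@pettis _ _ _ _ _ v) => [j|//].
apply: adapted_measurable_fun; first exact: smeas_norm_measurable.
move=> t B tT mB; have sFt := sigmaF tT.
have aut : @smeas _ (g_sigma_algebraType (F t)) V (u t).
  by have := au t tT; rewrite -{1}(measurable_g_measurableTypeE sFt).
have := smeas_norm_measurable (v j) aut measurableT mB.
rewrite setTI (measurable_g_measurableTypeE sFt).
by congr (F t _); apply/seteqP; split => w /=; rewrite extendE.
Qed.

Lemma smeas_adapted_process u : smeas (extend u) -> adapted_process F T u.
Proof.
move=> [s [ss su]].
have mD : measurable (`]0, T[%classic `*` setT : set TO).
  by apply: measurableX => //; exact: measurable_itv.
split.
  exists s; split=> [n|z Dz].
    have [fs ms] := ss n; split.
      by apply: sub_finite_set fs; exact: image_subset.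
    move=> v; apply: measurableI => //.
    by have := ms v; rewrite setTI; apply: trace_measurable; exact: adapted_sets_measurable.
  have := su z Logic.I; rewrite /extend.
  by case: Dz; rewrite /= in_itv/= => ->.
move=> t tT; exists (fun n w => s n (t, w)); split=> [n|w _]; last first.
  by have := su (t, w) Logic.I; rewrite extendE.
have [fs ms] := ss n; split.
  by apply: sub_finite_set fs => _ [w _ <-]; exists (t, w).
move=> v; have := ms v; rewrite !setTI (adapted_measurable hF) => -[_ /(_ t tT)].
by rewrite xsectionE.
Qed.

Lemma in_LF_bspace r s u : 0 < r -> 0 < s ->
  in_LF P F T r s u <-> Zspace r s (extend u).
Proof.
move=> r0 s0; split=> [[au un]|[su un]].
  have su := adapted_process_smeas au.
  by split=> //; rewrite -(process_normE r0 s0 su).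
by split; [exact: smeas_adapted_process|rewrite process_normE].
Qed.

Lemma extend_curried f z : extend (curried f) z = (\1_[set z : Z | 0 < z.1 < T] z : R) *: f z.
Proof.
rewrite indicE /extend /curried; case: ifP => zT.
  by rewrite mem_set// scale1r; case: z zT.
by rewrite memNset ?scale0r//= zT.
Qed.

Lemma bspace_in_LF r s f : 1 <= r -> 1 <= s -> Zspace r s f ->
  in_LF P F T r s (curried f).
Proof.
move=> r1 s1 bf; apply/in_LF_bspace; rewrite ?(lt_le_trans ltr01)//.
rewrite (_ : extend _ = (fun z => (\1_[set z : Z | 0 < z.1 < T] z : R) *: f z)); last first.
  by apply/funext => z; exact: extend_curried.
apply: (bspace_indic (mu := mu)) => //.
  exact: mixed_function_norm.
exact: measurable_window.
Qed.

Lemma ae_eq_curried u : ae_eq_process P T (curried (extend u)) u.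
Proof. by apply: aeW => z zT; rewrite /curried extendE. Qed.

End space.

(** A null set of the product is completed to a null set of the adapted sigma-algebra by
    adding the times at which its section is not negligible; the other sections belong
    to the filtration as it is complete. *)
Lemma ae_prod_adapted (Q : R -> Omega -> Prop) : ae_prod P T Q ->
  {ae mu, forall z, 0 < z.1 < T -> Q z.1 z.2}.
Proof.
move=> [A [mA A0 QA]].
have mPA := measurable_fun_xsection P mA.
pose N := [set t : measurableTypeR R | P (xsection A t) != 0%E].
have mN : measurable N.
  have := mPA measurableT _ (measurableC (emeasurable_set1 0%E)); rewrite setTI.
  by congr measurable; apply/seteqP; split => t /= /eqP.
have Nleb : lebesgue_measure N = 0%E.
  apply/negligibleP => //.
  have /(ae_eq_integral_abs _ measurableT mPA) : (\int[lebesgue_measure]_t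
      `|(P \o xsection A) t| = 0)%E.
    by rewrite -[RHS]A0; apply: eq_integral => t _; rewrite gee0_abs.
  by apply: negligibleS => t /= Nt h; move/negP: Nt; apply; apply/eqP; exact: h.
have Nm : m N = 0%E.
  apply/eqP; rewrite -measure_le0 -Nleb; apply: le_measure; rewrite ?inE//.
  exact: measurableI.
have Am : (m \x P)%E A = 0%E.
  have -> : (m \x P)%E A = (\int[m]_t (cst 0 t))%E; last exact: integral0.
  apply: ae_eq_integral => //; exists N; split => // t /= h.
  by apply/negP => /eqP Pt; apply: h.
have NTm : (m \x P)%E (N `*` setT) = 0%E.
  by rewrite product_measure1E// [X in (X * _)%E]Nm mul0e.
exists (A `|` N `*` setT); split.
- rewrite (adapted_measurable hF); split.
    by apply: measurableU => //; exact: measurableX.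
  move=> t tT; have [F0 FC FU] := sigmaF tT.
  have [Nt|Nt] := pselect (N t).
    rewrite (_ : xsection _ t = setT); last first.
      by apply/seteqP; split => // w _; rewrite xsectionE/=; right.
    by rewrite -(setD0 setT); exact: FC.
  rewrite (_ : xsection _ t = xsection A t); last first.
    by apply/seteqP; split => w; rewrite !xsectionE/=; [case=> // -[]|left].
  have t0 : 0 <= t by case/andP: tT => /ltW.
  apply: (filtration_homo hF (lexx 0) t0); apply: (filtration_null hF).
  exists (xsection A t); split => //; first exact: measurable_xsection.
  by apply/eqP; move/negP: Nt; rewrite negbK.
- exact: (null_set_setU mA (measurableX mN measurableT) Am NTm).
by move=> z /= Qz; left; apply: QA => h; apply: Qz.
Qed.

End processes_as_functions.

Section ae_prod.
Context {R : realType} {d : measure_display} {Omega : measurableType d}.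
Variables (P : probability Omega R) (T : R).
Implicit Types Q : R -> Omega -> Prop.

Let ae_filter := ae_filter_ringOfSetsType (@lebesgue_measure R \x P)%E.

Lemma ae_prodS Q Q' : (forall t w, 0 < t < T -> Q t w -> Q' t w) ->
  ae_prod P T Q -> ae_prod P T Q'.
Proof.
by move=> QQ'; apply: (@filterS _ _ ae_filter) => z h zT; apply: QQ' => //; exact: h.
Qed.

Lemma ae_prodS2 Q1 Q2 Q : (forall t w, 0 < t < T -> Q1 t w -> Q2 t w -> Q t w) ->
  ae_prod P T Q1 -> ae_prod P T Q2 -> ae_prod P T Q.
Proof.
move=> QQ; apply: (@filterS2 _ _ ae_filter) => z h1 h2 zT.
by apply: QQ => //; [exact: h1|exact: h2].
Qed.

End ae_prod.

Section transfer.
Context {R : realType} {d : measure_display} {Omega : measurableType d}.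
Variables (P : probability Omega R) (F : R -> set_system Omega) (T : R).
Hypotheses (hF : complete_filtration P F) (T0 : 0 < T).

Local Notation TO := (measurableTypeR R * Omega)%type.
Local Notation Z := (g_sigma_algebraType (adapted_sets F T : set_system TO)).
Local Notation mu := (adapted_measure P F T0).
Local Notation rho := (mixed_norm (time_measure T0) P).
Local Notation Zspace r s f := (@bspace R _ Z _ (rho r s) f).
Local Notation Znorm r s f := (@bnorm R _ Z _ (rho r s) f).

Lemma process_function_norm r s : 1 <= r -> 1 <= s -> function_norm mu (rho r s).
Proof. exact: mixed_function_norm. Qed.

Lemma process_reflexive_norm r s : 1 < r -> 1 < s -> reflexive_norm mu (rho r s).
Proof. by apply: mixed_reflexive_norm; exact: adapted_sets_cylinder hF. Qed.

Section space.
Variables (V : normedModType R) (r s : R).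
Hypotheses (r1 : 1 <= r) (s1 : 1 <= s).
Implicit Types u v : R -> Omega -> V.
Local Notation LF u := (in_LF P F T r s u).
Local Notation pn u := (process_norm P T r s u).
Local Notation ext u := (extend u : Z -> V).

Let r0 : 0 < r. Proof. exact: lt_le_trans r1. Qed.
Let s0 : 0 < s. Proof. exact: lt_le_trans s1. Qed.
Let fn := process_function_norm r1 s1.

Lemma in_LF_extend u : LF u <-> Zspace r s (ext u).
Proof. exact: in_LF_bspace. Qed.

Lemma LF_process_norm u : LF u -> pn u = Znorm r s (ext u).
Proof. by move=> /in_LF_extend[su _]; exact: process_normE. Qed.

Lemma in_LF_lin a u v : LF u -> LF v -> LF (fun t w => a *: u t w + v t w).
Proof.
move=> /in_LF_extend bu /in_LF_extend bv; apply/in_LF_extend.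
by rewrite extend_lin; apply: (bspaceD fn) => //; exact: (bspaceZ fn).
Qed.

Lemma process_norm_ae u v : LF u -> LF v -> ae_eq_process P T u v -> pn u = pn v.
Proof.
move=> lu lv uv; have [su _] := (in_LF_extend u).1 lu; have [sv _] := (in_LF_extend v).1 lv.
rewrite !LF_process_norm//; apply: (bnorm_ae fn) => //.
have aeuv := ae_prod_adapted hF T0 uv.
apply: (@filterS _ _ (ae_filter_ringOfSetsType mu) _ _ _ aeuv) => z.
by rewrite /extend; case: ifP => // _; exact.
Qed.

Lemma in_LF0 : LF (fun _ _ => 0 : V).
Proof.
apply/in_LF_extend; rewrite (_ : extend _ = (fun _ : Z => 0 : V)); first exact: (bspace0 fn).
by apply/funext => z; rewrite /extend; case: ifP.
Qed.

Lemma process_norm0 : pn (fun _ _ => 0 : V) = 0%E.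
Proof.
rewrite (LF_process_norm in_LF0) (_ : extend _ = (fun _ : Z => (0 : R) *: (0 : V))).
  by rewrite (bnormZ fn) ?normr0 ?mul0e//; exact: smeas_cst.
by apply/funext => z; rewrite /extend scaler0; case: ifP.
Qed.

Lemma in_LFZ a u : LF u -> LF (fun t w => a *: u t w).
Proof.
move=> lu; have := in_LF_lin a lu in_LF0.
by congr in_LF; apply/funext => t; apply/funext => w; rewrite addr0.
Qed.

Lemma process_normZ a u : LF u -> pn (fun t w => a *: u t w) = (`|a|%:E * pn u)%E.
Proof.
move=> lu; have [su _] := (in_LF_extend u).1 lu.
rewrite (LF_process_norm (in_LFZ a lu)) (LF_process_norm lu) -(bnormZ fn)//.
by congr bnorm; apply/funext => z; rewrite /extend; case: ifP; rewrite // scaler0.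
Qed.

Lemma LF_dual_ae (Lam : (R -> Omega -> V) -> R) u v : LF_dual P F T r s Lam -> LF u -> LF v ->
  ae_eq_process P T u v -> Lam u = Lam v.
Proof.
move=> [lin [C LC]] lu lv uv.
pose e t w := -1 *: v t w + u t w.
have le : LF e by exact: in_LF_lin.
have e0 : pn e = 0%E.
  rewrite -process_norm0; apply: process_norm_ae => //; first exact: in_LF0.
  by apply: ae_prodS uv => t w _ uv; rewrite /e uv scaleN1r addNr.
have := LC e le; rewrite e0 mule0 lee_fin normr_le0 => /eqP.
by rewrite lin// mulN1r => /eqP; rewrite addrC subr_eq0 => /eqP.
Qed.

Lemma LF_dual_bdual (Lam : (R -> Omega -> V) -> R) : LF_dual P F T r s Lam ->
  @bdual R _ Z _ (rho r s) (fun f => Lam (curried f)).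
Proof.
move=> [lin [C LC]]; split=> [a f g bf bg|].
  by rewrite -lin//; exact: (bspace_in_LF hF).
exists C => f bf; have := LC _ (bspace_in_LF hF r1 s1 bf).
by rewrite (process_norm_curried _ _ r0 s0)//; have [] := bf.
Qed.

End space.

Section operator_bound.
Variables (X Y : normedModType R) (p1 p2 q1 q2 : R).
Hypotheses (p11 : 1 <= p1) (p21 : 1 <= p2) (q11 : 1 <= q1) (q21 : 1 <= q2).
Variable G : (R -> Omega -> X) -> R -> Omega -> Y.
Hypothesis bG : LF_bounded_operator P F T p1 p2 q1 q2 G.

Lemma LF_opnorm_ge0 : (0 <= LF_opnorm P F T p1 p2 q1 q2 G)%E.
Proof.
have l0 : in_LF P F T p1 p2 (fun _ _ => 0 : X) by exact: in_LF0.
apply: le_trans (ereal_sup_ubound _).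
  2: by exists (fun _ _ => 0) => //; split=> //; rewrite process_norm0 ?lee01.
exact: poweR_ge0.
Qed.

(** By scaling to the unit sphere; where the norm of [u] is 0 the boundedness of [G] is
    used. *)
Lemma LF_opnorm_bound (C : R) u : (LF_opnorm P F T p1 p2 q1 q2 G <= C%:E)%E ->
  in_LF P F T p1 p2 u ->
  (process_norm P T q1 q2 (G u) <= C%:E * process_norm P T p1 p2 u)%E.
Proof.
move=> GC lu; have lGu := LF_operator_in bG lu.
have pn0 : (0 <= process_norm P T p1 p2 u)%E by exact: poweR_ge0.
have pfin : process_norm P T p1 p2 u \is a fin_num.
  by rewrite ge0_fin_numE//; have [] := lu.
have := pn0; rewrite le_eqVlt => /predU1P[pu0|pu].
  by have [C' /(_ u lu)] := LF_operator_bounded bG; rewrite -pu0 !mule0.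
pose x := fine (process_norm P T p1 p2 u).
have xE : process_norm P T p1 p2 u = x%:E by rewrite fineK.
have x0 : 0 < x by rewrite -lte_fin -xE.
pose v t w := x^-1 *: u t w.
have lv : in_LF P F T p1 p2 v by exact: in_LFZ.
have v1 : (process_norm P T p1 p2 v <= 1)%E.
  by rewrite process_normZ// xE -EFinM gtr0_norm ?invr_gt0// mulVf// gt_eqF.
have Gv : ae_eq_process P T (G v) (fun t w => x^-1 *: G u t w).
  (* linearity is stated for [a *: u + v], hence [x^-1 *: u] as [(x^-1 - 1) *: u + u] *)
  have := LF_operator_linear bG (x^-1 - 1) lu lu.
  rewrite (_ : (fun t w => _) = v); last first.
    by apply/funext => t; apply/funext => w; rewrite /v scalerBl scale1r subrK.
  by apply: ae_prodS => t w _ ->; rewrite scalerBl scale1r subrK.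
have vC : (process_norm P T q1 q2 (G v) <= C%:E)%E.
  by apply: le_trans GC; apply: ereal_sup_ubound; exists v.
have lGv := LF_operator_in bG lv; have lxGu := in_LFZ q11 q21 x^-1 lGu.
move: vC; rewrite (process_norm_ae q11 q21 lGv lxGu Gv).
rewrite process_normZ// gtr0_norm ?invr_gt0//.
by rewrite xE lee_pdivrMl// muleC.
Qed.

End operator_bound.
(** Through [curried] and [extend] the operators act on functions for the adapted sigma-
    algebra, and [pointwise_weak_compactness] applies to them. *)
Lemma LF_pointwise_weak_compactness (X Y : normedModType R) (p1 p2 q1 q2 C : R)
    (G_ : nat -> (R -> Omega -> X) -> R -> Omega -> Y) :
  separable X -> reflexive_space Y -> 1 <= p1 -> 1 <= p2 -> 1 < q1 -> 1 < q2 -> 0 <= C ->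
  (forall n, L_pd P F T p1 p2 q1 q2 (G_ n)) ->
  (forall n, LF_opnorm P F T p1 p2 q1 q2 (G_ n) <= C%:E)%E ->
  exists (n_ : nat -> nat) (L : R -> Omega -> {linear X -> Y}),
    [/\ {homo n_ : i j / (i < j)%N}, forall t w, continuous (L t w) &
      forall u, in_LF P F T p1 p2 u ->
        [/\ in_LF P F T q1 q2 (fun t w => L t w (u t w)),
            (process_norm P T q1 q2 (fun t w => L t w (u t w)) <=
             C%:E * process_norm P T p1 p2 u)%E &
            LF_weak_cvg P F T q1 q2 (fun k => G_ (n_ k) u) (fun t w => L t w (u t w))]].
Proof.
move=> hX hY p11 p21 q11 q21 C0 hG GC.
have [q1' q2'] := (ltW q11, ltW q21).
have bG n : LF_bounded_operator P F T p1 p2 q1 q2 (G_ n) by have [] := hG n.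
have [L_ L_P] : exists L_ : nat -> R -> Omega -> {linear X -> Y}, forall n u,
    in_LF P F T p1 p2 u -> ae_prod P T (fun t w => G_ n u t w = L_ n t w (u t w)).
  have /choice[L_ hL] : forall n, exists L : R -> Omega -> {linear X -> Y}, forall u,
      in_LF P F T p1 p2 u -> ae_prod P T (fun t w => G_ n u t w = L t w (u t w)).
    by move=> n; have [_ [L _ hL]] := hG n; exists L.
  by exists L_.
have inX (f : Z -> X) : Zspace p1 p2 f -> in_LF P F T p1 p2 (curried f).
  exact: (bspace_in_LF hF).
have inG n (f : Z -> X) : Zspace p1 p2 f -> in_LF P F T q1 q2 (G_ n (curried f)).
  by move=> bf; apply: (LF_operator_in (bG n)); exact: inX.
pose Tn n (f : Z -> X) : Z -> Y := extend (G_ n (curried f)).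
pose Ln n (z : Z) : {linear X -> Y} := if 0 < z.1 < T then L_ n z.1 z.2 else \0.
have Tin n (f : Z -> X) : Zspace p1 p2 f -> Zspace q1 q2 (Tn n f).
  by move=> bf; apply/(in_LF_extend q1' q2'); exact: inG.
have Tae n (f : Z -> X) : Zspace p1 p2 f -> {ae mu, forall z, Tn n f z = Ln n z (f z)}.
  move=> bf; have := ae_prod_adapted hF T0 (L_P n _ (inX _ bf)).
  apply: (@filterS _ _ (ae_filter_ringOfSetsType mu)) => z.
  rewrite /Tn /extend /Ln; case: ifP => [zT /(_ isT) ->|//].
  by rewrite /curried; case: z {zT}.
have TC n (f : Z -> X) : Zspace p1 p2 f -> (Znorm q1 q2 (Tn n f) <= C%:E * Znorm p1 p2 f)%E.
  move=> bf; rewrite -(LF_process_norm q1' q2')//; last exact: inG.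
  have := LF_opnorm_bound p11 p21 q1' q2' (bG n) (GC n) (inX _ bf).
  rewrite (process_norm_curried _ _ (lt_le_trans ltr01 p11) (lt_le_trans ltr01 p21))//.
  by have [] := bf.
have [n_ [L [nmono cL HL]]] := pointwise_weak_compactness (process_function_norm p11 p21)
  (process_reflexive_norm q11 q21) hX hY C0 Tin Tae TC.
exists n_, (fun t w => L (t, w)); split => // u lu.
pose Gu t w := L (t, w) (u t w).
have extG : extend Gu = (fun z => L z (extend u z)) :> (Z -> Y).
  by apply/funext => z; rewrite /extend; case: ifP => _; [case: z|rewrite linear0].
have [bGu GuC cv] := HL (extend u) ((in_LF_extend p11 p21 u).1 lu).
have lGu : in_LF P F T q1 q2 Gu by apply/(in_LF_extend q1' q2'); rewrite extG.
split => //; first by rewrite (LF_process_norm q1' q2' lGu) (LF_process_norm p11 p21 lu) extG.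
move=> Lam dLam; have := cv _ (LF_dual_bdual q1' q2' dLam).
have eqe (V : normedModType R) (v : R -> Omega -> V) :
  ae_eq_process P T (curried (extend v : Z -> V)) v by exact: ae_eq_curried.
rewrite -extG (LF_dual_ae q1' q2' dLam _ lGu)//; last first.
  by apply: (bspace_in_LF hF q1' q2'); rewrite extG.
move=> cvl; apply: cvg_trans cvl; apply: near_eq_cvg; apply: nearW => k.
have lcu : in_LF P F T p1 p2 (curried (extend u : Z -> X)).
  by apply: inX; exact/in_LF_extend.
have lTu : in_LF P F T q1 q2 (curried (Tn (n_ k) (extend u))).
  apply: (bspace_in_LF hF q1' q2'); apply: Tin; exact/in_LF_extend.
apply: (LF_dual_ae q1' q2' dLam lTu (LF_operator_in (bG _) lu)).
have e1 := eqe Y (G_ (n_ k) (curried (extend u : Z -> X))).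
have e2 := LF_operator_ae (bG (n_ k)) lcu lu (eqe X u).
by apply: ae_prodS2 e1 e2 => t w _ /= <- <-.
Qed.

End transfer.

Theorem theorem5p1 (R : realType) (d : measure_display)
  (Omega : measurableType d) (P : probability Omega R)
  (F : R -> set_system Omega) (T : R) (X Y : completeNormedModType R)
  (p p1 p2 q1 q2 : R)
  (G_ : nat -> (R -> Omega -> X) -> R -> Omega -> Y)
  (hF : complete_filtration P F) (hT : 0 < T)
  (hX : separable X) (hY : reflexive_space Y)
  (hp : 1 <= p) (hLp : separable_Lp P (F T) p)
  (hp1 : 1 <= p1) (hp2 : 1 <= p2) (hq1 : 1 < q1) (hq2 : 1 < q2)
  (hG : forall n, L_pd P F T p1 p2 q1 q2 (G_ n))
  (hbound : (ereal_sup (range (fun n => LF_opnorm P F T p1 p2 q1 q2 (G_ n)))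
             < +oo)%E) :
  exists (n_ : nat -> nat) (G : (R -> Omega -> X) -> R -> Omega -> Y),
    [/\ {homo n_ : i j / (i < j)%N},
        L_pd P F T p1 p2 q1 q2 G,
        (forall u, in_LF P F T p1 p2 u ->
           LF_weak_cvg P F T q1 q2 (fun k => G_ (n_ k) u) (G u)) &
        (LF_opnorm P F T p1 p2 q1 q2 G <=
         ereal_sup (range (fun n => LF_opnorm P F T p1 p2 q1 q2 (G_ n))))%E].
Proof.
set S := ereal_sup _ in hbound *.
have opS n : (LF_opnorm P F T p1 p2 q1 q2 (G_ n) <= S)%E.
  by apply: ereal_sup_ubound; exists n.
have S0 : (0 <= S)%E.
  exact: le_trans (LF_opnorm_ge0 hF hT q1 q2 hp1 hp2 (G_ 0%N)) (opS 0%N).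
have SE : S = (fine S)%:E by rewrite fineK// ge0_fin_numE.
have C0 : 0 <= fine S by exact: fine_ge0.
have opC n : (LF_opnorm P F T p1 p2 q1 q2 (G_ n) <= (fine S)%:E)%E by rewrite -SE.
have [n_ [L [nmono cL HL]]] :=
  LF_pointwise_weak_compactness hF hT hX hY hp1 hp2 hq1 hq2 C0 hG opC.
exists n_, (fun u t w => L t w (u t w)); split => //.
- split; last by exists L => // u lu; exact: aeW.
  split.
  + by move=> u lu; have [] := HL u lu.
  + by move=> u v lu lv; apply: ae_prodS => t w _ ->.
  + by move=> a u v lu lv; apply: aeW => z _; rewrite linearP.
  + by exists (fine S) => u lu; have [] := HL u lu.
- by move=> u lu; have [] := HL u lu.
apply: ub_ereal_sup => _ [u [lu u1] <-].
have [_ uC _] := HL u lu; apply: le_trans uC _.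
rewrite -SE -[leRHS]mule1; exact: lee_wpmul2l.
Qed.
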